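(* Let $G$ be a series parallel digraph on $n$ vertices. There is an algorithm that computes in time $\mathcal{O}(n^2)$ the cutwidth of $G$, and outputs a topological ordering of $G$ that achieves it (i.e. whose cutwidth equals the cutwidth of $G$).
   Context: Digraphs may have parallel arcs (multidigraphs). A topological order of a directed acyclic graph $G$ on $n$ vertices is a bijection $\sigma: V(G)\to[n]$ with $\sigma(u)<\sigma(v)$ for every arc $uv$. The cutwidth of $\sigma$ is $\max_{i\in[n-1]} |\{uv\in A(G): \sigma(u)\le i,\ \sigma(v)>i\}|$ (arcs counted with multiplicity), and the cutwidth of $G$ is the minimum cutwidth over all topological orders of $G$. A series parallel digraph (SPD) is a (multi)digraph $G$ with an ordered pair of terminals $(s,t)$ defined recursively: a single arc from $s$ to $t$ (with $V=\{s,t\}$) is an SPD; if $(G_1,(s_1,t_1))$ and $(G_2,(s_2,t_2))$ are SPDs, then so is their series composition (disjoint union with $t_1$ and $s_2$ identified, terminals $(s_1,t_2)$) and their parallel composition (disjoint union with $s_1,s_2$ identified and $t_1,t_2$ identified, terminals $(s_1,t_1)$). *)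

(* Defs.v *)
From HB Require Import structures.
From mathcomp Require Import all_boot all_fingroup.

Set Implicit Arguments.
Unset Strict Implicit.
Unset Printing Implicit Defensive.

(* Multidigraphs on the vertex set 'I_n.  Arcs are objects of their own, so
   parallel arcs are distinct elements of [arc G]. *)
Record mdigraph (n : nat) := MDigraph {
  arc : finType;
  src : arc -> 'I_n;
  dst : arc -> 'I_n
}.

(* Positions are numbered from 0: the position of v in 1..n is (sigma v).+1. *)
Definition topological (n : nat) (G : mdigraph n) (sigma : 'S_n) : Prop :=
  forall a : arc G, sigma (src a) < sigma (dst a).

(* With positions numbered from 0, "position <= i" reads sigma u < i, and
   "position > i" reads i <= sigma v. *)
Definition order_cutwidth (n : nat) (G : mdigraph n) (sigma : 'S_n) : nat :=
  \max_(1 <= i < n)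
     #|[set a : arc G | (sigma (src a) < i) && (i <= sigma (dst a))]|.

Definition is_cutwidth (n : nat) (G : mdigraph n) (k : nat) : Prop :=
  (exists2 sigma : 'S_n, topological G sigma & order_cutwidth G sigma = k) /\
  (forall sigma : 'S_n, topological G sigma -> k <= order_cutwidth G sigma).

(* G is, up to isomorphism, the disjoint union of G1 and G2 in which x in G1 and
   y in G2 are identified exactly when [ident x y] holds; f1 and f2 are the
   canonical maps on vertices, and g the bijection from the disjoint union of
   the arc sets to the arcs of G. *)
Definition gluing (n1 n2 n : nat)
    (G1 : mdigraph n1) (G2 : mdigraph n2) (G : mdigraph n)
    (f1 : 'I_n1 -> 'I_n) (f2 : 'I_n2 -> 'I_n)
    (ident : 'I_n1 -> 'I_n2 -> Prop) : Prop :=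
  [/\ injective f1,
      injective f2,
      forall v : 'I_n, (exists x, f1 x = v) \/ (exists y, f2 y = v),
      forall x y, f1 x = f2 y <-> ident x y
    & exists g : arc G1 + arc G2 -> arc G,
        [/\ bijective g,
            forall a, src (g (inl a)) = f1 (src a) /\
                      dst (g (inl a)) = f1 (dst a)
          & forall a, src (g (inr a)) = f2 (src a) /\
                      dst (g (inr a)) = f2 (dst a)]].

Inductive spd : forall n : nat, mdigraph n -> 'I_n -> 'I_n -> Prop :=
| spd_arc (G : mdigraph 2) (s t : 'I_2) :
    s != t -> #|arc G| = 1 -> (forall a : arc G, src a = s /\ dst a = t) ->
    spd G s t
| spd_series (n1 n2 n : nat)
    (G1 : mdigraph n1) (G2 : mdigraph n2) (G : mdigraph n)
    (s1 t1 : 'I_n1) (s2 t2 : 'I_n2) (f1 : 'I_n1 -> 'I_n) (f2 : 'I_n2 -> 'I_n) :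
    spd G1 s1 t1 -> spd G2 s2 t2 ->
    gluing G1 G2 G f1 f2 (fun x y => x = t1 /\ y = s2) ->
    spd G (f1 s1) (f2 t2)
| spd_parallel (n1 n2 n : nat)
    (G1 : mdigraph n1) (G2 : mdigraph n2) (G : mdigraph n)
    (s1 t1 : 'I_n1) (s2 t2 : 'I_n2) (f1 : 'I_n1 -> 'I_n) (f2 : 'I_n2 -> 'I_n) :
    spd G1 s1 t1 -> spd G2 s2 t2 ->
    gluing G1 G2 G f1 f2
      (fun x y => (x = s1 /\ y = s2) \/ (x = t1 /\ y = t2)) ->
    spd G (f1 s1) (f1 t1).

Definition is_spd (n : nat) (G : mdigraph n) : Prop :=
  exists s t : 'I_n, spd G s t.

(* Random access machine with the uniform cost criterion, programmed in
   structured form.  The only arithmetic is addition, truncated subtraction and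
   comparison: multiplication at unit cost would make the model unreasonably
   powerful. *)
Inductive expr :=
| Cst of nat
| Reg of nat
| Fetch of expr
| Add of expr & expr
| Sub of expr & expr
| Less of expr & expr
| Equal of expr & expr.

Inductive cmd :=
| Skip
| Assign of nat & expr
| Store of expr & expr
| Seq of cmd & cmd
| If of expr & cmd & cmd
| While of expr & cmd.

Record state := State { regs : nat -> nat; cells : nat -> nat }.

Fixpoint eval (st : state) (e : expr) : nat :=
  match e with
  | Cst k => k
  | Reg r => regs st r
  | Fetch e1 => cells st (eval st e1)
  | Add e1 e2 => eval st e1 + eval st e2
  | Sub e1 e2 => eval st e1 - eval st e2
  | Less e1 e2 => nat_of_bool (eval st e1 < eval st e2)
  | Equal e1 e2 => nat_of_bool (eval st e1 == eval st e2)
  end.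

Fixpoint ecost (e : expr) : nat :=
  match e with
  | Cst _ | Reg _ => 1
  | Fetch e1 => (ecost e1).+1
  | Add e1 e2 | Sub e1 e2 | Less e1 e2 | Equal e1 e2 => (ecost e1 + ecost e2).+1
  end.

(* [exec c st T st']: started in st, the command c halts in st' after T unit
   operations. *)
Inductive exec : cmd -> state -> nat -> state -> Prop :=
| exec_skip st : exec Skip st 1 st
| exec_assign r e st :
    exec (Assign r e) st (ecost e).+1
         (State [eta regs st with r |-> eval st e] (cells st))
| exec_store e1 e2 st :
    exec (Store e1 e2) st (ecost e1 + ecost e2).+1
         (State (regs st) [eta cells st with eval st e1 |-> eval st e2])
| exec_seq c1 c2 st T1 st1 T2 st2 :
    exec c1 st T1 st1 -> exec c2 st1 T2 st2 ->
    exec (Seq c1 c2) st (T1 + T2) st2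
| exec_if_true e c1 c2 st T st' :
    eval st e != 0 -> exec c1 st T st' ->
    exec (If e c1 c2) st ((ecost e).+1 + T) st'
| exec_if_false e c1 c2 st T st' :
    eval st e = 0 -> exec c2 st T st' ->
    exec (If e c1 c2) st ((ecost e).+1 + T) st'
| exec_while_true e c st T1 st1 T2 st2 :
    eval st e != 0 -> exec c st T1 st1 -> exec (While e c) st1 T2 st2 ->
    exec (While e c) st ((ecost e).+1 + T1 + T2) st2
| exec_while_false e c st :
    eval st e = 0 -> exec (While e c) st (ecost e).+1 st.

Definition initial_state (w : seq nat) : state :=
  State (fun _ => 0) (nth 0 w).

Definition multiplicity (n : nat) (G : mdigraph n) (u v : 'I_n) : nat :=
  #|[set a : arc G | (src a == u) && (dst a == v)]|.

(* The number of vertices, then the matrix of arc multiplicities row by row. *)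
Definition input_word (n : nat) (G : mdigraph n) : seq nat :=
  n :: [seq multiplicity G u v | u <- enum 'I_n, v <- enum 'I_n].

(* The cutwidth, then the position of each vertex. *)
Definition output_word (n : nat) (k : nat) (sigma : 'S_n) : seq nat :=
  k :: [seq nat_of_ord (sigma v) | v <- enum 'I_n].

(* Main.v *)
(* Give every vertex the weight outdegree minus indegree: the cutwidth of a
   topological order is its maximal prefix sum.  As long as possible, take a
   vertex v with a single in-neighbour u and a single out-neighbour w, and
   contract it into an arc from u to w labelled with the chain of all the
   vertices contracted so far between u and w.  When an arc from u to w already
   exists, the two chains between u and w are merged: first each chain is cut
   into blocks, two consecutive blocks being glued whenever the second should
   come first by Johnson's rule; then the two sorted lists of blocks are merged.
   Exchange arguments show that both operations preserve the optimum, since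
   everything that an order places between two consecutive blocks of a chain can
   be moved past one of them.  A series-parallel digraph on n vertices always
   shrinks to a single arc in n - 2 contractions, whichever are chosen, because
   contractions commute; the label of this arc is an optimal order.  A
   contraction takes time O(n): the numbers and the sums of the neighbours of
   each vertex are maintained under contraction and reveal v, u and w. *)

Require Import Defs.
From HB Require Import structures.
From mathcomp Require Import all_boot all_fingroup zify.
(* [Defs.arc] and [Defs.Sub] are shadowed by MathComp. *)
Import Defs.
Set Implicit Arguments.
Unset Strict Implicit.
Unset Printing Implicit Defensive.

(** The rest of the digraph is not yet arranged when two chains are merged, so a merge must be
    optimal in every environment. [better] therefore compares the maximal prefix sum and also
    requires equal totals, which makes it stable under any context. What an order places between two
    blocks of a chain is a single sequence with its own key. If the second block should come first
    by Johnson's rule, totality and transitivity of the rule let this sequence move before the first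
    block or behind the second, whatever it contains. Such moves keep the relative order of all
    vertices outside the two chains, so the constraints of the other arcs survive.

    Labels record chains but not blocks. At each contraction the blocks are recomputed in linear
    time with a stack, and each vertex receives the key of its block; merging two lists of blocks
    then amounts to merging two lists of vertices. The weights come from the original arcs and never
    change, so parallel arcs only matter for the initial degrees. *)

(** * The bicyclic monoid and Johnson's order *)

(* A pair (p, q) stands for a sequence with maximal prefix sum p and total
   p - q; [bmul] is concatenation (the product of the bicyclic monoid), and the
   truncated subtractions are meant as such. *)
Definition bmul (x y : nat * nat) : nat * nat :=
  (x.1 + (y.1 - x.2), y.2 + (x.2 - y.1)).

(** The totals take part in the comparison because a total shifts every later prefix sum. Their
    equality is written without subtraction. *)
Definition dom (x y : nat * nat) : Prop :=
  x.1 <= y.1 /\ x.1 + y.2 = y.1 + x.2.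

(* Johnson's rule: sequences of negative total first, by increasing p, then the
   others, by decreasing q. *)
Definition key_le (x y : nat * nat) : bool :=
  if x.1 < x.2 then (y.2 <= y.1) || (x.1 <= y.1)
  else (y.2 <= y.1) && (y.2 <= x.2).

Lemma bmulA : associative bmul.
Proof. by case=> a b [c d] [e f]; rewrite /bmul /=; f_equal; lia. Qed.

Lemma bmul0l x : bmul (0, 0) x = x.
Proof. by case: x => a b; rewrite /bmul /=; f_equal; lia. Qed.

Lemma bmul0r x : bmul x (0, 0) = x.
Proof. by case: x => a b; rewrite /bmul /=; f_equal; lia. Qed.

Lemma dom_refl x : dom x x.
Proof. by []. Qed.

Lemma dom_trans x y z : dom x y -> dom y z -> dom x z.
Proof. by move: x y z => [a b] [c d] [e f]; rewrite /dom /=; lia. Qed.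

Lemma dom_bmul x x' y y' :
  dom x x' -> dom y y' -> dom (bmul x y) (bmul x' y').
Proof.
by move: x x' y y' => [a b] [c d] [e f] [g h]; rewrite /dom /bmul /=; lia.
Qed.

Lemma key_le_total : total key_le.
Proof.
by move=> [a b] [c d]; rewrite /key_le /=;
  case: (ltnP a b); case: (ltnP c d) => /=; lia.
Qed.

Lemma key_le_trans : transitive key_le.
Proof.
by move=> [a b] [c d] [e f]; rewrite /key_le /=;
  case: (ltnP a b); case: (ltnP c d); case: (ltnP e f) => /=; lia.
Qed.

(** The adjacent interchange behind Johnson's rule. Both concatenations have the same total; for
    [x = (a, b)] and [y = (c, d)] the maximal prefix sums to compare are max(a, a + c - b) and
    max(c, c + a - d). *)
Lemma key_le_swap x y : key_le x y -> dom (bmul x y) (bmul y x).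
Proof.
move: x y => [a b] [c d]; rewrite /key_le /dom /bmul /=.
by case: (ltnP a b); case: (ltnP c d) => /=; lia.
Qed.

Lemma flatten_cons (S : Type) (s : seq S) ss : flatten (s :: ss) = s ++ flatten ss.
Proof. by []. Qed.

(** * Interleavings of sequences *)

Inductive shuffle (S : Type) : seq S -> seq S -> seq S -> Prop :=
| shuffle_nil : shuffle [::] [::] [::]
| shuffle_consl x a b c : shuffle a b c -> shuffle (x :: a) b (x :: c)
| shuffle_consr x a b c : shuffle a b c -> shuffle a (x :: b) (x :: c).
#[local] Hint Constructors shuffle : core.

Section Shuffle.
Variable S : Type.
Implicit Types a b c o s : seq S.

Lemma shuffle0s s : shuffle [::] s s.
Proof. by elim: s => [|x s IH]; auto. Qed.

Lemma shuffle0sE b c : shuffle [::] b c -> c = b.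
Proof.
move E: [::] => e H; elim: H E => // x a0 b0 c0 _ IH /IH -> //.
Qed.

Lemma shuffleC a b c : shuffle a b c -> shuffle b a c.
Proof. by elim; auto. Qed.

Lemma shuffle_cat a b c a' b' c' :
  shuffle a b c -> shuffle a' b' c' -> shuffle (a ++ a') (b ++ b') (c ++ c').
Proof. by move=> H H'; elim: H => //= *; auto. Qed.

Lemma shuffle_consE x a b c : shuffle (x :: a) b c ->
  exists b1 b2 c', [/\ b = b1 ++ b2, c = b1 ++ x :: c' & shuffle a b2 c'].
Proof.
move E: (x :: a) => e H; elim: H E => // {b c}.
- by move=> y a' b c H _ [-> ->]; exists [::], b, c.
- move=> y a' b c _ IH /IH [b1 [b2 [c' [-> -> H]]]].
  by exists (y :: b1), b2, c'.
Qed.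

(** The cut falls right after the last element of [a]. *)
Lemma shuffle_catE a a' b c : shuffle (a ++ a') b c ->
  exists b1 b2 c1 c2,
    [/\ b = b1 ++ b2, c = c1 ++ c2, shuffle a b1 c1 & shuffle a' b2 c2].
Proof.
elim: a b c => [|x a IH] b c /=.
  by move=> H; exists [::], b, [::], c.
move=> /shuffle_consE [b1 [b2 [c' [-> -> /IH]]]].
move=> [d1 [d2 [c1 [c2 [-> -> H1 H2]]]]].
exists (b1 ++ d1), d2, (b1 ++ x :: c1), c2; split => //; rewrite -?catA //.
by apply: (@shuffle_cat [::] b1 b1 (x :: a)); [exact: shuffle0s | auto].
Qed.

(** Regroups a three-way interleaving, so that one chain can be exchanged while the other counts as
    part of its environment. *)
Lemma shuffle_assoc a b o y c : shuffle a b y -> shuffle y o c ->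
  exists2 r, shuffle a r c & shuffle b o r.
Proof.
move=> H H'; elim: H' a b H => {y o c}.
- by move=> a b; move E: [::] => e H; case: H E => // _; exists [::].
- move=> x y o c H IH a b; move E: (x :: y) => e Hs.
  case: Hs E => // x' a' b' c' Hs [<- Ec]; rewrite -{}Ec in Hs.
    by case: (IH _ _ Hs) => r H1 H2; exists r; auto.
  by case: (IH _ _ Hs) => r H1 H2; exists (x :: r); auto.
- by move=> x y o c H IH a b /IH [r H1 H2]; exists (x :: r); auto.
Qed.

Lemma shuffle_map (S' : Type) (f : S -> S') a b c :
  shuffle a b c -> shuffle (map f a) (map f b) (map f c).
Proof. by elim => /=; auto. Qed.

End Shuffle.

Lemma shuffle_assocr (S : Type) (a b o r c : seq S) :
  shuffle a r c -> shuffle b o r ->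
  exists2 y, shuffle a b y & shuffle y o c.
Proof.
move=> /shuffleC H /shuffleC H'.
by case: (shuffle_assoc H' H) => y H1 /shuffleC H2; exists y => //; exact: shuffleC.
Qed.

Lemma shuffle_flatten (S : Type) (a b c : seq (seq S)) :
  shuffle a b c -> shuffle (flatten a) (flatten b) (flatten c).
Proof.
elim => //= x a' b' c' _ IH.
  by rewrite -(cat0s (flatten b')); apply: shuffle_cat => //; apply/shuffleC/shuffle0s.
by rewrite -(cat0s (flatten a')); apply: shuffle_cat => //; apply: shuffle0s.
Qed.

Lemma shuffle_subseql (S : eqType) (a b c : seq S) : shuffle a b c -> subseq a c.
Proof.
elim => // x a' b' c' _ IH; first by rewrite /= eqxx.
exact: subseq_trans IH (subseq_cons _ _).
Qed.

Lemma shuffle_perm (S : eqType) (a b c : seq S) :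
  shuffle a b c -> perm_eq c (a ++ b).
Proof.
elim => //= x a' b' c' _ IH; first by rewrite perm_cons.
by rewrite perm_sym -cat_rcons perm_catC -rcons_cat perm_rcons perm_cons perm_catC perm_sym.
Qed.

Lemma shuffle_filter (S : eqType) (p : pred S) (a : seq S) :
  shuffle (filter p a) (filter (predC p) a) a.
Proof. by elim: a => //= x a IH; case: (p x) => /=; auto. Qed.

Lemma shuffle_filterr (S : eqType) (p : pred S) (a b c : seq S) :
  shuffle a b c -> all p a -> filter (predC p) c = filter (predC p) b.
Proof.
elim => //= x a' b' c' _ IH; first by case/andP => -> /IH.
by move/IH ->.
Qed.

(** * Exchange arguments on blocks *)

Section Blocks.
Variables (T : eqType) (kv : T -> nat * nat).
Implicit Types (s a b : seq T) (A B P O : seq (seq T)).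

Definition bic s : nat * nat := foldr (fun x => bmul (kv x)) (0, 0) s.

Lemma bic_cat s1 s2 : bic (s1 ++ s2) = bmul (bic s1) (bic s2).
Proof. by elim: s1 => [|x s IH] /=; rewrite ?bmul0l // IH bmulA. Qed.

Definition better s1 s2 := dom (bic s1) (bic s2).

Lemma better_trans s1 s2 s3 : better s1 s2 -> better s2 s3 -> better s1 s3.
Proof. exact: dom_trans. Qed.

Lemma better_cat s1 s2 s3 s4 :
  better s1 s2 -> better s3 s4 -> better (s1 ++ s3) (s2 ++ s4).
Proof. by rewrite /better !bic_cat; exact: dom_bmul. Qed.

Lemma better_context c1 c2 s1 s2 :
  better s1 s2 -> better (c1 ++ s1 ++ c2) (c1 ++ s2 ++ c2).
Proof. by move=> H; do 2?apply: better_cat => //; exact: dom_refl. Qed.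

Definition block_le a b := key_le (bic a) (bic b).

Lemma block_le_total : total block_le.
Proof. by move=> a b; exact: key_le_total. Qed.

Lemma block_le_trans : transitive block_le.
Proof. by move=> a b c; exact: key_le_trans. Qed.

Lemma block_swap a b : block_le a b -> better (a ++ b) (b ++ a).
Proof. by rewrite /better !bic_cat; exact: key_le_swap. Qed.

(* Whatever lies between two consecutive blocks of a chain is itself a block,
   and can be moved past one of them. *)
Lemma shuffle_adjacent A1 a b A2 O P :
  shuffle (A1 ++ a :: b :: A2) O P ->
  exists O1 c O2 P1 P2,
    [/\ O = O1 ++ c ++ O2, P = P1 ++ a :: c ++ b :: P2,
        shuffle A1 O1 P1 & shuffle A2 O2 P2].
Proof.
move=> /shuffle_catE [O1 [O' [P1 [P' [-> -> H1 H]]]]].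
have {H} [o1 [o2 [P'' [-> -> H]]]] := shuffle_consE H.
have {H} [c [O2 [P2 [-> -> H2]]]] := shuffle_consE H.
exists (O1 ++ o1), c, O2, (P1 ++ o1), P2; split; rewrite -?catA //.
by rewrite -(cats0 A1); apply: shuffle_cat => //; exact: shuffle0s.
Qed.

(** Let [c] be what lies between [a] and [b]. By totality either [c] is at most [a] and moves in
    front of it, or [c] is at least [a], hence at least [b], and moves behind [b]. *)
Lemma shuffle_glue A1 a b A2 O P :
  block_le b a -> shuffle (A1 ++ a :: b :: A2) O P ->
  exists2 P', shuffle (A1 ++ (a ++ b) :: A2) O P'
            & better (flatten P') (flatten P).
Proof.
move=> ba /shuffle_adjacent [O1 [c [O2 [P1 [P2 [-> -> H1 H2]]]]]].
have [ca|ac] := orP (block_le_total (flatten c) a).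
  exists (P1 ++ c ++ (a ++ b) :: P2).
    by apply: shuffle_cat => //; apply: (@shuffle_cat _ [::] c); [exact: shuffle0s|auto].
  rewrite !(flatten_cat, flatten_cons) -!catA.
  rewrite (catA (flatten c) a) (catA a (flatten c)).
  by apply: better_context; exact: block_swap.
exists (P1 ++ (a ++ b) :: c ++ P2).
  apply: shuffle_cat => //; apply: shuffle_consl.
  by apply: (@shuffle_cat _ [::] c); [exact: shuffle0s|auto].
rewrite !(flatten_cat, flatten_cons) -!catA !(catA (flatten P1) a).
rewrite (catA b) (catA (flatten c) b).
by apply: better_context; apply: block_swap; apply: block_le_trans ba ac.
Qed.

(** Gluing first brings the two blocks side by side; then they can be exchanged by [block_swap]. *)
Lemma shuffle_swap A1 a b A2 O P :
  block_le a b -> shuffle (A1 ++ b :: a :: A2) O P ->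
  exists2 P', shuffle (A1 ++ a :: b :: A2) O P'
            & better (flatten P') (flatten P).
Proof.
move=> ab /(shuffle_glue ab) [P' H Hb].
have {H} [O1 [O' [P1 [P'' [-> E' H1 H]]]]] := shuffle_catE H.
have {H} [o1 [o2 [P2 [-> EP'' H2]]]] := shuffle_consE H.
rewrite {}E' {}EP'' in Hb.
exists (P1 ++ o1 ++ a :: b :: P2).
  apply: shuffle_cat => //.
  by apply: (@shuffle_cat _ [::] o1); [exact: shuffle0s|auto].
apply: better_trans Hb; rewrite !(flatten_cat, flatten_cons) -!catA.
rewrite !(catA (flatten P1) (flatten o1)) (catA a b) (catA b a).
by apply: better_context; exact: block_swap.
Qed.

Lemma shuffle_to_front A1 a A2 O P :
  all (block_le a) A1 -> shuffle (A1 ++ a :: A2) O P ->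
  exists2 P', shuffle (a :: A1 ++ A2) O P' & better (flatten P') (flatten P).
Proof.
elim/last_ind: A1 A2 P => [|A1 b IH] A2 P.
  by exists P => //; exact: dom_refl.
rewrite all_rcons cat_rcons => /andP[ab H] /(shuffle_swap ab) [P1 H1 B1].
have [P2 H2 B2] := IH _ _ H H1; exists P2; first by rewrite cat_rcons.
exact: better_trans B2 B1.
Qed.

Lemma shuffle_consl_exchange a A1 A2 O P :
  (forall O' P', shuffle A1 O' P' ->
     exists2 P'', shuffle A2 O' P'' & better (flatten P'') (flatten P')) ->
  shuffle (a :: A1) O P ->
  exists2 P', shuffle (a :: A2) O P' & better (flatten P') (flatten P).
Proof.
move=> H HP; have [o1 [o2 [P1 [-> -> H1]]]] := shuffle_consE HP.
have [P2 H2 B2] := H _ _ H1.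
exists (o1 ++ a :: P2).
  by apply: (@shuffle_cat _ [::] o1); [exact: shuffle0s|auto].
rewrite !(flatten_cat, flatten_cons); do 2?apply: better_cat => //; exact: dom_refl.
Qed.

(** Everything that [Y] places before [a] comes from [B], so [a] may overtake it. The environment
    [O] remains free to precede [a]. *)
Lemma shuffle_merge_front a A B Y O P :
  path block_le a A -> all (block_le a) B -> shuffle (a :: A) B Y ->
  shuffle Y O P ->
  exists2 Y', shuffle A B Y' &
  exists2 P', shuffle (a :: Y') O P' & better (flatten P') (flatten P).
Proof.
move=> sA aB HY HO; have [B1 [B2 [Y' [EB EY H]]]] := shuffle_consE HY.
rewrite {}EY in HO; move: aB; rewrite EB all_cat => /andP[aB1 _].
have [P' H' B'] := shuffle_to_front aB1 HO.
exists (B1 ++ Y'); last by exists P'.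
by apply: (@shuffle_cat _ [::] B1); [exact: shuffle0s|].
Qed.

(** Follows the recursion of [merge]: the head that it selects is least among all remaining blocks,
    so it can be brought forward, and the induction handles what comes after it. *)
Lemma shuffle_merge A B Y O P :
  sorted block_le A -> sorted block_le B -> shuffle A B Y -> shuffle Y O P ->
  exists2 P', shuffle (merge block_le A B) O P'
            & better (flatten P') (flatten P).
Proof.
elim: A B Y O P => [|a A IHA] B Y O P sA sB HY HP.
  by rewrite -(shuffle0sE HY); exists P => //; exact: dom_refl.
elim: B Y O P sB HY HP => [|b B IHB] Y O P sB HY HP.
  by rewrite [merge _ _ _]/= -(shuffle0sE (shuffleC HY)); exists P => //; exact: dom_refl.
rewrite [merge _ _ _]/=; case: ifP => [ab|ba].
  have aB : all (block_le a) (b :: B).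
    by rewrite /= ab; apply: sub_all (order_path_min block_le_trans sB) => c; apply: block_le_trans ab.
  have [Y' HY' [P' HP' B']] := shuffle_merge_front sA aB HY HP.
  have [P'' H'' B''] := shuffle_consl_exchange
    (fun O' P' => IHA _ _ O' P' (path_sorted sA) sB HY') HP'.
  by exists P'' => //; apply: better_trans B'' B'.
have {}ba : block_le b a by case/orP: (block_le_total a b) => //; rewrite ba.
have bA : all (block_le b) (a :: A).
  by rewrite /= ba; apply: sub_all (order_path_min block_le_trans sA) => c; apply: block_le_trans ba.
have [Y' HY' [P' HP' B']] := shuffle_merge_front sB bA (shuffleC HY) HP.
have [P'' H'' B''] := shuffle_consl_exchange
    (fun O' P' => IHB _ O' P' (path_sorted sB) (shuffleC HY')) HP'.
by exists P'' => //; apply: better_trans B'' B'.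
Qed.

(* A block may be glued to its successor in the chain as soon as it should not
   come first, by [shuffle_glue]. *)
Inductive glued : seq (seq T) -> seq (seq T) -> Prop :=
| glued_refl A : glued A A
| glued_step A B1 a b B2 : glued A (B1 ++ a :: b :: B2) -> block_le b a ->
    glued A (B1 ++ (a ++ b) :: B2).

Lemma glued_rcons A B a : glued A B -> glued (rcons A a) (rcons B a).
Proof.
elim=> [A'|A' B1 b c B2 _ IH bc]; first exact: glued_refl.
rewrite rcons_cat /=; apply: glued_step bc.
by rewrite rcons_cat in IH.
Qed.

Lemma shuffle_glued A B O P : glued A B -> shuffle A O P ->
  exists2 P', shuffle B O P' & better (flatten P') (flatten P).
Proof.
move=> H; elim: H P => {A B} [A|A B1 a b B2 _ IH ba] P HP.
  by exists P => //; exact: dom_refl.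
have [P1 /(shuffle_glue ba) [P2 H2 b2] b1] := IH _ HP.
by exists P2 => //; exact: better_trans b2 b1.
Qed.

Definition singles s := [seq [:: x] | x <- s].

Lemma flatten_singles s : flatten (singles s) = s.
Proof. exact: flatten_seq1. Qed.

Lemma glued_flatten A B : glued A B -> flatten B = flatten A.
Proof.
elim=> // A' B1 a b B2 _ <- _.
by rewrite !(flatten_cat, flatten_cons) -!catA.
Qed.

(** Three moves, each with all other letters as environment: cut [a] into its blocks, cut [b] into
    its blocks, merge the two lists. The regroupings of shuffles in between only change what counts
    as environment. *)
Lemma parallel_exchange (a b y o s : seq T) A B :
  glued (singles a) A -> glued (singles b) B ->
  sorted block_le A -> sorted block_le B ->
  shuffle a b y -> shuffle y o s ->
  exists2 s', shuffle (flatten (merge block_le A B)) o s' & better s' s.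
Proof.
move=> gA gB sA sB Hy Hs.
have [r Ha Hb] := shuffle_assoc Hy Hs.
move: (shuffle_map (fun x => [:: x]) Ha) => /(shuffle_glued gA) [P1 H1 B1].
have Hb1 := shuffle_map (fun x => [:: x]) Hb.
have [r1 K1 /shuffleC K2] := shuffle_assocr H1 Hb1.
case: (shuffle_assoc (shuffleC K1) (shuffleC K2)) => r2 K3 K4.
have [P2 H2 B2] := shuffle_glued gB K3.
have [Y KY HY] := shuffle_assocr H2 K4.
have [P3 H3 B3] := shuffle_merge sA sB (shuffleC KY) HY.
exists (flatten P3).
  by rewrite -{1}(flatten_singles o); exact: shuffle_flatten.
apply: better_trans B3 _; apply: better_trans B2 _.
by rewrite -{1}(flatten_singles s).
Qed.

End Blocks.

(** * Contracting series-parallel digraphs *)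

Section Contraction.
Variable T : eqType.
Implicit Types (E F : rel T) (s t u v w x y : T).

(** A relation cannot hold two parallel arcs, so the parallel reduction happens inside a
    contraction, namely when [E u w] already holds. *)
Definition contract E u v w : rel T :=
  fun x y => [&& x != v, y != v & E x y || (x == u) && (y == w)].

Definition inner E u v w : Prop :=
  [/\ forall x, E x v = (x == u), forall y, E v y = (y == w), u != v & w != v].

Fixpoint reds k E F : Prop :=
  if k is k'.+1
  then exists u v w, inner E u v w /\ reds k' (contract E u v w) F
  else E =2 F.

Definition edge s t : rel T := fun x y => (x == s) && (y == t).

Lemma contract_ext E E' u v w :
  E =2 E' -> contract E u v w =2 contract E' u v w.
Proof. by move=> H x y; rewrite /contract H. Qed.

Lemma inner_ext E E' u v w : E =2 E' -> inner E u v w -> inner E' u v w.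
Proof. by move=> H [H1 H2 H3 H4]; split=> // x; rewrite -H. Qed.

Lemma reds_ext k E E' F : E =2 E' -> reds k E F -> reds k E' F.
Proof.
elim: k E E' => [|k IH] E E' H /=; first by move=> HF x y; rewrite -H.
move=> [u [v [w [Hi Hr]]]]; exists u, v, w; split; first exact: inner_ext Hi.
exact: IH (contract_ext _ _ _ H) Hr.
Qed.

Lemma reds_cat k l E F H : reds k E F -> reds l F H -> reds (k + l) E H.
Proof.
elim: k E => [|k IH] E /=.
  by move=> EF; apply: reds_ext => x y; rewrite EF.
by move=> [u [v [w [Hi Hr]]]] HF; exists u, v, w; split=> //; exact: IH.
Qed.

(** Undoing a contraction doubles all ranks, which makes room for [v] just above [u]. The rank
    expresses acyclicity. *)
Lemma reds_rank k E s t : s != t -> reds k E (edge s t) ->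
  exists h : T -> nat, forall x y, E x y -> h x < h y.
Proof.
move=> st; elim: k E => [|k IH] E /=.
  move=> H; exists (fun x => x == t) => x y; rewrite H => /andP[/eqP-> /eqP->].
  by rewrite eqxx (negPf st).
move=> [u [v [w [[H1 H2 uv wv] /IH [h Hh]]]]].
exists (fun x => if x == v then (h u).*2.+1 else (h x).*2) => x y.
have huw : h u < h w by apply: Hh; rewrite /contract uv wv !eqxx orbT.
have [->|xv] := eqVneq x v.
  by rewrite H2 => /eqP ->; rewrite (negPf wv); lia.
have [->|yv] := eqVneq y v; first by rewrite H1 => /eqP ->.
by move=> Exy; have := Hh x y; rewrite /contract xv yv Exy => /(_ isT); lia.
Qed.

(* Contractions of distinct inner vertices commute, so any maximal sequence of
   contractions of a reducible graph ends in a single arc ([reds_inner]). *)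
Lemma inner_contract E (h : T -> nat) u v w u' v' w' :
  (forall x y, E x y -> h x < h y) ->
  inner E u v w -> inner E u' v' w' -> v' != v ->
  inner (contract E u v w) (if u' == v then u else u') v'
        (if w' == v then w else w').
Proof.
move=> Hh [H1 H2 uv wv] [H1' H2' uv' wv'] vv.
have huv : h u < h v by apply: Hh; rewrite H1.
have hvw : h v < h w by apply: Hh; rewrite H2.
have E1 : (v' == w) = (u' == v) by rewrite -H2 H1' eq_sym.
have E2 : (v' == u) = (w' == v) by rewrite -H1 H2' eq_sym.
split.
- move=> x; rewrite /contract vv H1' E1 /=.
  case: (eqVneq u' v) => [->|n1]; last first.
    by rewrite andbF orbF; case: (eqVneq x v) => // ->; rewrite eq_sym (negPf n1).
  by rewrite andbT; case: (eqVneq x v) => [->|_] //=; rewrite eq_sym (negPf uv).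
- move=> x; rewrite /contract vv H2' E2 /=.
  case: (eqVneq w' v) => [->|n1]; last first.
    by rewrite orbF; case: (eqVneq x v) => // ->; rewrite eq_sym (negPf n1).
  by case: (eqVneq x v) => [->|_] //=; rewrite eq_sym (negPf wv).
(* The new in-neighbour [u] could equal [v'] only if [v] and [v'] formed a 2-cycle, which the rank
   excludes; the other side is symmetric. *)
- case: (eqVneq u' v) => [e|_] //; rewrite eq_sym E2; apply/eqP => e2.
  by have := Hh v' v; rewrite H1 E2 e2 eqxx => /(_ isT); have := Hh v v'; rewrite H1' e eqxx => /(_ isT); lia.
- case: (eqVneq w' v) => [e|_] //; rewrite eq_sym E1; apply/eqP => e2.
  have := Hh v v'; rewrite H1' e2 eqxx => /(_ isT).
  by have := Hh v' v; rewrite H2' e eqxx => /(_ isT); lia.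
Qed.

(** If [v] and [v'] are adjacent, contracting one of them changes a neighbour of the other; the
    conditionals name the neighbour after that change. *)
Lemma contractC E (h : T -> nat) u v w u' v' w' :
  (forall x y, E x y -> h x < h y) ->
  inner E u v w -> inner E u' v' w' -> v' != v ->
  contract (contract E u v w) (if u' == v then u else u') v'
           (if w' == v then w else w') =2
  contract (contract E u' v' w') (if u == v' then u' else u) v
           (if w == v' then w' else w).
Proof.
move=> Hh [H1 H2 uv wv] [H1' H2' uv' wv'] vv x y.
have E1 : (w == v') = (u' == v) by rewrite eq_sym -H2 H1' eq_sym.
have E2 : (u == v') = (w' == v) by rewrite eq_sym -H1 H2' eq_sym.
(* Both equalities together would give a 2-cycle through [v] and [v']. *)
have N : ~~ ((u' == v) && (w' == v)).
  apply/negP => /andP[/eqP e1 /eqP e2].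
  have := Hh v v'; rewrite H1' e1 eqxx => /(_ isT).
  by have := Hh v' v; rewrite H2' e2 eqxx => /(_ isT); lia.
rewrite /contract E1 E2.
pose u2 := if u' == v then u else u'; pose w2 := if w' == v then w else w'.
pose u3 := if w' == v then u' else u; pose w3 := if u' == v then w' else w.
rewrite -/u2 -/w2 -/u3 -/w3.
have nu2 : (v == u2) = false.
  by rewrite eq_sym /u2; case: (eqVneq u' v) => // e; exact: negbTE.
have nw2 : (v == w2) = false.
  by rewrite eq_sym /w2; case: (eqVneq w' v) => // e; exact: negbTE.
have nu3 : (v' == u3) = false.
  by rewrite eq_sym /u3 -E2; case: (eqVneq u v') => // e; exact: negbTE.
have nw3 : (v' == w3) = false.
  by rewrite eq_sym /w3 -E1; case: (eqVneq w v') => // e; exact: negbTE.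
case: (eqVneq x v) => [->|xv] /=; first by rewrite nu2 /= !andbF.
case: (eqVneq y v) => [->|yv] /=; first by rewrite nw2 !andbF.
case: (eqVneq x v') => [->|xv'] /=; first by rewrite nu3.
case: (eqVneq y v') => [->|yv'] /=; first by rewrite nw3 andbF.
rewrite /u2 /w2 /u3 /w3 {u2 w2 u3 w3 nu2 nw2 nu3 nw3}.
move: N; case: (eqVneq u' v) => [e1|n1]; case: (eqVneq w' v) => [e2|n2] //= _.
- have -> : (y == w) = false.
    by apply: contraNF yv' => /eqP ->; rewrite E1 e1.
  have -> : (x == u') = false by rewrite e1; exact: negbTE.
  by rewrite !andbF !andFb !orbF.
- have -> : (x == u) = false.
    by apply: contraNF xv' => /eqP ->; rewrite E2 e2.
  have -> : (y == w') = false by rewrite e2; exact: negbTE.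
  by rewrite !andbF !andFb !orbF.
- by rewrite -!orbA; congr (_ || _); rewrite orbC.
Qed.

Lemma edge_inner s t u v w : ~ inner (edge s t) u v w.
Proof.
move=> [H1 H2 uv wv]; have := H1 u; have := H2 w; rewrite /edge !eqxx.
by move=> /andP[_ /eqP ew] /andP[/eqP eu _]; move: (H1 s) ; rewrite /edge eqxx -eu;
 rewrite eqxx /=; have := H2 w; rewrite /edge eqxx => /andP[/eqP e _] ; rewrite e eu eqxx in uv.
Qed.

(** The first contraction of the given sequence either is the wanted one or commutes with it, and
    then the induction hypothesis finds the wanted one further on. Hence a greedy choice never gets
    stuck. *)
Lemma reds_inner k E s t u v w : s != t ->
  reds k E (edge s t) -> inner E u v w ->
  exists2 k', k = k'.+1 & reds k' (contract E u v w) (edge s t).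
Proof.
move=> st; elim: k E u v w => [|k IH] E u' v' w' Hr Hi'.
  by case: (@edge_inner s t u' v' w'); apply: inner_ext Hi'.
have [h Hh] := reds_rank st Hr; exists k => //.
move: Hr => /= [u [v [w [Hi Hr]]]].
have [e|vv] := eqVneq v' v.
  move: Hi Hi' => [H1 H2 _ _] [H1' H2' _ _].
  have -> : u' = u by apply/eqP; rewrite -H1 -e H1'.
  have -> : w' = w by apply/eqP; rewrite -H2 -e H2'.
  by rewrite e.
have [k' -> Hk'] := IH _ _ _ _ Hr (inner_contract Hh Hi Hi' vv).
have vv' : v != v' by rewrite eq_sym.
exists (if u == v' then u' else u), v, (if w == v' then w' else w); split.
  exact: inner_contract Hh Hi' Hi vv'.
by apply: reds_ext Hk'; exact: contractC Hh Hi Hi' vv.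
Qed.

(** Isolated vertices stay isolated, whereas the terminals carry the last arc. Thus a contracted
    vertex is never a terminal. *)
Lemma reds_isolated k E s t v : reds k E (edge s t) ->
  (forall x, ~~ E x v && ~~ E v x) -> v != s /\ v != t.
Proof.
elim: k E => [|k IH] E /=.
  move=> H N; have := N s; have := N t; rewrite !H /edge !eqxx andbT /=.
  by move=> /andP[_ ->] /andP[-> _].
move=> [u [z [w [[H1 H2 uz wz] /IH Hr]]]] N; apply: Hr => x.
have nw : v != w by have /andP[+ _] := N z; rewrite H2.
have nu : v != u by have /andP[_ +] := N z; rewrite H1.
have /andP[n1 n2] := N x.
by rewrite /contract (negPf n1) (negPf n2) (negPf nw) (negPf nu) !andbF.
Qed.

End Contraction.

(** * Series-parallel digraphs reduce to a single arc *)

(** Reduces one component inside a composition. [F] stands for the rest of the graph: it meets the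
    component only at the terminals, so every contracted vertex has the same neighbours in the whole
    graph as in the component. *)
Lemma reds_transport (T1 T2 : eqType) (f : T1 -> T2) k (E1 : rel T1) s t
    (E : rel T2) (F : T2 -> T2 -> Prop) :
  injective f -> reds k E1 (edge s t) ->
  (forall x y, E x y <-> (exists a b, [/\ x = f a, y = f b & E1 a b]) \/ F x y) ->
  (forall v y, v != s -> v != t -> ~ F (f v) y /\ ~ F y (f v)) ->
  exists2 E' : rel T2, reds k E E' &
    forall x y, E' x y <-> (x = f s /\ y = f t) \/ F x y.
Proof.
move=> fI; elim: k E1 E => [|k IH] E1 E /=.
  move=> H1 HE _; exists E => // x y; rewrite HE; split=> -[]; auto.
    by move=> [a [b [-> ->]]]; rewrite H1 => /andP[/eqP-> /eqP->]; auto.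
  by move=> [-> ->]; left; exists s, t; rewrite H1 /edge !eqxx.
move=> [u [v [w [[H1 H2 uv wv] Hr]]]] HE HF.
have [vs vt] : v != s /\ v != t.
  by apply: reds_isolated Hr _ => x; rewrite /contract eqxx andbF.
have Ei : inner E (f u) (f v) (f w).
  split; rewrite ?(inj_eq fI) // => x; apply/idP/eqP => [/HE [|]|->].
  - by move=> [a [b [-> /fI <-]]]; rewrite H1 => /eqP ->.
  - by case: (HF v x vs vt).
  - by apply/HE; left; exists u, v; rewrite H1.
  - by move=> [a [b [/fI <- ->]]]; rewrite H2 => /eqP ->.
  - by case: (HF v x vs vt).
  - by apply/HE; left; exists v, w; rewrite H2.
case: (IH _ (contract E (f u) (f v) (f w)) Hr) => //.
  move=> x y; rewrite /contract; split.
    case/and3P => xv yv /orP[/HE [|]|/andP[/eqP ex /eqP ey]]; auto.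
      move=> [a [b [ex ey Hab]]]; left; exists a, b; split=> //.
      by move: xv yv; rewrite ex ey !(inj_eq fI) Hab => -> ->.
    by left; exists u, w; rewrite uv wv !eqxx orbT.
  move=> [[a [b [-> -> /and3P[av bv /orP H]]]]|Fxy].
    rewrite !(inj_eq fI) av bv /=; apply/orP; case: H => [Hab|]; [left|by right].
    by apply/HE; left; exists a, b.
  have Exy : E x y by apply/HE; right.
  apply/and3P; split; last by rewrite Exy.
    by apply/eqP => e; case: (HF v y vs vt); rewrite -e.
  by apply/eqP => e; case: (HF v x vs vt); rewrite -e.
by move=> E' HE' HFE; exists E' => //; exists (f u), (f v), (f w).
Qed.

Definition adj n (G : mdigraph n) : rel 'I_n :=
  fun x y => [exists a : arc G, (src a == x) && (dst a == y)].

Lemma adjP n (G : mdigraph n) x y :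
  reflect (exists2 a : arc G, src a = x & dst a = y) (adj G x y).
Proof.
apply: (iffP existsP) => [[a /andP[/eqP <- /eqP <-]]|[a <- <-]]; exists a => //.
by rewrite !eqxx.
Qed.

Lemma gluing_adj n1 n2 n (G1 : mdigraph n1) (G2 : mdigraph n2) (G : mdigraph n)
    f1 f2 ident x y : gluing G1 G2 G f1 f2 ident ->
  adj G x y <->
    (exists a b, [/\ x = f1 a, y = f1 b & adj G1 a b]) \/
    (exists a b, [/\ x = f2 a, y = f2 b & adj G2 a b]).
Proof.
move=> [_ _ _ _ [g [[g' _ gK] H1 H2]]]; split.
  case/adjP => a <- <-; rewrite -(gK a); case: (g' a) => b.
    by left; exists (src b), (dst b); case: (H1 b) => -> ->; split=> //; apply/adjP; exists b.
  by right; exists (src b), (dst b); case: (H2 b) => -> ->; split=> //; apply/adjP; exists b.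
case=> [] [a [b [-> -> /adjP[c <- <-]]]]; apply/adjP.
  by case: (H1 c) => <- <-; exists (g (inl c)).
by case: (H2 c) => <- <-; exists (g (inr c)).
Qed.

(** Inclusion-exclusion: the images of [f1] and [f2] cover all vertices and meet in [f1 @: I]. *)
Lemma gluing_card n1 n2 n (G1 : mdigraph n1) (G2 : mdigraph n2) (G : mdigraph n)
    f1 f2 ident (I : {set 'I_n1}) : gluing G1 G2 G f1 f2 ident ->
  (forall x, x \in I <-> exists y, ident x y) -> n + #|I| = n1 + n2.
Proof.
move=> [i1 i2 Hc Hid _] HI.
have := cardsUI (f1 @: setT) (f2 @: setT).
rewrite !card_imset // !cardsT !card_ord => <-; congr (_ + _).
  rewrite -[LHS]card_ord -cardsT; apply: eq_card => v; rewrite !inE.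
  case: (Hc v) => [] [x <-]; apply/esym/orP; [left|right]; exact: imset_f.
rewrite -(card_imset _ i1); apply: eq_card => v; rewrite inE.
apply/imsetP/andP => [[x /HI [y /Hid e] ->]|[/imsetP[x _ ->] /imsetP[y _ e]]].
  by split; [|rewrite e]; exact: imset_f.
by exists x => //; apply/HI; exists y; apply/Hid.
Qed.

(** Each component shrinks to one arc between its terminals. In a series composition n = n1 + n2 -
    1, and the shared terminal costs one more contraction; in a parallel composition n = n1 + n2 -
    2, and the two final arcs coincide. Both counts give n - 2. *)
Lemma spd_reds n (G : mdigraph n) s t : spd G s t ->
  [/\ s != t, 1 < n & reds (n - 2) (adj G) (edge s t)].
Proof.
elim=> {n G s t}.
- move=> G s t st /eqP; rewrite -cardsT => /cards1P [a Ha] H; split=> // x y.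
  apply/adjP/andP => [[b <- <-]|[/eqP -> /eqP ->]]; first by case: (H b) => -> ->.
  by exists a; case: (H a).
- move=> n1 n2 n G1 G2 G s1 t1 s2 t2 f1 f2 _ [st1 n1_gt R1] _ [st2 n2_gt R2] HG.
  have Hadj := fun x y => gluing_adj x y HG.
  have Hn : n + 1 = n1 + n2.
    rewrite -(cards1 t1); apply: gluing_card HG _ => x; rewrite inE.
    by split=> [/eqP ->|[y [-> _]]] //; exists s2.
  move: HG => [i1 i2 _ Hid _].
  have e12 : f1 t1 = f2 s2 by apply/Hid.
  have d12 : f1 s1 != f2 t2.
    by apply/eqP => /Hid [e _]; rewrite e eqxx in st1.
  have [E1 RE1 HE1] : exists2 E', reds (n1 - 2) (adj G) E' & forall x y, E' x y <->
     (x = f1 s1 /\ y = f1 t1) \/ (exists a b, [/\ x = f2 a, y = f2 b & adj G2 a b]).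
    apply: (reds_transport i1 R1 Hadj) => v y vs vt.
    by split=> -[a [b []]]; [move=> /Hid|move=> _ /Hid] => -[e]; rewrite e eqxx in vt.
  have [E2 RE2 HE2] : exists2 E', reds (n2 - 2) E1 E' & forall x y, E' x y <->
     (x = f2 s2 /\ y = f2 t2) \/ (x = f1 s1 /\ y = f1 t1).
    apply: (reds_transport i2 R2) => [x y|v y vs vt].
      by rewrite HE1; split=> -[]; auto.
    rewrite e12; split=> -[].
      by move=> /esym /Hid [e]; rewrite e eqxx in st1.
    by move=> _ /i2 e; rewrite e eqxx in vs.
  split=> //; first lia.
  have -> : n - 2 = (n1 - 2) + (n2 - 2) + 1 by lia.
  apply: reds_cat (reds_cat RE1 RE2) _ => /=.
  have d1 : f1 s1 != f1 t1 by rewrite (inj_eq i1).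
  have d2 : f2 s2 != f2 t2 by rewrite (inj_eq i2).
  exists (f1 s1), (f1 t1), (f2 t2); split.
    split=> // [x|x|]; last by rewrite e12 eq_sym.
      apply/idP/eqP => [/HE2 [|] [-> //]|->]; last by apply/HE2; right.
      by move=> e; rewrite -e e12 eqxx in d2.
    apply/idP/eqP => [/HE2 [|] []// e|->]; first by rewrite e eqxx in d1.
    by apply/HE2; left.
  move=> x y; rewrite /contract /edge; apply/idP/idP => [/and3P[xm ym]|].
    by case/orP=> // /HE2 [|] [e1 e2]; [rewrite e1 e12 eqxx in xm|rewrite e2 eqxx in ym].
  by move=> /andP[/eqP -> /eqP ->]; rewrite d1 e12 eq_sym d2 !eqxx orbT.
- move=> n1 n2 n G1 G2 G s1 t1 s2 t2 f1 f2 _ [st1 n1_gt R1] _ [st2 n2_gt R2] HG.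
  have Hadj := fun x y => gluing_adj x y HG.
  have Hn : n + 2 = n1 + n2.
    have <- : #|[set s1; t1]| = 2 by rewrite cards2 st1.
    apply: gluing_card HG _ => x; rewrite !inE.
    split=> [/orP[]/eqP ->|[y [] [-> _]]]; rewrite ?eqxx ?orbT //.
      by exists s2; left.
    by exists t2; right.
  move: HG => [i1 i2 _ Hid _].
  have es : f1 s1 = f2 s2 by apply/Hid; left.
  have et : f1 t1 = f2 t2 by apply/Hid; right.
  have [E1 RE1 HE1] : exists2 E', reds (n1 - 2) (adj G) E' & forall x y, E' x y <->
     (x = f1 s1 /\ y = f1 t1) \/ (exists a b, [/\ x = f2 a, y = f2 b & adj G2 a b]).
    apply: (reds_transport i1 R1 Hadj) => v y vs vt.
    by split=> -[a [b []]]; [move=> /Hid|move=> _ /Hid] => -[] [e _];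
       rewrite e eqxx in vs vt.
  have [E2 RE2 HE2] : exists2 E', reds (n2 - 2) E1 E' & forall x y, E' x y <->
     (x = f2 s2 /\ y = f2 t2) \/ (x = f1 s1 /\ y = f1 t1).
    apply: (reds_transport i2 R2) => [x y|v y vs vt].
      by rewrite HE1; split=> -[]; auto.
    by rewrite es et; split=> -[]; [move=> /i2 e|move=> _ /i2 e]; rewrite e eqxx in vs vt.
  split; [by rewrite (inj_eq i1)|lia|].
  have -> : n - 2 = (n1 - 2) + (n2 - 2) by lia.
  rewrite -[_ + _]addn0; apply: reds_cat (reds_cat RE1 RE2) _ => x y.
  rewrite /edge; apply/idP/andP => [/HE2|].
    by rewrite -es -et => -[] [-> ->]; rewrite !eqxx.
  by move=> [/eqP-> /eqP->]; apply/HE2; right.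
Qed.

Definition nadj n (G : mdigraph n) : rel nat :=
  fun x y => [exists a : arc G, (src a == x :> nat) && (dst a == y :> nat)].

Lemma nadjP n (G : mdigraph n) x y :
  reflect (exists2 a : arc G, src a = x :> nat & dst a = y :> nat) (nadj G x y).
Proof.
apply: (iffP existsP) => [[a /andP[/eqP <- /eqP <-]]|[a <- <-]]; exists a => //.
by rewrite !eqxx.
Qed.

Lemma is_spd_reds n (G : mdigraph n) : is_spd G ->
  1 < n /\ exists s t : nat, [/\ s != t, s < n, t < n
                               & reds (n - 2) (nadj G) (edge s t)].
Proof.
move=> [s [t /spd_reds [st n_gt R]]]; split=> //.
exists s, t; split=> //.
(* Transport along the inclusion of ['I_n] into [nat], with an empty environment. *)
have [E RE HE] : exists2 E', reds (n - 2) (nadj G) E' & forall x y : nat, E' x y <->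
   (x = s /\ y = t) \/ False.
  apply: reds_transport (@ord_inj n) R _ _ => [x y|]; last by auto.
  split.
    case/nadjP=> a <- <-; left; exists (src a), (dst a); split=> //.
    by apply/adjP; exists a.
  by move=> [[a [b [-> -> /adjP [c <- <-]]]]|//]; apply/nadjP; exists c.
rewrite -[n - 2]addn0; apply: reds_cat RE _ => x y.
rewrite /edge; apply/idP/andP => [/HE [[-> ->]|//]|[/eqP-> /eqP->]] //.
by apply/HE; left.
Qed.

(** * Cutwidth as a maximal prefix sum *)

(** The pair of a one-letter sequence of weight wo x - wi x. At least one of the two truncated
    differences is 0, since the empty prefix counts too. *)
Definition net_key (T : Type) (wo wi : T -> nat) (x : T) : nat * nat :=
  (wo x - wi x, wi x - wo x).

(** Negative weights are moved to the right-hand side to stay in [nat]. The bound [c] is generalised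
    in the induction because reading [x] changes it to c + wi x - wo x. *)
Lemma bic_leP (T : eqType) (wo wi : T -> nat) (s : seq T) c :
  (bic (net_key wo wi) s).1 <= c <->
  forall i, i <= size s ->
    \sum_(x <- take i s) wo x <= c + \sum_(x <- take i s) wi x.
Proof.
elim: s c => [|x s IH] c /=.
  by split=> // _ [|i] // _; rewrite !big_nil.
have -> : (wo x - wi x + ((bic (net_key wo wi) s).1 - (wi x - wo x)) <= c) =
   (wo x - wi x <= c) && ((bic (net_key wo wi) s).1 <= c + wi x - wo x) by lia.
split=> [/andP[H1 /IH H2] [|i] /=|H].
- by rewrite !big_nil.
- by rewrite ltnS => /H2; rewrite !big_cons; lia.
- have := H 1 isT; rewrite /= take0 !big_cons !big_nil => H1.
  apply/andP; split; first lia.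
  by apply/IH => i Hi; have := H i.+1 Hi; rewrite /= !big_cons; lia.
Qed.

Section Cutwidth.
Variables (n : nat) (G : mdigraph n).

Definition wout (x : nat) := #|[set a : arc G | src a == x :> nat]|.
Definition win (x : nat) := #|[set a : arc G | dst a == x :> nat]|.

Lemma sum_arcs (e : arc G -> nat) (s : seq nat) : uniq s ->
  \sum_(x <- s) #|[set a | e a == x]| = #|[set a | e a \in s]|.
Proof.
move=> us; rewrite (eq_bigr (fun x => \sum_a (e a == x))); last first.
  by move=> x _; rewrite -sum1_card -big_mkcond; apply: eq_bigl => a; rewrite inE.
rewrite exchange_big -sum1_card [RHS]big_mkcond; apply: eq_bigr => a _ /=.
rewrite inE; transitivity (nat_of_bool (e a \in s)); last by case: (e a \in s).
rewrite -(count_uniq_mem _ us) -sum1_count [RHS]big_mkcond /=.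
by apply: eq_bigr => x _; rewrite eq_sym.
Qed.

(** [p] is the inverse of [sigma], written as a word. *)
Definition positions (sigma : 'S_n) (p : seq nat) : Prop :=
  perm_eq p (iota 0 n) /\ forall v : 'I_n, index (val v) p = sigma v.

Definition respects (p : seq nat) : Prop :=
  forall x y, nadj G x y -> index x p < index y p.

Lemma positions_topological sigma p :
  positions sigma p -> topological G sigma <-> respects p.
Proof.
move=> [_ H]; split=> [Ht x y /nadjP [a <- <-]|Hr a]; first by rewrite !H.
by rewrite -!H; apply: Hr; apply/nadjP; exists a.
Qed.

Lemma positions_exist p : perm_eq p (iota 0 n) ->
  exists sigma, positions sigma p.
Proof.
move=> Hp; have mp x : (x \in p) = (x < n) by rewrite (perm_mem Hp) mem_iota.
have Hs : size p = n by rewrite (perm_size Hp) size_iota.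
have lt (v : 'I_n) : index (val v) p < n by rewrite -[X in _ < X]Hs index_mem mp ltn_ord.
have inj : injective (fun v => Ordinal (lt v)).
  move=> u v [] e; apply: val_inj.
  by apply: (can_in_inj (fun x => @nth_index _ 0 x p)) e; rewrite ?mp ltn_ord.
by exists (perm inj); split=> // v; rewrite permE.
Qed.

Lemma positions_of sigma : exists p, positions sigma p.
Proof.
pose p := [seq val ((sigma^-1)%g i) | i <- enum 'I_n]; exists p.
have up : uniq p.
  rewrite map_inj_uniq ?enum_uniq // => i j /val_inj; exact: perm_inj.
have Hi (v : 'I_n) : index (val v) p = sigma v.
  have -> : val v = val ((sigma^-1)%g (sigma v)) by rewrite permK.
  rewrite (@index_map _ _ (fun i => val ((sigma^-1)%g i))).
    by rewrite index_enum_ord.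
  by move=> i j /val_inj; exact: perm_inj.
split=> //; apply: uniq_perm => //; first exact: iota_uniq.
move=> x; rewrite mem_iota add0n /=; apply/mapP/idP => [[i _ ->]|lt]; first exact: ltn_ord.
by exists (sigma (Ordinal lt)); rewrite ?mem_enum // permK.
Qed.

(** In a topological order an arc whose head lies in the prefix has its tail there too. So the arcs
    with tail in the prefix split into those that leave it and those that end in it. *)
Lemma cut_sum sigma p i : positions sigma p -> topological G sigma ->
  #|[set a : arc G | (sigma (src a) < i) && (i <= sigma (dst a))]| +
  \sum_(x <- take i p) win x = \sum_(x <- take i p) wout x.
Proof.
move=> [Hp H] Ht; have mp x : (x \in p) = (x < n) by rewrite (perm_mem Hp) mem_iota.
have up : uniq p by rewrite (perm_uniq Hp) iota_uniq.
rewrite /win /wout !(sum_arcs (fun a => _ (_ a))) ?take_uniq //.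
rewrite -cardsUI [X in _ + X](_ : _ = 0) ?addn0.
  apply: eq_card => a; rewrite !inE !in_take ?mp // !H.
  by have := Ht a; case: (ltnP (sigma (dst a)) i); lia.
apply/eqP; rewrite cards_eq0; apply/eqP/setP => a; rewrite !inE in_take ?mp // H.
by case: (ltnP (sigma (dst a)) i); rewrite ?andbF ?andbT // andbF.
Qed.

Lemma order_cutwidth_bic sigma p : positions sigma p -> topological G sigma ->
  order_cutwidth G sigma = (bic (net_key wout win) p).1.
Proof.
move=> Hsp Ht; have [Hp H] := Hsp.
have Hs : size p = n by rewrite (perm_size Hp) size_iota.
(* Two numbers with the same upper bounds are equal. *)
have E c : (order_cutwidth G sigma <= c) = ((bic (net_key wout win) p).1 <= c).
  apply/idP/idP => [Hc|/bic_leP Hc].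
    apply/bic_leP => i; rewrite Hs => i_le.
    have [->|i_gt] := posnP i; first by rewrite take0 !big_nil.
    have := cut_sum i Hsp Ht; set k := #|_| => <-; rewrite leq_add2r {}/k.
    move: i_le; rewrite leq_eqVlt => /orP[/eqP ->|i_lt].
      (* The whole order is also one of the prefixes, but no arc leaves it. *)
      rewrite (_ : [set _ | _] = set0) ?cards0 //.
      by apply/setP => a; rewrite !inE [n <= _]leqNgt !ltn_ord.
    move: Hc => /bigmax_leqP_seq; apply=> //.
    by rewrite mem_index_iota i_gt.
  apply/bigmax_leqP_seq => i; rewrite mem_index_iota => /andP[_ i_lt] _.
  by rewrite -(leq_add2r (\sum_(x <- take i p) win x)) (cut_sum i Hsp Ht) Hc // Hs ltnW.
by apply/eqP; rewrite eqn_leq E leqnn -E leqnn.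
Qed.

End Cutwidth.

(** * Orders compatible with the labels *)

Section SubseqUniq.
Variable T : eqType.
Implicit Types (a b s p : seq T) (u v w x y : T).

Lemma subseq_after u a s p : u \notin s ->
  subseq (u :: a) (s ++ u :: p) = subseq a p.
Proof.
elim: s => [|x s IH] /=; first by rewrite eqxx.
by rewrite inE negb_or => /andP[/negPf -> /IH].
Qed.

Lemma subseq_before w a s p : w \notin p ->
  subseq (rcons a w) (s ++ w :: p) = subseq a s.
Proof.
move=> wp; rewrite -subseq_rev rev_rcons rev_cat rev_cons cat_rcons.
by rewrite subseq_after ?mem_rev // subseq_rev.
Qed.

Lemma uniq_split x s : x \in s -> uniq s ->
  exists s1 s2, [/\ s = s1 ++ x :: s2, x \notin s1 & x \notin s2].
Proof.
move=> /splitPr[s1 s2]; rewrite cat_uniq /= negb_or => /and4P[_ /andP[x1 _] x2 _].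
by exists s1, s2.
Qed.

Lemma subseq_glue v a b s : uniq s ->
  subseq (rcons a v) s -> subseq (v :: b) s -> subseq (a ++ v :: b) s.
Proof.
move=> us Ha Hb; have vs : v \in s by apply: (mem_subseq Hb); rewrite mem_head.
have [s1 [s2 [Es v1 v2]]] := uniq_split vs us.
move: Ha Hb; rewrite Es subseq_before // subseq_after // => Ha Hb.
by apply: cat_subseq => //=; rewrite eqxx.
Qed.

Lemma subseq_pair_index x y s : uniq s -> x \in s -> y \in s ->
  subseq [:: x; y] s = (index x s < index y s).
Proof.
move=> us xs ys; have [s1 [s2 [Es x1 x2]]] := uniq_split xs us.
move: ys us; rewrite Es subseq_after // sub1seq mem_cat inE => ys.
rewrite cat_uniq => /and3P[_ /hasPn H /andP[_ _]].
rewrite !index_cat (negPf x1) /= eqxx addn0.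
case: (boolP (y \in s1)) => [y1|y1].
  rewrite [RHS]ltnNge index_size /=; apply/negbTE/negP => y2.
  by have := H y; rewrite inE y2 orbT y1 => /(_ isT).
move: ys; rewrite (negPf y1) /= [x == y]eq_sym; case: (eqVneq y x) => [-> _|_ /= ->].
  by rewrite addn0 ltnn; exact: negbTE.
by lia.
Qed.

Lemma subseq_around u w a s : uniq s -> subseq (u :: rcons a w) s ->
  exists s1 m s2, [/\ s = s1 ++ u :: m ++ w :: s2, u \notin s1,
                      w \notin s2 & subseq a m].
Proof.
move=> us Ha; have u_s : u \in s by apply: (mem_subseq Ha); rewrite mem_head.
have [s1 [s' [Es u1 u2]]] := uniq_split u_s us.
move: Ha us; rewrite Es subseq_after // => Ha; rewrite cat_uniq /=.
move=> /and4P[_ _ _ us']; have ws : w \in s'.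
  by apply: (mem_subseq Ha); rewrite mem_rcons mem_head.
have [m [s2 [Es' w1 w2]]] := uniq_split ws us'.
by exists s1, m, s2; rewrite -Es'; split=> //; rewrite Es' subseq_before in Ha.
Qed.

(** In a duplicate-free sequence every subsequence is the filter by its own members, so the
    restriction of [s] to [a ++ b] splits back into [a] and [b]. *)
Lemma disjoint_shuffle a b s : uniq s -> subseq a s -> subseq b s ->
  (forall x, x \in a -> x \notin b) ->
  exists2 y, shuffle a b y & shuffle y [seq x <- s | x \notin a ++ b] s.
Proof.
move=> us Ha Hb D; exists [seq x <- s | x \in a ++ b]; last exact: shuffle_filter.
have Ea : [seq x <- [seq x <- s | x \in a ++ b] | x \in a] = a.
  rewrite -filter_predI [RHS](subseq_uniqP us Ha); apply: eq_filter => x.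
  by rewrite /= mem_cat; case: (x \in a).
have Eb : [seq x <- [seq x <- s | x \in a ++ b] | x \notin a] = b.
  rewrite -filter_predI [RHS](subseq_uniqP us Hb); apply: eq_filter => x.
  by rewrite /= mem_cat; case: (boolP (x \in a)) => //= /D /negPf.
have := shuffle_filter (mem a) [seq x <- s | x \in a ++ b].
by rewrite Ea Eb.
Qed.

End SubseqUniq.

Lemma merge_shuffle (S : Type) (leT : rel S) (a b : seq S) :
  shuffle a b (merge leT a b).
Proof.
elim: a b => [|x a IHa] b; first exact: shuffle0s.
elim: b => [|y b IHb] /=; first exact/shuffleC/shuffle0s.
by case: ifP => _; constructor.
Qed.

Section Feasible.
Variables (n : nat) (wo wi : nat -> nat).
Let kv := net_key wo wi.
Implicit Types (E : rel nat) (L : nat -> nat -> seq nat) (p : seq nat).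

(* An arc u -> w of a contracted graph carries the chain [L u w] of the vertices
   contracted into it, in the order in which they will appear. *)
Definition feasible E L p : Prop :=
  perm_eq p (iota 0 n) /\
  forall u w, E u w -> subseq (u :: rcons (L u w) w) p.

(** Each vertex below n is either live, that is, incident to an arc, or dead and in the label of
    exactly one arc. *)
Record well_labelled E L : Prop := WellLabelled {
  wl_dead : forall u w x y, E u w -> x \in L u w -> ~~ E x y && ~~ E y x;
  wl_owner : forall u w u' w' x, E u w -> E u' w' ->
    x \in L u w -> x \in L u' w' -> u = u' /\ w = w';
  wl_cover : forall x, x < n ->
    (exists y, E x y || E y x) \/ (exists u w, E u w /\ x \in L u w)
}.

Lemma feasible_uniq E L p : feasible E L p -> uniq p.
Proof. by case=> /perm_uniq ->; rewrite iota_uniq. Qed.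

(** * Effect of one contraction on feasible orders *)

Section Step.
Variables (E : rel nat) (L : nat -> nat -> seq nat) (u v w : nat).
Variables (bA bB : seq (seq nat)).
Hypotheses (Hw : well_labelled E L) (Hi : inner E u v w).

(** A missing arc acts as an empty chain, so contractions with and without a parallel arc are one
    case. *)
Definition side_label := if E u w then L u w else [::].
Definition through_label := L u v ++ v :: L v w.
Definition merged_label := flatten (merge (block_le kv) bA bB).
Definition relabel x y := if (x == u) && (y == w) then merged_label else L x y.

Hypotheses (gA : glued kv (singles side_label) bA)
           (gB : glued kv (singles through_label) bB).
Hypotheses (sA : sorted (block_le kv) bA) (sB : sorted (block_le kv) bB).

Let E' := contract E u v w.

Let Euv : E u v. Proof. by case: Hi => ->. Qed.
Let Evw : E v w. Proof. by case: Hi => _ ->. Qed.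
Let uv : u != v. Proof. by case: Hi. Qed.
Let wv : w != v. Proof. by case: Hi. Qed.

Let flatA : flatten bA = side_label.
Proof. by rewrite (glued_flatten gA) flatten_singles. Qed.
Let flatB : flatten bB = through_label.
Proof. by rewrite (glued_flatten gB) flatten_singles. Qed.

Lemma merged_shuffle : shuffle side_label through_label merged_label.
Proof. by rewrite -flatA -flatB; exact/shuffle_flatten/merge_shuffle. Qed.

Let merged_perm := shuffle_perm merged_shuffle.

Let mem_merged x :
  (x \in merged_label) = (x \in side_label) || (x \in through_label).
Proof. by rewrite (perm_mem merged_perm) mem_cat. Qed.

Lemma mem_sideP x : reflect (E u w /\ x \in L u w) (x \in side_label).
Proof.
by rewrite /side_label; case: (E u w); apply: (iffP idP) => [|[]]; rewrite ?in_nil.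
Qed.

Lemma mem_throughP x :
  reflect ([\/ x \in L u v, x = v | x \in L v w]) (x \in through_label).
Proof.
rewrite mem_cat inE; apply: (iffP or3P); move=> [] H.
- by apply: Or31. - by apply: Or32; exact/eqP. - by apply: Or33.
- by apply: Or31. - by apply: Or32; exact/eqP. - by apply: Or33.
Qed.

(** The vertices [u], [v] and [w] are incident to arcs, hence in no label. *)
Let alive x y z : E x y -> z \in L x y -> [/\ z != u, z != v & z != w].
Proof.
move=> Exy zL; split; apply/eqP => e.
- by have := wl_dead Hw v Exy zL; rewrite e Euv.
- by have := wl_dead Hw w Exy zL; rewrite e Evw.
- by have := wl_dead Hw v Exy zL; rewrite e Evw andbF.
Qed.

Lemma side_through_disjoint x : x \in side_label -> x \notin through_label.
Proof.
move=> /mem_sideP [Euw xA]; have [n1 n2 n3] := alive Euw xA.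
apply/negP => /mem_throughP [H|e|H].
- by have [_ e] := wl_owner Hw Euw Euv xA H; move: wv; rewrite e eqxx.
- by rewrite e eqxx in n2.
- by have [e _] := wl_owner Hw Euw Evw xA H; move: uv; rewrite e eqxx.
Qed.

Let other x y : E' x y -> (x == u) && (y == w) = false ->
  [/\ E x y, x != v & y != v].
Proof. by rewrite /E' /contract => /and3P[-> -> H] nxy; move: H; rewrite nxy orbF. Qed.

(** An unaffected arc shares no vertex of its chain with the merged label. Its endpoints may include
    [u] or [w], which are outside the label as well. *)
Let other_disjoint x y z : E x y -> x != v -> y != v ->
  (x == u) && (y == w) = false -> z \in x :: rcons (L x y) y ->
  z \notin merged_label.
Proof.
move=> Exy xv yv nxy; rewrite mem_merged inE mem_rcons inE => /or3P H.
rewrite negb_or; apply/andP; split; apply/negP.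
  move=> /mem_sideP [Euw zA]; case: H => [/eqP e|/eqP e|H].
  - by have := wl_dead Hw y Euw zA; rewrite e Exy.
  - by have := wl_dead Hw x Euw zA; rewrite e Exy andbF.
  - by have [e1 e2] := wl_owner Hw Euw Exy zA H; rewrite e1 e2 !eqxx in nxy.
move=> /mem_throughP; case: H => [/eqP ->|/eqP ->|H] [H'|e|H'].
- by have := wl_dead Hw y Euv H'; rewrite Exy.
- by rewrite e eqxx in xv.
- by have := wl_dead Hw y Evw H'; rewrite Exy.
- by have := wl_dead Hw x Euv H'; rewrite Exy andbF.
- by rewrite e eqxx in yv.
- by have := wl_dead Hw x Evw H'; rewrite Exy andbF.
- by have [_ e] := wl_owner Hw Euv Exy H' H; rewrite e eqxx in yv.
- by have [_ /eqP] := alive Exy H.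
- by have [e _] := wl_owner Hw Evw Exy H' H; rewrite e eqxx in xv.
Qed.

Let Euw' : E' u w.
Proof. by rewrite /E' /contract uv wv !eqxx orbT. Qed.

(** The only vertex that ceases to be live is [v], and it enters the merged label. The labels on
    both sides of it are absorbed there too. *)
Lemma well_labelled_step : well_labelled E' relabel.
Proof.
split.
- move=> x y z z' Exy; rewrite /relabel; case: ifP => [/andP[/eqP ex /eqP ey]|nxy].
    rewrite mem_merged => /orP[/mem_sideP [Euw zA]|/mem_throughP [H|->|H]].
    + have [n1 n2 n3] := alive Euw zA; have := wl_dead Hw z' Euw zA.
      by rewrite /E' /contract (negPf n1) (negPf n3) => /andP[/negPf -> /negPf ->]; rewrite !andbF.
    + have [n1 n2 n3] := alive Euv H; have := wl_dead Hw z' Euv H.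
      by rewrite /E' /contract (negPf n1) (negPf n3) => /andP[/negPf -> /negPf ->]; rewrite !andbF.
    + by rewrite /E' /contract eqxx andbF.
    + have [n1 n2 n3] := alive Evw H; have := wl_dead Hw z' Evw H.
      by rewrite /E' /contract (negPf n1) (negPf n3) => /andP[/negPf -> /negPf ->]; rewrite !andbF.
  have [{}Exy xv yv] := other Exy nxy => H.
  have [n1 n2 n3] := alive Exy H; have := wl_dead Hw z' Exy H.
  by rewrite /E' /contract (negPf n1) (negPf n3) => /andP[/negPf -> /negPf ->]; rewrite !andbF.
- move=> x y x' y' z Exy Exy'; rewrite /relabel; case: ifP => [/andP[/eqP -> /eqP ->]|nxy].
    case: ifP => [/andP[/eqP -> /eqP ->]//|nxy' zX H].
    have [{}Exy' xv yv] := other Exy' nxy'.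
    suff /(other_disjoint Exy' xv yv nxy') : z \in x' :: rcons (L x' y') y'.
      by rewrite zX.
    by rewrite inE mem_rcons inE H !orbT.
  have [{}Exy xv yv] := other Exy nxy => H.
  case: ifP => [/andP[/eqP -> /eqP ->]|nxy'].
    suff /(other_disjoint Exy xv yv nxy) /negPf -> : z \in x :: rcons (L x y) y by [].
    by rewrite inE mem_rcons inE H !orbT.
  have [{}Exy' _ _] := other Exy' nxy'.
  by move=> H'; exact: (wl_owner Hw Exy Exy' H H').
- move=> x /(wl_cover Hw); have [-> _|xv H] := eqVneq x v.
    right; exists u, w; rewrite /relabel !eqxx; split=> //.
    by rewrite mem_merged; apply/orP; right; apply/mem_throughP; apply: Or32.
  case: H => [[y H]|[a [b [Eab xL]]]].
    left; have [ey|yv] := eqVneq y v; last first.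
      by exists y; rewrite /E' /contract xv yv /=; case/orP: H => ->; rewrite ?orbT.
    move: H; rewrite ey; case: Hi => -> -> _ _ /orP[/eqP->|/eqP->].
      by exists w; rewrite Euw'.
    by exists u; rewrite Euw' orbT.
  right; have [ea|av] := eqVneq a v.
    exists u, w; rewrite /relabel !eqxx mem_merged; split=> //; apply/orP; right.
    move: Eab xL; rewrite ea; case: Hi => _ -> _ _ /eqP -> H.
    by apply/mem_throughP; apply: Or33.
  have [eb|bv] := eqVneq b v.
    exists u, w; rewrite /relabel !eqxx mem_merged; split=> //; apply/orP; right.
    move: Eab xL; rewrite eb; case: Hi => -> _ _ _ /eqP -> H.
    by apply/mem_throughP; apply: Or31.
  exists a, b; rewrite /relabel /E' /contract av bv Eab; split=> //.
  case: ifP => [/andP[/eqP ea /eqP eb]|//]; rewrite mem_merged.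
  by apply/orP; left; apply/mem_sideP; rewrite -ea -eb.
Qed.

(** Both chains are subsequences of the merged one, so respecting the new label enforces the old
    constraints between [u], [v] and [w]. *)
Lemma feasible_coarsen p : feasible E' relabel p -> feasible E L p.
Proof.
move=> [Hp H]; split=> // x y Exy.
have Huw := H _ _ Euw'; rewrite /relabel !eqxx /= in Huw.
have [sS sT] : subseq side_label merged_label /\ subseq through_label merged_label.
  by split; [exact: shuffle_subseql merged_shuffle|exact/shuffle_subseql/shuffleC/merged_shuffle].
have sub a : subseq a merged_label -> subseq (u :: rcons a w) p.
  move=> Ha; apply: subseq_trans Huw; rewrite /= eqxx -!cats1.
  by apply: cat_subseq.
have := sub _ sT; rewrite /through_label rcons_cat rcons_cons => Huvw.
have [ey|yv] := eqVneq y v.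
  move: Exy; rewrite ey; case: Hi => -> _ _ _ /eqP ->.
  apply: subseq_trans Huvw; rewrite /= eqxx -cat_rcons; exact: prefix_subseq.
have [ex|xv] := eqVneq x v.
  move: Exy; rewrite ex; case: Hi => _ -> _ _ /eqP ->.
  by apply: subseq_trans Huvw; rewrite -cat_cons; exact: suffix_subseq.
have := H x y; rewrite /E' /contract xv yv Exy => /(_ isT).
rewrite /relabel; case: ifP => [/andP[/eqP ex /eqP ey] _|//].
by rewrite ex ey; apply: sub; move: sS; rewrite /side_label -ex -ey Exy.
Qed.

(** Both chains lie entirely between [u] and [w], so only that segment of the order is rearranged,
    by [parallel_exchange]. *)
Lemma feasible_refine p : feasible E L p ->
  exists2 p', feasible E' relabel p' & better kv p' p.
Proof.
move=> Hf; have up := feasible_uniq Hf; have [Hp H] := Hf.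
have HT : subseq (u :: rcons through_label w) p.
  rewrite /through_label rcons_cat rcons_cons -cat_cons.
  by apply: subseq_glue => //; [exact: H Euv|exact: H Evw].
have [s1 [m [s2 [Ep u1 w2 Tm]]]] := subseq_around up HT.
have um : uniq m.
  by move: up; rewrite Ep cat_uniq /= cat_uniq => /and5P[_ _ _ ->].
have Sm : subseq side_label m.
  rewrite /side_label; case: ifP => [Euw|_]; last exact: sub0seq.
  by have := H _ _ Euw; rewrite Ep subseq_after // subseq_before.
have [y Hy Hm] := disjoint_shuffle um Sm Tm side_through_disjoint.
have [m' Hm' bm] := parallel_exchange gA gB sA sB Hy Hm.
rewrite -/merged_label in Hm'.
set o := [seq x <- m | _] in Hm Hm'.
have Fm : [seq x <- m' | x \notin merged_label] = [seq x <- m | x \notin merged_label].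
  have Em (x : nat) : (x \notin merged_label) = (x \notin side_label ++ through_label).
    by rewrite (perm_mem merged_perm).
  rewrite (shuffle_filterr (p := mem merged_label) Hm'); last exact/allP.
  by rewrite (eq_filter Em) /o filter_id (eq_filter Em).
exists (s1 ++ u :: m' ++ w :: s2); last first.
  rewrite Ep; apply: better_cat; first exact: dom_refl.
  rewrite -!cat_cons -(cat1s u m) -(cat1s u m') -!catA.
  exact: better_context.
have Pm : perm_eq m' m.
  rewrite (permPl (shuffle_perm Hm')) (permPr (shuffle_perm Hm)) perm_cat2r.
  by rewrite (permPl merged_perm) perm_sym (shuffle_perm Hy).
split.
  rewrite -(permPr Hp) Ep perm_cat2l perm_cons perm_cat2r //.
move=> a b Eab; rewrite /relabel; case: ifP => [/andP[/eqP -> /eqP ->]|nab].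
  apply: subseq_trans (suffix_subseq _ _).
  rewrite -cats1 -(cat_cons u m') -(cat_cons u merged_label).
  apply: cat_subseq; first by rewrite /= eqxx; exact: shuffle_subseql Hm'.
  by rewrite sub1seq mem_head.
have [{}Eab av bv] := other Eab nab.
have Hc := H _ _ Eab.
(* The constraint of an unaffected arc avoids the merged label, and once that label is deleted the
   old and the new order agree. *)
apply: subseq_trans (filter_subseq (fun x => x \notin merged_label) _).
suff -> : [seq x <- s1 ++ u :: m' ++ w :: s2 | x \notin merged_label] =
          [seq x <- p | x \notin merged_label].
  by rewrite subseq_filter Hc andbT; apply/allP => z; exact: other_disjoint.
by rewrite Ep !filter_cat /= !filter_cat /= Fm.
Qed.

End Step.

Lemma feasible_nil E p : (forall x y, E x y -> x < n /\ y < n) ->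
  perm_eq p (iota 0 n) ->
  feasible E (fun _ _ => [::]) p <->
  (forall x y, E x y -> index x p < index y p).
Proof.
move=> HE Hp; have up : uniq p by rewrite (perm_uniq Hp) iota_uniq.
have H x y : E x y -> subseq [:: x; y] p = (index x p < index y p).
  move=> /HE [xn yn].
  by rewrite subseq_pair_index // (perm_mem Hp) mem_iota add0n.
by split=> [[_ Hf] x y Exy|Hi]; [rewrite -H //; exact: Hf|split=> // x y Exy; rewrite /= H //; exact: Hi].
Qed.

Lemma well_labelled_nil E :
  (forall x, x < n -> exists y, E x y || E y x) ->
  well_labelled E (fun _ _ => [::]).
Proof. by move=> H; split=> // x /H; left. Qed.

(** With one arc left, every vertex is [s], [t] or in the label, which leaves [p] no further vertex
    to hold. *)
Lemma feasible_edge E L s t p : E =2 edge s t -> well_labelled E L ->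
  feasible E L p -> p = s :: rcons (L s t) t.
Proof.
move=> HE Hw Hf; have [Hp H] := Hf; have up := feasible_uniq Hf.
have Est : E s t by rewrite HE /edge !eqxx.
have Hs := H _ _ Est; apply/esym/eqP.
suff Hle : size p <= size (s :: rcons (L s t) t).
  by rewrite -(size_subseq_leqif Hs) eqn_leq (size_subseq Hs) Hle.
apply: (uniq_leq_size up) => x; rewrite (perm_mem Hp) mem_iota add0n /=.
move=> /(wl_cover Hw) [[y]|[a [b []]]].
  by rewrite !HE /edge inE mem_rcons inE => /orP[/andP[-> _]|/andP[_ ->]]; rewrite ?orbT.
rewrite HE => /andP[/eqP -> /eqP ->].
by rewrite inE mem_rcons inE => ->; rewrite !orbT.
Qed.

End Feasible.

(** * Cost-bounded execution *)

Fixpoint assigned (c : cmd) : seq nat :=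
  match c with
  | Skip | Store _ _ => [::]
  | Assign r _ => [:: r]
  | Seq c1 c2 | If _ c1 c2 => assigned c1 ++ assigned c2
  | While _ c1 => assigned c1
  end.

Fixpoint flat (c : cmd) : bool :=
  match c with
  | Skip | Store _ _ | Assign _ _ => true
  | Seq c1 c2 | If _ c1 c2 => flat c1 && flat c2
  | While _ _ => false
  end.

Fixpoint flat_cost (c : cmd) : nat :=
  match c with
  | Skip => 1
  | Assign _ e => (ecost e).+1
  | Store e1 e2 => (ecost e1 + ecost e2).+1
  | Seq c1 c2 => flat_cost c1 + flat_cost c2
  | If e c1 c2 => (ecost e).+1 + maxn (flat_cost c1) (flat_cost c2)
  | While _ _ => 0
  end.

(** A functional semantics for loop-free commands, so that their effect can be computed; on [While]
    the value is a dummy, excluded by [flat]. *)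
Fixpoint run (c : cmd) (st : state) : state :=
  match c with
  | Skip | While _ _ => st
  | Assign r e => State [eta regs st with r |-> eval st e] (cells st)
  | Store e1 e2 => State (regs st) [eta cells st with eval st e1 |-> eval st e2]
  | Seq c1 c2 => run c2 (run c1 st)
  | If e c1 c2 => if eval st e != 0 then run c1 st else run c2 st
  end.

Lemma exec_run c st : flat c -> exists2 T, exec c st T (run c st) & T <= flat_cost c.
Proof.
elim: c st => //=.
- by move=> st _; exists 1 => //; constructor.
- by move=> r e st _; exists (ecost e).+1 => //; constructor.
- by move=> e1 e2 st _; exists (ecost e1 + ecost e2).+1 => //; constructor.
- move=> c1 IH1 c2 IH2 st /andP[/(IH1 st) [T1 H1 L1] /(IH2 (run c1 st)) [T2 H2 L2]].
  by exists (T1 + T2); [exact: exec_seq H1 H2|exact: leq_add].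
- move=> e c1 IH1 c2 IH2 st /andP[/(IH1 st) [T1 H1 L1] /(IH2 st) [T2 H2 L2]].
  case: eqP => [e0|/eqP e0].
    exists ((ecost e).+1 + T2); first exact: exec_if_false.
    by rewrite leq_add2l leq_max L2 orbT.
  exists ((ecost e).+1 + T1); first exact: exec_if_true.
  by rewrite leq_add2l leq_max L1.
Qed.

Lemma exec_frame c st T st' r :
  exec c st T st' -> r \notin assigned c -> regs st' r = regs st r.
Proof.
move=> H; elim: H => {c st T st'} //=.
- by move=> r' e st; rewrite inE => /negPf ->.
- by move=> c1 c2 st T1 st1 T2 st2 _ IH1 _ IH2; rewrite mem_cat negb_or => /andP[/IH1 <- /IH2].
- by move=> e c1 c2 st T st' _ _ IH; rewrite mem_cat negb_or => /andP[/IH].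
- by move=> e c1 c2 st T st' _ _ IH; rewrite mem_cat negb_or => /andP[_ /IH].
- by move=> e c st T1 st1 T2 st2 _ _ IH1 _ IH2 H; rewrite IH2 // IH1.
Qed.

(** A total-correctness triple with a time bound. *)
Definition runs (c : cmd) (st : state) (k : nat) (Q : state -> Prop) : Prop :=
  exists T st', [/\ exec c st T st', T <= k & Q st'].

Definition same_regs (c : cmd) (st st' : state) : Prop :=
  forall r, r \notin assigned c -> regs st' r = regs st r.

Lemma runs_frame c st k (Q : state -> Prop) :
  runs c st k Q -> runs c st k (fun st' => same_regs c st st' /\ Q st').
Proof.
move=> [T [st' [H1 H2 H3]]]; exists T, st'; split=> //; split=> // r.
exact: exec_frame H1.
Qed.

Lemma runs_weaken c st k k' (Q Q' : state -> Prop) :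
  runs c st k Q -> k <= k' -> (forall st', Q st' -> Q' st') -> runs c st k' Q'.
Proof.
move=> [T [st' [H1 H2 H3]]] kk H; exists T, st'; split=> //; last exact: H.
exact: leq_trans kk.
Qed.

Lemma runs_flat c st (Q : state -> Prop) :
  flat c -> Q (run c st) -> runs c st (flat_cost c) Q.
Proof. by move=> /exec_run - /(_ st) [T H1 H2] H; exists T, (run c st). Qed.

Lemma runs_seq c1 c2 st k1 k2 (Q : state -> Prop) :
  runs c1 st k1 (fun st' => runs c2 st' k2 Q) -> runs (Seq c1 c2) st (k1 + k2) Q.
Proof.
move=> [T1 [st1 [H1 L1 [T2 [st2 [H2 L2 HQ]]]]]].
by exists (T1 + T2), st2; split=> //; [exact: exec_seq H1 H2|exact: leq_add].
Qed.

(** The index of [I] is a variant: it strictly decreases and so bounds the number of iterations. The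
    last summand pays for the test that ends the loop. Registers not assigned in the body are known
    to be unchanged throughout. *)
Lemma runs_while (I : nat -> state -> Prop) e c kb st j (Q : state -> Prop) :
  (forall i st', same_regs c st st' -> I i st' -> eval st' e = 0 -> Q st') ->
  (forall i st', same_regs c st st' -> I i st' -> eval st' e <> 0 ->
     runs c st' kb (fun st2 => exists2 i', i' < i & I i' st2)) ->
  I j st -> runs (While e c) st (j * ((ecost e).+1 + kb) + (ecost e).+1) Q.
Proof.
move=> H0 H1 HI.
suff: forall m i st', i <= m -> same_regs c st st' -> I i st' ->
  runs (While e c) st' (i * ((ecost e).+1 + kb) + (ecost e).+1) Q.
  by move=> /(_ j j st (leqnn _)); apply.
elim=> [|m IH] i st' im Hs Hi; have [e0|/eqP e0] := eqVneq (eval st' e) 0.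
- exists (ecost e).+1, st'.
  by split; [exact: exec_while_false|exact: leq_addl|exact: H0 Hi e0].
- have [T [st2 [_ _ [i' i'i _]]]] := H1 _ _ Hs Hi e0.
  by move: im i'i; rewrite leqn0 => /eqP ->.
- exists (ecost e).+1, st'.
  by split; [exact: exec_while_false|exact: leq_addl|exact: H0 Hi e0].
have [T [st2 [Hx LT [i' i'i Hi']]]] := H1 _ _ Hs Hi e0.
have Hs2 : same_regs c st st2.
  by move=> r Hr; rewrite (exec_frame Hx Hr) Hs.
have im' : i' <= m by rewrite -ltnS; exact: leq_trans im.
have [T' [st3 [Hx' LT' HQ]]] := IH i' st2 im' Hs2 Hi'.
exists ((ecost e).+1 + T + T'), st3; split=> //.
  by apply: exec_while_true Hx Hx'; exact/eqP.
apply: leq_trans (leq_add (leq_add (leqnn _) LT) LT') _.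
have : i'.+1 * ((ecost e).+1 + kb) <= i * ((ecost e).+1 + kb) by rewrite leq_mul2r i'i orbT.
by rewrite mulSn; lia.
Qed.

(** * Merging blocks by the keys of their vertices *)

Lemma merge_all_le (T : Type) (leT : rel T) (a s t : seq T) y :
  all (leT^~ y) a -> merge leT (a ++ s) (y :: t) = a ++ merge leT s (y :: t).
Proof. by elim: a => //= x a IH /andP[-> /IH ->]. Qed.

Lemma merge_all_gt (T : Type) (leT : rel T) (b s t : seq T) x :
  all (fun y => ~~ leT x y) b ->
  merge leT (x :: s) (b ++ t) = b ++ merge leT (x :: s) t.
Proof.
by elim: b => //= y b IH /andP[/negPf -> /IH] /= <-.
Qed.

(** The information that replaces the blocks in memory: every vertex carries the key of the block it
    belongs to. *)
Definition keyed (wt : nat -> nat * nat) (K : nat -> nat * nat) (A : seq (seq nat)) :=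
  forall b, b \in A -> b <> [::] /\ forall x, x \in b -> K x = bic wt b.

(** All vertices of a block carry the same key, so the comparison that released its first vertex
    releases the others: a merge of vertices never interrupts a block. *)
Lemma flatten_merge_keyed wt K A B : keyed wt K A -> keyed wt K B ->
  flatten (merge (block_le wt) A B) =
  merge (fun x y => key_le (K x) (K y)) (flatten A) (flatten B).
Proof.
elim: A B => [//|a A IHA] B kA.
have [ak kA'] : (a <> [::] /\ forall x, x \in a -> K x = bic wt a) /\ keyed wt K A.
  split; first by apply: kA; rewrite mem_head.
  by move=> b bA; apply: kA; rewrite inE bA orbT.
have [x [a' ea]] : exists x a', a = x :: a' by case: (a) ak => [[]|x a' _] //; exists x, a'.
elim: B => [|b B IHB] kB; first by rewrite ea.
have [bk kB'] : (b <> [::] /\ forall x, x \in b -> K x = bic wt b) /\ keyed wt K B.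
  split; first by apply: kB; rewrite mem_head.
  by move=> c cB; apply: kB; rewrite inE cB orbT.
have [y [b' eb]] : exists y b', b = y :: b' by case: (b) bk => [[]|y b' _] //; exists y, b'.
rewrite [merge _ (a :: A) (b :: B)]/=; case: ifP => le.
  transitivity (a ++ flatten (merge (block_le wt) A (b :: B))); first by [].
  rewrite (IHA (b :: B) kA' kB) !flatten_cons eb cat_cons merge_all_le //.
  apply/allP => z za; have [_ ->] := ak; last exact: za.
  by have [_ ->] := bk; [exact: le|rewrite eb mem_head].
transitivity (b ++ flatten (merge (block_le wt) (a :: A) B)); first by [].
rewrite (IHB kB') !flatten_cons ea cat_cons merge_all_gt //.
apply/allP => z zb; have [_ ->] := ak; last by rewrite ea mem_head.
by have [_ ->] := bk; [rewrite /block_le in le; rewrite le|].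
Qed.

(** * The program *)

(* Cells.  Cell 0 is cleared once n is known, so that the null pointer is an
   empty label.  Cell 1 + x n + y holds 0 if there is no arc from x to y, and
   otherwise the address of its label, stored as its length followed by its
   vertices.  From b = 1 + n^2 on, there are rows of length n, whose addresses
   are in registers 10 to 23:
     10 addresses of the rows of the matrix     17-19 stack of blocks: start, p, q
     11, 12 out- and indegree, with parallel    20, 21 p, q of the block of a vertex
            arcs                                22 chain through the inner vertex
     13, 14 number of out- and in-neighbours    23 zeros
     15, 16 sum of the out- and in-neighbours
   New labels are allocated at the address in register 1.
   Registers.  0: n; 2, 3, 4: u, v, w; 28, 29, 30: source, length, target of
   the current chain; 32, 33, 34 and 35, 36, 37: addresses and lengths of the
   labels of (u, v), (v, w), (u, w); 38: length of the chain in row 22; 24-27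
   and 9: arguments and result of [keyle]; 31: main loop counter. *)

Definition incr r := Assign r (Add (Reg r) (Cst 1)).
Definition decr r := Assign r (Sub (Reg r) (Cst 1)).

Definition copy : cmd :=
  Seq (Assign 5 (Cst 0))
      (While (Less (Reg 5) (Reg 29))
         (Seq (Store (Add (Reg 30) (Reg 5)) (Fetch (Add (Reg 28) (Reg 5))))
              (incr 5))).

Lemma run_copy st s d len : regs st 28 = s -> regs st 29 = len ->
  regs st 30 = d -> (s + len <= d) || (d + len <= s) ->
  runs copy st (2 + (len * 16 + 4)) (fun st' =>
    (forall t, t < len -> cells st' (d + t) = cells st (s + t)) /\
    (forall a, ~~ (d <= a < d + len) -> cells st' a = cells st a)).
Proof.
move=> Hs Hl Hd D; apply: runs_seq; apply: (@runs_flat (Assign 5 (Cst 0))) => //.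
rewrite /=.
pose I j st' := exists2 i, j = len - i &
  [/\ i <= len, regs st' 5 = i,
      forall t, t < i -> cells st' (d + t) = cells st (s + t) &
      forall a, ~~ (d <= a < d + i) -> cells st' a = cells st a].
apply: (@runs_while I _ _ _ _ len) => [i st' F|i st' F|].
- move=> [k _ [kl E H1 H2]]; rewrite /= E F //= Hl; case: ltnP => // lk _.
  by have -> : len = k by lia.
- move=> [k -> [kl E H1 H2]]; rewrite /= E F //= Hl; case: ltnP => // lk _.
  apply: runs_flat => //=; rewrite E !F //= Hd Hs.
  exists (len - k.+1); first lia.
  exists k.+1 => //; split=> //=; first lia.
  + move=> t tk; case: eqP => [e|ne]; last by apply: H1; lia.
    by rewrite H2; [congr (cells st (s + _)); lia|lia].
  + by move=> a Ha; case: eqP => [e|ne]; [lia|apply: H2; lia].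
- exists 0; first by rewrite subn0.
  by split=> //= a.
Qed.

Definition keyle : cmd :=
  If (Less (Reg 24) (Reg 25))
     (If (Less (Reg 26) (Reg 27))
         (Assign 9 (Less (Reg 24) (Add (Reg 26) (Cst 1))))
         (Assign 9 (Cst 1)))
     (If (Less (Reg 26) (Reg 27))
         (Assign 9 (Cst 0))
         (Assign 9 (Less (Reg 27) (Add (Reg 25) (Cst 1))))).


Lemma run_keyle st : run keyle st =
  State [eta regs st with 9 |-> key_le (regs st 24, regs st 25) (regs st 26, regs st 27) : nat]
        (cells st).
Proof.
rewrite /keyle /= /key_le !addn1 !ltnS /=.
by case: (ltnP (regs st 24) (regs st 25)); case: (ltnP (regs st 26) (regs st 27)).
Qed.

Opaque keyle.

Lemma run_frame c st r : flat c -> r \notin assigned c ->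
  regs (run c st) r = regs st r.
Proof. by move=> /exec_run - /(_ st) [T H _]; exact: exec_frame H. Qed.

(** * Cutting a chain into blocks *)

Definition offset (bs : seq (seq nat)) k := size (flatten (take k bs)).

Lemma offset_rcons bs b k : k <= size bs -> offset (rcons bs b) k = offset bs k.
Proof. by move=> kb; rewrite /offset -cats1 take_cat; case: ltngtP kb => // ->; rewrite subnn take0 cats0 take_size. Qed.

Lemma offset_size bs : offset bs (size bs) = size (flatten bs).
Proof. by rewrite /offset take_size. Qed.

(** Gluing never changes the flattened chain, so a block is determined by its start in that chain
    and the start of the next one; only its key is stored in addition. *)
Definition stack (b n : nat) (wt : nat -> nat * nat) (c : nat -> nat)
    (bs : seq (seq nat)) : Prop :=
  forall t, t < size bs -> [/\ c (b + t) = offset bs t,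
    c (b + n + t) = (bic wt (nth [::] bs t)).1
  & c (b + n + n + t) = (bic wt (nth [::] bs t)).2].

Lemma stack_rcons b n wt c bs a : stack b n wt c (rcons bs a) <->
  stack b n wt c bs /\
  [/\ c (b + size bs) = size (flatten bs), c (b + n + size bs) = (bic wt a).1
    & c (b + n + n + size bs) = (bic wt a).2].
Proof.
split=> [H|[H1 H2] t].
  split=> [t tb|].
    have := H t; rewrite size_rcons nth_rcons tb offset_rcons ?(ltnW tb) //.
    by apply; exact: ltnW.
  have := H (size bs); rewrite size_rcons nth_rcons ltnn eqxx offset_rcons // offset_size.
  by apply.
rewrite size_rcons ltnS nth_rcons leq_eqVlt => /orP[/eqP ->|tb].
  by rewrite ltnn eqxx offset_rcons // offset_size.
by rewrite tb offset_rcons ?(ltnW tb) //; exact: H1.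
Qed.

Lemma stack_ext b n wt c c' bs :
  (forall t, t < size bs -> [/\ c' (b + t) = c (b + t), c' (b + n + t) = c (b + n + t)
                             & c' (b + n + n + t) = c (b + n + n + t)]) ->
  stack b n wt c bs -> stack b n wt c' bs.
Proof. by move=> E H t tb; have [-> -> ->] := E t tb; exact: H. Qed.

(* The stack algorithm for pooling adjacent violators: glue the two topmost
   blocks while they are in the wrong order (register 7), else push the next
   vertex. *)
Definition glue_top : cmd :=
  Seq (Assign 44 (Sub (Reg 6) (Cst 1)))
  (Seq (Assign 45 (Sub (Reg 6) (Cst 2)))
  (Seq (Assign 24 (Fetch (Add (Reg 18) (Reg 45))))
  (Seq (Assign 25 (Fetch (Add (Reg 19) (Reg 45))))
  (Seq (Assign 26 (Fetch (Add (Reg 18) (Reg 44))))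
  (Seq (Assign 27 (Fetch (Add (Reg 19) (Reg 44))))
  (Seq (Store (Add (Reg 18) (Reg 45)) (Add (Reg 24) (Sub (Reg 26) (Reg 25))))
  (Seq (Store (Add (Reg 19) (Reg 45)) (Add (Reg 27) (Sub (Reg 25) (Reg 26))))
       (Assign 6 (Reg 44))))))))).

Definition push : cmd :=
  Seq (Assign 8 (Fetch (Add (Reg 28) (Reg 5))))
  (Seq (Assign 24 (Fetch (Add (Reg 11) (Reg 8))))
  (Seq (Assign 25 (Fetch (Add (Reg 12) (Reg 8))))
  (Seq (Store (Add (Reg 17) (Reg 6)) (Reg 5))
  (Seq (Store (Add (Reg 18) (Reg 6)) (Sub (Reg 24) (Reg 25)))
  (Seq (Store (Add (Reg 19) (Reg 6)) (Sub (Reg 25) (Reg 24)))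
  (Seq (incr 6) (incr 5))))))).

Definition check_top : cmd :=
  If (Less (Cst 1) (Reg 6))
    (Seq (Assign 44 (Sub (Reg 6) (Cst 1)))
    (Seq (Assign 45 (Sub (Reg 6) (Cst 2)))
    (Seq (Assign 24 (Fetch (Add (Reg 18) (Reg 45))))
    (Seq (Assign 25 (Fetch (Add (Reg 19) (Reg 45))))
    (Seq (Assign 26 (Fetch (Add (Reg 18) (Reg 44))))
    (Seq (Assign 27 (Fetch (Add (Reg 19) (Reg 44))))
    (Seq keyle (Assign 7 (Sub (Cst 1) (Reg 9))))))))))
    (Assign 7 (Cst 0)).

Definition pool : cmd :=
  Seq (Assign 5 (Cst 0)) (Seq (Assign 6 (Cst 0)) (Seq (Assign 7 (Cst 0))
  (While (Add (Less (Reg 5) (Reg 29)) (Reg 7))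
     (Seq (If (Reg 7) glue_top push) check_top)))).

Lemma sorted_rcons2 (T : Type) (leT : rel T) s a b :
  sorted leT (rcons (rcons s a) b) = sorted leT (rcons s a) && leT a b.
Proof. by case: s => [|x s] /=; rewrite ?andbT // !rcons_path last_rcons. Qed.

(** All blocks below the topmost are already sorted, so one comparison decides whether the whole
    stack is. *)
Lemma run_check_top st n wt bs :
  regs st 6 = size bs -> regs st 18 = regs st 17 + n -> regs st 19 = regs st 18 + n ->
  stack (regs st 17) n wt (cells st) bs ->
  sorted (block_le wt) (take (size bs).-1 bs) ->
  [/\ forall r, r \notin assigned check_top -> regs (run check_top st) r = regs st r,
      cells (run check_top st) = cells st &
      regs (run check_top st) 7 = ~~ sorted (block_le wt) bs].
Proof.
move=> E6 E18 E19; have [e|] := ltnP 1 (size bs); last first.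
  move=> H _ _; rewrite /= E6 ltnNge H /=; split=> //.
    by move=> r; rewrite !inE; case: (r == 7); rewrite ?orbT.
  by case: bs H {E6} => [|a [|]].
case/lastP: bs e E6 => // bs b; case/lastP: bs => // bs a _ E6.
rewrite stack_rcons stack_rcons => -[[_ [_ A1 A2]] [_ B1 B2]].
rewrite !size_rcons -cats1 take_size_cat ?size_rcons // => sa.
split; first by move=> r; apply: run_frame; vm_compute.
  by rewrite /= run_keyle /=; case: ifP.
rewrite /= run_keyle /= E6 !size_rcons /= E19 E18 subn1 subn2 /=.
rewrite size_rcons in B1 B2.
rewrite A1 A2 B1 B2 cats1 sorted_rcons2 sa /= /block_le -!surjective_pairing.
by case: key_le.
Qed.

Lemma run_glue_top st n wt bs a b0 :
  regs st 6 = (size bs).+2 -> (size bs).+2 <= n ->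
  regs st 18 = regs st 17 + n -> regs st 19 = regs st 18 + n ->
  stack (regs st 17) n wt (cells st) (rcons (rcons bs a) b0) ->
  [/\ regs (run glue_top st) 6 = (size bs).+1,
      stack (regs st 17) n wt (cells (run glue_top st)) (rcons bs (a ++ b0)) &
      forall p, ~~ (regs st 17 <= p < regs st 17 + n + n + n) ->
        cells (run glue_top st) p = cells st p].
Proof.
move=> E6 Hn E18 E19; rewrite !stack_rcons size_rcons.
move=> [[H [A0 A1 A2]] [B0 B1 B2]].
rewrite /glue_top /= E6 E19 E18 subn1 subn2 /=; split=> //.
  apply/stack_rcons; split.
    by apply: (stack_ext _ H) => t tb; rewrite /=; split; (do 2?case: eqP => ?); lia.
  rewrite A1 A2 B1 B2 bic_cat /bmul /=; split.
  - by do 2?(case: eqP => ?; first lia).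
  - by case: eqP => ?; [lia|rewrite eqxx].
  - by rewrite eqxx.
by move=> p Hp; do 2?(case: eqP => ?; first lia).
Qed.

Lemma run_push st n wt bs x :
  regs st 6 = size bs -> size bs < n ->
  regs st 18 = regs st 17 + n -> regs st 19 = regs st 18 + n ->
  cells st (regs st 28 + regs st 5) = x ->
  regs st 5 = size (flatten bs) ->
  wt x = (cells st (regs st 11 + x) - cells st (regs st 12 + x),
          cells st (regs st 12 + x) - cells st (regs st 11 + x)) ->
  stack (regs st 17) n wt (cells st) bs ->
  [/\ regs (run push st) 6 = (size bs).+1, regs (run push st) 5 = (regs st 5).+1,
      stack (regs st 17) n wt (cells (run push st)) (rcons bs [:: x]) &
      forall p, ~~ (regs st 17 <= p < regs st 17 + n + n + n) ->
        cells (run push st) p = cells st p].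
Proof.
move=> E6 Hn E18 E19 Ex E5 Ew H.
rewrite /push /= E6 E19 E18 Ex !addn1; split=> //.
  rewrite stack_rcons; split.
    by apply: (stack_ext _ H) => t tb; rewrite /=; split; (do 3?case: eqP => ?); lia.
  have -> : bic wt [:: x] = wt x by exact: bmul0r.
  rewrite Ew -E5 /=; split.
  - by do 2?(case: eqP => ?; first lia); rewrite eqxx.
  - by case: eqP => ?; [lia|rewrite eqxx].
  - by rewrite eqxx.
by move=> p Hp; do 3?(case: eqP => ?; first lia).
Qed.

Lemma size_flatten_ge (T : Type) (bs : seq (seq T)) :
  all (fun b => 0 < size b) bs -> size bs <= size (flatten bs).
Proof.
by elim: bs => //= b bs IH /andP[b_gt /IH]; rewrite size_cat; lia.
Qed.

Definition pool_body := Seq (If (Reg 7) glue_top push) check_top.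

Lemma run_pool st n wt X :
  let b := regs st 17 in let s := regs st 28 in
  (forall x, x < n -> wt x =
     (cells st (regs st 11 + x) - cells st (regs st 12 + x),
      cells st (regs st 12 + x) - cells st (regs st 11 + x))) ->
  regs st 18 = b + n -> regs st 19 = b + n + n -> regs st 29 = size X ->
  (forall t, t < size X -> cells st (s + t) = nth 0 X t) ->
  size X <= n -> all (ltn^~ n) X ->
  regs st 11 + n <= b -> regs st 12 + n <= b ->
  (s + size X <= b) || (b + n + n + n <= s) ->
  runs pool st (2 + (2 + (2 + ((size X).*2 * (6 + flat_cost pool_body) + 6)))) (fun st' =>
    exists bs, [/\ glued wt (singles X) bs, sorted (block_le wt) bs,
      all (fun b => 0 < size b) bs,
      regs st' 6 = size bs /\ stack b n wt (cells st') bs &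
      forall p, ~~ (b <= p < b + n + n + n) -> cells st' p = cells st p]).
Proof.
move=> b s Hw E18 E19 E29 HX Xn Xlt H11 H12 D.
rewrite /pool; do 3!(apply: runs_seq; apply: (@runs_flat (Assign _ _)) => //; rewrite /=).
set st0 := State _ _.
(* Amortised count: a push lowers 2 (|X| - i) by two and adds one block, a gluing removes one block.
   The variant drops by one each time, hence at most 2 |X| iterations. *)
pose I j st' := exists i bs, [/\ j = (size X - i).*2 + size bs /\ i <= size X,
  regs st' 5 = i, regs st' 6 = size bs /\ regs st' 7 = ~~ sorted (block_le wt) bs,
  [/\ glued wt (singles (take i X)) bs, all (fun b => 0 < size b) bs,
      sorted (block_le wt) (take (size bs).-1 bs) & stack b n wt (cells st') bs] &
  forall p, ~~ (b <= p < b + n + n + n) -> cells st' p = cells st p].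
apply: (@runs_while I _ _ _ _ (size X).*2) => [j st' F|j st' F|]; last first.
- by exists 0, [::]; rewrite take0 subn0 addn0; split=> //; split=> //; exact: glued_refl.
- have {}F r : r \notin assigned pool_body -> regs st' r = regs st0 r by exact: F.
  move=> [i [bs [[-> iX] E5 [E6 E7] [G N S K] C]]].
  rewrite /= E5 E7 F // [regs st0 29]/= E29 => Hcond.
  apply: runs_flat => //.
  pose st1 := run (If (Reg 7) glue_top push) st'.
  rewrite -[run _ st']/(run check_top st1).
  have fl : flat glue_top && flat push by [].
  have F1 r : r \notin assigned pool_body -> regs st1 r = regs st0 r.
    move=> Hr; rewrite /st1 run_frame ?F //.
    by apply: contraNN Hr => H; change (r \in assigned (If (Reg 7) glue_top push) ++ assigned check_top); rewrite mem_cat H.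
  (* Blocks are nonempty, so the stack never outgrows its rows of length n. *)
  have sz : size bs <= i.
    apply: leq_trans (size_flatten_ge N) _; rewrite (glued_flatten G) flatten_singles.
    by rewrite size_take; case: ltnP => //; lia.
  have [bs' [i' [E5' E6' [G' N' S' K'] C' J]]] : exists bs' i', [/\ regs st1 5 = i',
     regs st1 6 = size bs',
     [/\ glued wt (singles (take i' X)) bs', all (fun b => 0 < size b) bs',
      sorted (block_le wt) (take (size bs').-1 bs') & stack b n wt (cells st1) bs'],
     forall p, ~~ (b <= p < b + n + n + n) -> cells st1 p = cells st p &
     (size X - i').*2 + size bs' < (size X - i).*2 + size bs /\ i' <= size X].
    have e18 : regs st' 18 = regs st' 17 + n by rewrite !F.
    have e19 : regs st' 19 = regs st' 18 + n by rewrite !F //= E19 E18.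
    have e17 : regs st' 17 = b by rewrite F.
    have -> : st1 = if sorted (block_le wt) bs then run push st' else run glue_top st'.
      rewrite /st1 -[LHS]/(if regs st' 7 != 0 then run glue_top st' else run push st') E7.
      by case: sorted.
    have [so|nso] := boolP (sorted (block_le wt) bs).
      have {Hcond} iX' : i < size X by move: Hcond; rewrite so; case: ltnP.
      have xi : nth 0 X i < n by move/all_nthP: Xlt; exact.
      have hx : cells st' (regs st' 28 + regs st' 5) = nth 0 X i.
        by rewrite F // E5 C ?HX //= -/s; lia.
      have h5 : regs st' 5 = size (flatten bs).
        by rewrite (glued_flatten G) flatten_singles size_takel.
      have hw : wt (nth 0 X i) = (cells st' (regs st' 11 + nth 0 X i) - cells st' (regs st' 12 + nth 0 X i),
          cells st' (regs st' 12 + nth 0 X i) - cells st' (regs st' 11 + nth 0 X i)).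
        by rewrite !F //= !C ?Hw //; lia.
      have [P6 P5 PK PC] := run_push E6 (leq_ltn_trans sz (leq_trans iX' Xn)) e18 e19 hx h5 hw
        (eq_ind_r (fun c => stack c n wt (cells st') bs) K e17).
      exists (rcons bs [:: nth 0 X i]), i.+1; split; rewrite ?size_rcons //.
      + by rewrite P5 E5.
      + rewrite (take_nth 0) // /singles map_rcons all_rcons /= N.
        split=> //; first exact: glued_rcons.
          by rewrite -cats1 take_size_cat.
        by rewrite e17 in PK.
      + by move=> p Hp; rewrite PC ?e17 // C.
      + by split=> //; lia.
    move: nso sz S N K G E6 {Hcond E7}; case/lastP: bs => // bs b0; case/lastP: bs => // bs a.
    rewrite sorted_rcons2 !size_rcons -[take _ _]/(take (size bs).+1 _) -[X in take _ X]cats1.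
    rewrite take_size_cat ?size_rcons // => nso sz S N K G E6.
    move: nso; rewrite S /= => nab.
    have ba : block_le wt b0 a by case/orP: (block_le_total wt a b0) => //; rewrite (negPf nab).
    have [P6 PK PC] := run_glue_top E6 (leq_trans sz (leq_trans iX Xn)) e18 e19
       (eq_ind_r (fun c => stack c n wt (cells st') _) K e17).
    exists (rcons bs (a ++ b0)), i; split; rewrite ?size_rcons //.
    + split.
      * rewrite -cats1; apply: glued_step ba; rewrite -cat_rcons -cat_rcons cats0 //.
      * by move: N; rewrite !all_rcons size_cat => /and3P[_ h ->]; rewrite ltn_addr.
      * by rewrite -cats1 take_size_cat // ; move: S; rewrite -cats1 => /cat_sorted2[].
      * by rewrite e17 in PK.
    + by move=> p Hp; transitivity (cells st' p); [apply: PC; rewrite e17|apply: C].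
    + by split=> //; lia.
  have e18 : regs st1 18 = regs st1 17 + n by rewrite !F1.
  have e19 : regs st1 19 = regs st1 18 + n by rewrite !F1 //= E19 E18.
  have e17 : regs st1 17 = b by rewrite F1.
  have [R2 C2 R7] := run_check_top E6' e18 e19
    (eq_ind_r (fun c => stack c n wt (cells st1) _) K' e17) S'.
  case: J => J1 J2.
  exists ((size X - i').*2 + size bs') => //; exists i', bs'; split=> //.
  - by rewrite R2.
  - by rewrite R2 // R7.
  - by rewrite C2.
  - by move=> p Hp; rewrite C2 C'.
- move=> [i [bs [[_ iX] E5 [E6 E7] [G N S K] C]]].
  rewrite /= E5 E7 F // [regs st0 29]/= E29 => Hcond.
  have [so ei] : sorted (block_le wt) bs /\ i = size X.
    by move: Hcond; case: sorted; case: ltnP => //=; lia.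
  by exists bs; split=> //; move: G; rewrite ei take_size.
Qed.

(** * Attaching the block keys to the vertices *)

Lemma offsetS bs k : k < size bs ->
  offset bs k.+1 = offset bs k + size (nth [::] bs k).
Proof.
by move=> kb; rewrite /offset (take_nth [::]) // flatten_rcons size_cat.
Qed.

Lemma leq_offset bs j k : j <= k -> offset bs j <= offset bs k.
Proof.
move=> jk; rewrite /offset -(subnKC jk) takeD flatten_cat size_cat; exact: leq_addr.
Qed.

Definition key_at (b c : nat) (m : nat -> nat) (x : nat) := (m (b + x), m (c + x)).

(** The chain is walked backwards: the current block is left exactly when its stored start is
    reached, so block ends need not be stored. *)
Definition spread_body : cmd :=
  Seq (decr 5)
  (Seq (Assign 8 (Fetch (Add (Reg 28) (Reg 5))))
  (Seq (Assign 44 (Sub (Reg 6) (Cst 1)))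
  (Seq (Store (Add (Reg 20) (Reg 8)) (Fetch (Add (Reg 18) (Reg 44))))
  (Seq (Store (Add (Reg 21) (Reg 8)) (Fetch (Add (Reg 19) (Reg 44))))
       (If (Equal (Fetch (Add (Reg 17) (Reg 44))) (Reg 5)) (Assign 6 (Reg 44)) Skip))))).

Definition spread : cmd :=
  Seq (Assign 5 (Reg 29)) (While (Less (Cst 0) (Reg 5)) spread_body).

Lemma run_spread_body st n wt (bs : seq (seq nat)) j b k x :
  regs st 5 = j.+1 -> regs st 6 = k.+1 -> k < size bs -> size bs <= n ->
  regs st 17 = b -> regs st 18 = b + n -> regs st 19 = b + n + n ->
  regs st 20 = b + n + n + n -> regs st 21 = b + n + n + n + n ->
  (~~ (b + n + n + n <= regs st 28 + j < b + n + n + n + n + n)) ->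
  cells st (regs st 28 + j) = x -> x < n ->
  stack b n wt (cells st) bs ->
  let st' := run spread_body st in
  [/\ regs st' 5 = j, regs st' 6 = if offset bs k == j then k else k.+1,
      key_at (b + n + n + n) (b + n + n + n + n) (cells st') x =
        bic wt (nth [::] bs k),
      forall y, y < n -> y != x ->
        key_at (b + n + n + n) (b + n + n + n + n) (cells st') y =
        key_at (b + n + n + n) (b + n + n + n + n) (cells st) y &
      forall p, ~~ (b + n + n + n <= p < b + n + n + n + n + n) ->
        cells st' p = cells st p].
Proof.
move=> E5 E6 kb bn E17 E18 E19 E20 E21 D Ex xn K.
have [K0 K1 K2] := K k kb.
rewrite /spread_body /= E5 E6 !subn1 /= E17 E18 E19 E20 E21 Ex.
have ne : (b + n + n + k == b + n + n + n + x) = false by apply/eqP; lia.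
have ne1 : (b + k == b + n + n + n + n + x) = false by apply/eqP; lia.
have ne2 : (b + k == b + n + n + n + x) = false by apply/eqP; lia.
rewrite ne ne1 ne2 K0 K1 K2.
set c := [eta [eta cells st with _ |-> _] with _ |-> _].
have Kx : key_at (b + n + n + n) (b + n + n + n + n) c x = bic wt (nth [::] bs k).
  rewrite /key_at /c /= eqxx.
  case: eqP => e; first by exfalso; lia.
  by rewrite eqxx -surjective_pairing.
have Ky y : y < n -> y != x -> key_at (b + n + n + n) (b + n + n + n + n) c y =
        key_at (b + n + n + n) (b + n + n + n + n) (cells st) y.
  by move=> yn yx; rewrite /key_at /c /=; do 4?(case: eqP => ?; first lia).
have Kp p : ~~ (b + n + n + n <= p < b + n + n + n + n + n) -> c p = cells st p.
  by move=> Hp; rewrite /c /=; do 2?(case: eqP => ?; first lia).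
by case: (offset bs k == j).
Qed.

Lemma run_spread st n wt (bs : seq (seq nat)) b (X : seq nat) :
  regs st 6 = size bs -> regs st 29 = size X -> flatten bs = X ->
  all (fun a => 0 < size a) bs -> uniq X -> size X <= n -> all (ltn^~ n) X ->
  regs st 17 = b -> regs st 18 = b + n -> regs st 19 = b + n + n ->
  regs st 20 = b + n + n + n -> regs st 21 = b + n + n + n + n ->
  (regs st 28 + size X <= b) || (b + n + n + n + n + n <= regs st 28) ->
  (forall t, t < size X -> cells st (regs st 28 + t) = nth 0 X t) ->
  stack b n wt (cells st) bs ->
  runs spread st (2 + (size X * (4 + flat_cost spread_body) + 4)) (fun st' =>
    let K := key_at (b + n + n + n) (b + n + n + n + n) in
    [/\ keyed wt (K (cells st')) bs,
        forall y, y < n -> y \notin X -> K (cells st') y = K (cells st) y &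
        forall p, ~~ (b + n + n + n <= p < b + n + n + n + n + n) ->
          cells st' p = cells st p]).
Proof.
move=> E6 E29 EX N uX Xn Xlt E17 E18 E19 E20 E21 D HX K.
have bX : size bs <= size X by rewrite -EX; exact: size_flatten_ge.
apply: runs_seq; apply: (@runs_flat (Assign _ _)) => //.
rewrite [run _ _]/= E29; set st0 := State _ _.
pose Kf := key_at (b + n + n + n) (b + n + n + n + n).
pose I j st' := exists sp, [/\ regs st' 5 = j /\ j <= size X,
  regs st' 6 = sp /\ sp <= size bs,
  (* Position j - 1, the next to be treated, lies in block sp - 1. *)
  0 < j -> [/\ 0 < sp, offset bs sp.-1 < j & j <= offset bs sp],
  forall k t, k < size bs -> j <= t -> offset bs k <= t < offset bs k.+1 ->
    Kf (cells st') (nth 0 X t) = bic wt (nth [::] bs k) &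
  (forall p, ~~ (b + n + n + n <= p < b + n + n + n + n + n) ->
          cells st' p = cells st p) /\
  (forall y, y < n -> y \notin X -> Kf (cells st') y = Kf (cells st) y)].
apply: (@runs_while I _ _ _ _ (size X)) => [j st' F|j st' F|]; last first.
- exists (size bs); split=> //.
  + move=> X_gt; have b_gt : 0 < size bs.
      by case: (bs) EX X_gt => //= <-.
    split=> //; last by rewrite offset_size EX.
    rewrite -[X in _ < size X]EX -offset_size -{2}(prednK b_gt) offsetS ?prednK //.
    rewrite -[ltnLHS]addn0 ltn_add2l.
    by move/all_nthP: N => /(_ [::] (size bs).-1); rewrite prednK //; apply.
  + move=> k t kb Xt /andP[_ lt]; exfalso.
    have h := leq_offset bs kb; rewrite offset_size EX in h.
    by have := leq_trans lt (leq_trans h Xt); rewrite ltnn.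
- move=> [sp [[E5 jX] [E6' spb] Hj Hd [C Cy]]]; rewrite /= E5 => j_gt.
  case: j E5 jX Hj Hd j_gt => // j E5 jX Hj Hd _.
  have bn : size bs <= n := leq_trans bX Xn.
  have {Hj} [sp_gt Hj1 Hj2] := Hj isT.
  have xn : nth 0 X j < n by move/all_nthP: Xlt; exact.
  have hx : cells st' (regs st' 28 + j) = nth 0 X j.
    by rewrite F //= C ?HX //; lia.
  have hk : stack b n wt (cells st') bs.
    by apply: (stack_ext _ K) => t tb; split; apply: C; lia.
  have kb : sp.-1 < size bs by rewrite prednK.
  rewrite -(prednK sp_gt) in E6'.
  apply: runs_flat => //.
  have [|||||||P5 P6 Px Py Pp] :=
     @run_spread_body st' n wt bs j b sp.-1 (nth 0 X j) E5 E6' kb _ _ _ _ _ _ _ hx xn hk;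
    rewrite ?F //=; try lia.
  exists j => //.
  exists (if offset bs sp.-1 == j then sp.-1 else sp); split.
  + by rewrite P5; split=> //; exact: ltnW.
  + by rewrite P6 (prednK sp_gt); case: ifP => _; lia.
  + move=> j_gt; case: eqP => e; last by split=> //; lia.
    have s1 : 0 < sp.-1 by rewrite lt0n; apply: contraTneq j_gt => s0; rewrite -e s0 /offset take0.
    split=> //; last by rewrite e.
    rewrite -e -{2}(prednK s1) offsetS ?prednK //; last exact: ltnW.
    rewrite -[ltnLHS]addn0 ltn_add2l.
    by move/all_nthP: N => /(_ [::] sp.-1.-1); apply; lia.
  + move=> k t kbs; rewrite leq_eqVlt => /orP[/eqP <- Hk|jt Hk].
      suff -> : k = sp.-1 by exact: Px.
      case: (ltngtP k sp.-1) => // lt.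
        by have := leq_offset bs lt; lia.
      by have := leq_offset bs lt; rewrite prednK; lia.
    have tX : t < size X.
      by have := leq_offset bs kbs; rewrite offset_size EX; lia.
    rewrite -(Hd k t) //; apply: Py.
      by move/all_nthP: Xlt; exact.
    by rewrite nth_uniq //; lia.
  + split=> [p Hp|y yn yX]; first by rewrite Pp ?C.
    rewrite -Cy //; apply: Py => //; apply: contraNneq yX => ->.
    exact: mem_nth.
- move=> [sp [[E5 jX] [E6' spb] Hj Hd [C Cy]]] /=; rewrite E5.
  case: j E5 jX Hj Hd => // E5 jX Hj Hd _; split=> //.
  move=> B BB; split; first by move/allP: N => /(_ _ BB); case: (B).
  move=> x xB; have kb : index B bs < size bs by rewrite index_mem.
  have nB := nth_index [::] BB.
  have iB : index x B < size B by rewrite index_mem.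
  rewrite -[in RHS]nB -(Hd _ (offset bs (index B bs) + index x B)) //.
    congr (Kf _ _); rewrite -EX -[in flatten bs](cat_take_drop (index B bs) bs) (drop_nth [::]) // nB.
    rewrite flatten_cat flatten_cons nth_cat /offset ltnNge leq_addr /=.
    by rewrite addKn nth_cat iB nth_index.
  by rewrite offsetS // nB leq_addr ltn_add2l.
Qed.

Definition layout (n b : nat) (st : state) : Prop :=
  forall j, j < 14 -> regs st (10 + j) = b + j * n.

Definition canon : cmd := Seq pool spread.

Definition weighs (b n : nat) (wt : nat -> nat * nat) (m : nat -> nat) : Prop :=
  forall x, x < n -> wt x = (m (b + 1 * n + x) - m (b + 2 * n + x),
                             m (b + 2 * n + x) - m (b + 1 * n + x)).

Definition block_key (b n : nat) (m : nat -> nat) : nat -> nat * nat :=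
  key_at (b + 10 * n) (b + 11 * n) m.

Definition canon_cost (k : nat) : nat :=
  (2 + (2 + (2 + (k.*2 * (6 + flat_cost pool_body) + 6)))) +
  (2 + (k * (4 + flat_cost spread_body) + 4)).

(** Keys outside [X] are preserved because the procedure is called on two disjoint chains in turn,
    and the merge needs the keys of both. *)
Lemma run_canon st n b wt (X : seq nat) :
  layout n b st -> weighs b n wt (cells st) -> regs st 29 = size X ->
  (forall t, t < size X -> cells st (regs st 28 + t) = nth 0 X t) ->
  uniq X -> size X <= n -> all (ltn^~ n) X ->
  (regs st 28 + size X <= b) || (b + 12 * n <= regs st 28) ->
  runs canon st (canon_cost (size X)) (fun st' => same_regs canon st st' /\
    exists bs, [/\ glued wt (singles X) bs,
      sorted (block_le wt) bs,
      keyed wt (block_key b n (cells st')) bs,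
      forall y, y < n -> y \notin X ->
        block_key b n (cells st') y = block_key b n (cells st) y &
      forall p, ~~ (b + 7 * n <= p < b + 12 * n) -> cells st' p = cells st p]).
Proof.
move=> L Hw E29 HX uX Xn Xlt D; apply: runs_frame; rewrite /canon_cost; apply: runs_seq.
have E11 : regs st 11 = b + 1 * n := L 1 isT.
have E12 : regs st 12 = b + 2 * n := L 2 isT.
have E17 : regs st 17 = b + 7 * n := L 7 isT.
have E18 : regs st 18 = b + 8 * n := L 8 isT.
have E19 : regs st 19 = b + 9 * n := L 9 isT.
have E20 : regs st 20 = b + 10 * n := L 10 isT.
have E21 : regs st 21 = b + 11 * n := L 11 isT.
have e18 : regs st 18 = regs st 17 + n by lia.
have e19 : regs st 19 = regs st 17 + n + n by lia.
have h11 : regs st 11 + n <= regs st 17 by lia.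
have h12 : regs st 12 + n <= regs st 17 by lia.
have D' : (regs st 28 + size X <= regs st 17) ||
          (regs st 17 + n + n + n <= regs st 28) by lia.
have Hw' : forall x, x < n -> wt x = (cells st (regs st 11 + x) - cells st (regs st 12 + x),
   cells st (regs st 12 + x) - cells st (regs st 11 + x)) by rewrite E11 E12.
have H := runs_frame (run_pool Hw' e18 e19 E29 HX Xn Xlt h11 h12 D').
apply: runs_weaken H (leqnn _) _ => st1 [F [bs [G S N [P6 K] C]]].
rewrite E17 in K C.
have EX : flatten bs = X by rewrite (glued_flatten G) flatten_singles.
have {}F r : r \notin assigned pool -> regs st1 r = regs st r by exact: F.
have f17 : regs st1 17 = b + 7 * n by rewrite F.
have f18 : regs st1 18 = b + 7 * n + n by rewrite F //; lia.
have f19 : regs st1 19 = b + 7 * n + n + n by rewrite F //; lia.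
have f20 : regs st1 20 = b + 7 * n + n + n + n by rewrite F //; lia.
have f21 : regs st1 21 = b + 7 * n + n + n + n + n by rewrite F //; lia.
have f29 : regs st1 29 = size X by rewrite F.
have D2 : (regs st1 28 + size X <= b + 7 * n) ||
          (b + 7 * n + n + n + n + n + n <= regs st1 28) by rewrite F //; lia.
have HX1 t : t < size X -> cells st1 (regs st1 28 + t) = nth 0 X t.
  by move=> tX; rewrite F // C ?HX //; lia.
have H := run_spread P6 f29 EX N uX Xn Xlt f17 f18 f19 f20 f21 D2 HX1 K.
apply: runs_weaken H (leqnn _) _ => st2 [Kd Ky Kp].
have E1 : b + 7 * n + n + n + n = b + 10 * n by lia.
have E2 : b + 7 * n + n + n + n + n = b + 11 * n by lia.
rewrite E2 E1 in Kd Ky Kp.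
exists bs; split=> //.
  move=> y yn yX; rewrite /block_key Ky // /key_at !C //; lia.
by move=> p Hp; rewrite Kp ?C //; lia.
Qed.

(** * Merging two chains of vertices *)

Definition select_body : cmd :=
  If (Less (Reg 39) (Reg 37))
    (If (Less (Reg 40) (Reg 38))
       (Seq (Assign 8 (Fetch (Add (Add (Reg 34) (Cst 1)) (Reg 39))))
       (Seq (Assign 41 (Fetch (Add (Reg 22) (Reg 40))))
       (Seq (Assign 24 (Fetch (Add (Reg 20) (Reg 8))))
       (Seq (Assign 25 (Fetch (Add (Reg 21) (Reg 8))))
       (Seq (Assign 26 (Fetch (Add (Reg 20) (Reg 41))))
       (Seq (Assign 27 (Fetch (Add (Reg 21) (Reg 41)))) keyle))))))
       (Assign 9 (Cst 1)))
    (Assign 9 (Cst 0)).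

Definition emit_body : cmd :=
  If (Reg 9)
    (Seq (Store (Add (Add (Reg 1) (Cst 1)) (Add (Reg 39) (Reg 40)))
                (Fetch (Add (Add (Reg 34) (Cst 1)) (Reg 39))))
         (incr 39))
    (Seq (Store (Add (Add (Reg 1) (Cst 1)) (Add (Reg 39) (Reg 40)))
                (Fetch (Add (Reg 22) (Reg 40))))
         (incr 40)).

Definition merge_chains : cmd :=
  Seq (Assign 39 (Cst 0)) (Seq (Assign 40 (Cst 0))
  (While (Less (Add (Reg 39) (Reg 40)) (Add (Reg 37) (Reg 38)))
     (Seq select_body emit_body))).

Lemma run_select st :
  cells (run select_body st) = cells st /\
  regs (run select_body st) 9 =
   (regs st 39 < regs st 37) && ((regs st 38 <= regs st 40) ||
     key_le (key_at (regs st 20) (regs st 21) (cells st)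
               (cells st (regs st 34 + 1 + regs st 39)))
            (key_at (regs st 20) (regs st 21) (cells st)
               (cells st (regs st 22 + regs st 40)))).
Proof.
rewrite /select_body /= run_keyle /=.
case: (ltnP (regs st 39) (regs st 37)) => //= _.
by case: (ltnP (regs st 40) (regs st 38)).
Qed.

Lemma merges0 (T : Type) (leT : rel T) s : merge leT s [::] = s.
Proof. by case: s. Qed.

Definition merge_cost k := 2 + (2 + (k * (8 + flat_cost (Seq select_body emit_body)) + 8)).

(** Both sources and both rows of keys lie below the target [d], so writing never disturbs what
    remains to be read. *)
Lemma run_merge st n (A B : seq nat) :
  let K := key_at (regs st 20) (regs st 21) (cells st) in
  let d := (regs st 1).+1 in
  let M := merge (fun x y => key_le (K x) (K y)) A B in
  regs st 37 = size A -> regs st 38 = size B ->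
  (forall t, t < size A -> cells st ((regs st 34).+1 + t) = nth 0 A t) ->
  (forall t, t < size B -> cells st (regs st 22 + t) = nth 0 B t) ->
  all (ltn^~ n) A -> all (ltn^~ n) B ->
  (regs st 34).+1 + size A <= d -> regs st 22 + size B <= d ->
  regs st 20 + n <= d -> regs st 21 + n <= d ->
  runs merge_chains st (merge_cost (size A + size B)) (fun st' =>
    [/\ same_regs merge_chains st st',
      forall t, t < size A + size B -> cells st' (d + t) = nth 0 M t &
      forall p, ~~ (d <= p < d + (size A + size B)) -> cells st' p = cells st p]).
Proof.
move=> K d M E37 E38 HA HB Alt Blt DA DB D20 D21.
suff H : runs merge_chains st (merge_cost (size A + size B)) (fun st' =>
   (forall t, t < size A + size B -> cells st' (d + t) = nth 0 M t) /\
      forall p, ~~ (d <= p < d + (size A + size B)) -> cells st' p = cells st p).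
  by apply: runs_weaken (runs_frame H) (leqnn _) _ => st' [? []].
apply: runs_seq; apply: (@runs_flat (Assign _ _)) => //.
apply: runs_seq; apply: (@runs_flat (Assign _ _)) => //.
set st0 := run (Assign 40 _) _.
pose leT x y := key_le (K x) (K y).
pose I j st' := exists i k out,
  [/\ j = size A + size B - (i + k), i <= size A /\ k <= size B,
      regs st' 39 = i /\ regs st' 40 = k,
      size out = i + k /\ M = out ++ merge leT (drop i A) (drop k B) &
      (forall t, t < i + k -> cells st' (d + t) = nth 0 out t) /\
      forall p, ~~ (d <= p < d + (i + k)) -> cells st' p = cells st p].
apply: (@runs_while I _ _ _ _ (size A + size B)) => [j st' F|j st' F|]; last first.
- by exists 0, 0, [::]; rewrite !drop0 subn0; split.
- move=> [i [k [out [-> [iA kB] [E39 E40] [so EM] [H C]]]]].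
  rewrite /= E39 E40 !F // [regs st0 37]/= [regs st0 38]/= E37 E38 => Hc.
  have {Hc} lt : i + k < size A + size B by move: Hc; case: ltnP.
  apply: runs_flat => //.
  pose st1 := run select_body st'.
  rewrite -[run _ st']/(run emit_body st1).
  have [C1 R9] := run_select st'.
  have R r : r \notin assigned select_body -> regs st1 r = regs st' r.
    by move=> Hr; apply: run_frame => //; vm_compute.
  have hA : i < size A -> cells st' ((regs st 34).+1 + i) = nth 0 A i.
    by move=> iA'; rewrite C ?HA //; lia.
  have hB : k < size B -> cells st' (regs st 22 + k) = nth 0 B k.
    by move=> kB'; rewrite C ?HB //; lia.
  have hK x : x < n -> key_at (regs st 20) (regs st 21) (cells st') x = K x.
    by move=> xn; rewrite /key_at /K !C //; lia.
  pose tk := (i < size A) && ((size B <= k) || leT (nth 0 A i) (nth 0 B k)).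
  have R9' : regs st1 9 = tk.
    rewrite R9 /tk E39 E40 !F // /= E37 E38; case: ltnP => //= iA'; case: leqP => //= kB'.
    rewrite addn1 hA // hB // /leT !hK //; [move/all_nthP: Blt|move/all_nthP: Alt]; exact.
  pose z := if tk then nth 0 A i else nth 0 B k.
  pose i' := if tk then i.+1 else i.
  pose k' := if tk then k else k.+1.
  have [S1 S2 S3 EM'] : [/\ i' <= size A, k' <= size B, i' + k' = (i + k).+1 &
     merge leT (drop i A) (drop k B) = z :: merge leT (drop i' A) (drop k' B)].
    rewrite /z /i' /k' /tk; case: (ltnP i (size A)) => iA' /=; last first.
      have kB' : k < size B by lia.
      by rewrite addnS; split=> //; rewrite (drop_oversize iA') (drop_nth 0 kB').
    case: (leqP (size B) k) => kB' /=.
      by split=> //; rewrite (drop_oversize kB') (drop_nth 0 iA') !merges0.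
    case: ifP => le /=; (split=> //; rewrite ?addnS //).
      by rewrite (drop_nth 0 iA') (drop_nth 0 kB') /= le.
    by rewrite (drop_nth 0 iA') (drop_nth 0 kB') /= le.
  have [T1 T2 T3] : [/\ regs (run emit_body st1) 39 = i',
     regs (run emit_body st1) 40 = k' &
     cells (run emit_body st1) = [eta cells st' with d + (i + k) |-> z]].
    have r34 : regs st1 34 = regs st 34 by rewrite R ?F.
    have r22 : regs st1 22 = regs st 22 by rewrite R ?F.
    have r1 : regs st1 1 = regs st 1 by rewrite R ?F.
    have r39 : regs st1 39 = i by rewrite R.
    have r40 : regs st1 40 = k by rewrite R.
    have {}C1 : cells st1 = cells st' := C1.
    have tb (c : bool) : (nat_of_bool c != 0) = c by case: c.
    rewrite /i' /k' /z /emit_body /= R9' tb.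
    case: ifP => [e|ne] /=; rewrite ?r34 ?r22 r1 r39 r40 C1 !addn1; split=> //.
      by rewrite hA //; move: e; rewrite /tk; case: ltnP.
    rewrite hB //; move: ne; rewrite /tk; case: ltnP => /= [iA'|]; last by lia.
    by case: leqP.
  exists (size A + size B - (i + k).+1); first lia.
  exists i', k', (rcons out z); split=> //.
  + by rewrite S3.
  + by rewrite size_rcons so S3 cat_rcons EM EM'.
  + rewrite T3 S3; split=> /= [t|p Hp].
      rewrite ltnS leq_eqVlt nth_rcons so eqn_add2l => /orP[/eqP ->|tik].
        by rewrite eqxx ltnn.
      by rewrite tik (ltn_eqF tik) H.
    by case: eqP => ?; [lia|apply: C; lia].
- move=> [i [k [out [_ [iA kB] [E39 E40] [so EM] [H C]]]]].
  rewrite /= E39 E40 !F // [regs st0 37]/= [regs st0 38]/= E37 E38 => Hc.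
  have [ei ek] : i = size A /\ k = size B by move: Hc; case: ltnP => // *; lia.
  rewrite ei ek !drop_size cats0 in EM; rewrite ei ek in H C.
  by split=> // t Ht; rewrite EM H.
Qed.

Lemma assigned_sub c c' r : all [in assigned c'] (assigned c) ->
  r \notin assigned c' -> r \notin assigned c.
Proof. by move=> /allP H; apply: contraNN => /H. Qed.

(** * Locating the inner vertex and joining its chains *)

(** The loop test is an arithmetical conjunction: it vanishes exactly when both degrees are 1. *)
Definition find_inner : cmd :=
  Seq (Assign 3 (Cst 0))
    (While (Sub (Cst 2) (Add (Equal (Fetch (Add (Reg 13) (Reg 3))) (Cst 1))
                             (Equal (Fetch (Add (Reg 14) (Reg 3))) (Cst 1))))
       (incr 3)).

(** [v0] only guarantees termination and bounds the time; the vertex found may come before it. *)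
Lemma run_find st v0 :
  cells st (regs st 13 + v0) = 1 -> cells st (regs st 14 + v0) = 1 ->
  runs find_inner st (2 + (v0 * 20 + 16)) (fun st' => [/\ same_regs find_inner st st',
    cells st' = cells st, regs st' 3 <= v0,
    cells st (regs st 13 + regs st' 3) = 1 &
    cells st (regs st 14 + regs st' 3) = 1]).
Proof.
move=> H13 H14.
suff H : runs find_inner st (2 + (v0 * 20 + 16)) (fun st' => [/\
    cells st' = cells st, regs st' 3 <= v0,
    cells st (regs st 13 + regs st' 3) = 1 &
    cells st (regs st 14 + regs st' 3) = 1]).
  by apply: runs_weaken (runs_frame H) (leqnn _) _ => st' [? []].
apply: runs_seq; apply: (@runs_flat (Assign _ _)) => //=.
pose I j st' := cells st' = cells st /\ j + regs st' 3 = v0.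
apply: (@runs_while I _ _ _ _ v0) => [j st' F|j st' F|]; last first.
- by split=> //=; rewrite addn0.
- have f13 : regs st' 13 = regs st 13 by rewrite F.
  have f14 : regs st' 14 = regs st 14 by rewrite F.
  move=> [C E]; rewrite /= f13 f14 C => ne.
  case: j E ne => [|j] E; first by rewrite add0n in E; rewrite E H13 H14.
  by move=> _; apply: runs_flat => //=; exists j => //; split=> //=; lia.
- have f13 : regs st' 13 = regs st 13 by rewrite F.
  have f14 : regs st' 14 = regs st 14 by rewrite F.
  move=> [C E]; rewrite /= f13 f14 C => e.
  have [/eqP h1 /eqP h2] : (cells st (regs st 13 + regs st' 3) == 1) /\
      (cells st (regs st 14 + regs st' 3) == 1).
    by move: e; case: (_ == 1); case: (_ == 1).
  by split=> //; lia.
Qed.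

Definition fetch_labels : cmd :=
  Seq (Assign 2 (Fetch (Add (Reg 16) (Reg 3))))
  (Seq (Assign 4 (Fetch (Add (Reg 15) (Reg 3))))
  (Seq (Assign 32 (Fetch (Add (Fetch (Add (Reg 10) (Reg 2))) (Reg 3))))
  (Seq (Assign 33 (Fetch (Add (Fetch (Add (Reg 10) (Reg 3))) (Reg 4))))
  (Seq (Assign 34 (Fetch (Add (Fetch (Add (Reg 10) (Reg 2))) (Reg 4))))
  (Seq (Assign 35 (Fetch (Reg 32)))
  (Seq (Assign 36 (Fetch (Reg 33)))
       (Assign 37 (Fetch (Reg 34))))))))).

Definition join1 :=
  Seq (Assign 28 (Add (Reg 32) (Cst 1))) (Seq (Assign 29 (Reg 35)) (Assign 30 (Reg 22))).
Definition join2 :=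
  Seq (Store (Add (Reg 22) (Reg 35)) (Reg 3))
  (Seq (Assign 28 (Add (Reg 33) (Cst 1)))
  (Seq (Assign 29 (Reg 36)) (Assign 30 (Add (Add (Reg 22) (Reg 35)) (Cst 1))))).
Definition join3 := Assign 38 (Add (Add (Reg 35) (Reg 36)) (Cst 1)).
Definition join : cmd :=
  Seq join1 (Seq copy (Seq join2 (Seq copy join3))).

Definition labelled (m : nat -> nat) (p : nat) (X : seq nat) : Prop :=
  m p = size X /\ forall t, t < size X -> m (p.+1 + t) = nth 0 X t.

Lemma run_join st n b v (X Y : seq nat) :
  layout n b st -> regs st 3 = v -> regs st 35 = size X -> regs st 36 = size Y ->
  labelled (cells st) (regs st 32) X -> labelled (cells st) (regs st 33) Y ->
  b + 13 * n <= regs st 32 -> b + 13 * n <= regs st 33 ->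
  size (X ++ v :: Y) <= n ->
  runs join st (60 + 16 * n) (fun st' => [/\ same_regs join st st',
    regs st' 38 = size (X ++ v :: Y),
    forall t, t < size (X ++ v :: Y) -> cells st' (b + 12 * n + t) = nth 0 (X ++ v :: Y) t &
    forall p, ~~ (b + 12 * n <= p < b + 13 * n) -> cells st' p = cells st p]).
Proof.
move=> L E3 E35 E36 [_ HX] [_ HY] D1 D2; rewrite size_cat /= => XYn.
suff H : runs join st (60 + 16 * n) (fun st' => [/\
    regs st' 38 = size (X ++ v :: Y),
    forall t, t < size (X ++ v :: Y) -> cells st' (b + 12 * n + t) = nth 0 (X ++ v :: Y) t &
    forall p, ~~ (b + 12 * n <= p < b + 13 * n) -> cells st' p = cells st p]).
  by apply: runs_weaken (runs_frame H) (leqnn _) _ => st' [? []]; rewrite size_cat.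
have E22 : regs st 22 = b + 12 * n := L 12 isT.
have H : runs join st (flat_cost join1 + ((2 + (size X * 16 + 4)) + (flat_cost join2 +
    ((2 + (size Y * 16 + 4)) + flat_cost join3)))) (fun st' => [/\
    regs st' 38 = size (X ++ v :: Y),
    forall t, t < size (X ++ v :: Y) -> cells st' (b + 12 * n + t) = nth 0 (X ++ v :: Y) t &
    forall p, ~~ (b + 12 * n <= p < b + 13 * n) -> cells st' p = cells st p]); last first.
  by apply: runs_weaken H _ _ => //=; lia.
apply: runs_seq; apply: runs_flat => //; apply: runs_seq.
set st1 := run join1 st.
have F1 r : r \notin assigned join1 -> regs st1 r = regs st r by exact: run_frame.
have C1 : cells st1 = cells st by [].
have e28 : regs st1 28 = (regs st 32).+1 by rewrite /= addn1.
have e30 : regs st1 30 = b + 12 * n by [].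
have e29 : regs st1 29 = size X by [].
have D3 : ((regs st 32).+1 + size X <= b + 12 * n) || (b + 12 * n + size X <= (regs st 32).+1) by lia.
have R := runs_frame (run_copy e28 e29 e30 D3).
apply: runs_weaken R (leqnn _) _ => st2 [F2 [H2 C2]].
apply: runs_seq; apply: runs_flat => //; apply: runs_seq.
set st3 := run join2 st2.
have F r : r \notin assigned join -> regs st2 r = regs st r.
  by move=> Hr; rewrite F2 ?F1 //; exact: assigned_sub Hr.
have g28 : regs st3 28 = (regs st 33).+1 by rewrite /= F // addn1.
have g29 : regs st3 29 = size Y by rewrite /= F.
have g30 : regs st3 30 = b + 12 * n + size X + 1 by rewrite /= !F // E22 E35.
have D4 : ((regs st 33).+1 + size Y <= b + 12 * n + size X + 1) ||
          (b + 12 * n + size X + 1 + size Y <= (regs st 33).+1) by lia.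
have R3 := runs_frame (run_copy g28 g29 g30 D4).
apply: runs_weaken R3 (leqnn _) _ => st4 [F4 [H4 C4]].
apply: (@runs_flat join3) => //.
have G r : r \notin assigned join -> regs st4 r = regs st r.
  move=> Hr; rewrite F4; last exact: assigned_sub Hr.
  rewrite /st3 run_frame ?F //.
  exact: assigned_sub Hr.
have C3 p : cells st3 p = if p == b + 12 * n + size X then v else cells st2 p.
  by rewrite /= !F // E22 E35 E3.
split.
- by rewrite /= !G // E35 E36 size_cat /=; lia.
- move=> t; rewrite size_cat /= => tXY; rewrite [cells _]/=.
  have [tX|] := ltnP t (size X).
    rewrite C4; last lia.
    rewrite C3 nth_cat tX; case: eqP => [|_]; first lia.
    by rewrite H2 ?C1 ?HX.
  rewrite leq_eqVlt => /orP[/eqP <-|Xt].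
    rewrite C4; last lia.
    by rewrite C3 eqxx nth_cat ltnn subnn.
  have -> : b + 12 * n + t = b + 12 * n + size X + 1 + (t - (size X).+1) by lia.
  rewrite H4; last lia.
  rewrite C3; case: eqP => [|_]; first lia.
  rewrite C2; last lia.
  rewrite C1 HY; last lia.
  rewrite nth_cat ltnNge (ltnW Xt) /=.
  by have -> : t - size X = (t - (size X).+1).+1 by lia.
- move=> p Hp; rewrite [cells _]/= C4; last lia.
  rewrite C3; case: eqP => [|_]; first lia.
  by rewrite C2 //; lia.
Qed.

(** * Updating the matrix and the neighbour sums *)

Definition mat (n x y : nat) := 1 + x * n + y.

Lemma mat_bound n b x y : n * n < b -> x < n -> y < n -> 0 < mat n x y < b.
Proof.
move=> nb xn yn; have : x.+1 * n <= n * n by rewrite leq_mul2r xn orbT.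
by rewrite /mat mulSn; lia.
Qed.

Lemma mat_eq n x y x' y' : y < n -> y' < n ->
  (mat n x y == mat n x' y') = (x == x') && (y == y').
Proof.
move=> yn yn'; have n_gt : 0 < n by lia.
apply/eqP/andP => [|[/eqP -> /eqP ->]] //.
rewrite /mat -!addnA => /addnI e.
have ex : x = x'.
  by have := congr1 (divn^~ n) e; rewrite !divnMDl // !divn_small // !addn0.
by move: e; rewrite ex => /addnI ->; rewrite !eqxx.
Qed.

Lemma row_eq n b k k' x y : x < n -> y < n ->
  (b + k * n + x == b + k' * n + y) = (k == k') && (x == y).
Proof. by move=> xn yn; have := mat_eq k k' xn yn; rewrite /mat -!addnA !eqn_add2l. Qed.

Definition update_matrix : cmd :=
  Seq (Store (Reg 1) (Add (Reg 37) (Reg 38)))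
  (Seq (Store (Add (Fetch (Add (Reg 10) (Reg 2))) (Reg 3)) (Cst 0))
  (Seq (Store (Add (Fetch (Add (Reg 10) (Reg 3))) (Reg 4)) (Cst 0))
       (Store (Add (Fetch (Add (Reg 10) (Reg 2))) (Reg 4)) (Reg 1)))).

Lemma run_seqE c1 c2 st : run (Seq c1 c2) st = run c2 (run c1 st).
Proof. by []. Qed.

(** If the arc from u to w already exists, u and w each lose the neighbour v and nothing replaces
    it. Otherwise w replaces v for u, and u replaces v for w, with degrees unchanged. Registers 8,
    44 and 45 hold the corresponding corrections. *)
Definition pick_terms : cmd :=
  Seq (Assign 8 (Less (Cst 0) (Reg 34)))
  (If (Reg 34) (Seq (Assign 44 (Cst 0)) (Assign 45 (Cst 0)))
               (Seq (Assign 44 (Reg 2)) (Assign 45 (Reg 4)))).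

Definition shift_sums : cmd :=
  Seq (Store (Add (Reg 13) (Reg 2)) (Sub (Fetch (Add (Reg 13) (Reg 2))) (Reg 8)))
  (Seq (Store (Add (Reg 14) (Reg 4)) (Sub (Fetch (Add (Reg 14) (Reg 4))) (Reg 8)))
  (Seq (Store (Add (Reg 15) (Reg 2))
          (Sub (Add (Fetch (Add (Reg 15) (Reg 2))) (Reg 45)) (Reg 3)))
       (Store (Add (Reg 16) (Reg 4))
          (Sub (Add (Fetch (Add (Reg 16) (Reg 4))) (Reg 44)) (Reg 3))))).

(** The free pointer advances by n: a label has fewer than n vertices, so n cells suffice for it and
    its length. *)
Definition clear_sums : cmd :=
  Seq (Store (Add (Reg 13) (Reg 3)) (Cst 0))
  (Seq (Store (Add (Reg 14) (Reg 3)) (Cst 0))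
  (Seq (Store (Add (Reg 15) (Reg 3)) (Cst 0))
  (Seq (Store (Add (Reg 16) (Reg 3)) (Cst 0))
       (Assign 1 (Add (Reg 1) (Reg 0)))))).

Definition update_sums : cmd := Seq pick_terms (Seq shift_sums clear_sums).

Lemma run_update_matrix st n b u v w :
  n * n < b -> regs st 10 = b -> b + 14 * n <= regs st 1 ->
  regs st 2 = u -> regs st 3 = v -> regs st 4 = w -> u < n -> v < n -> w < n ->
  (forall x, x < n -> cells st (b + x) = 1 + x * n) ->
  let st' := run update_matrix st in
  [/\ regs st' = regs st,
     forall x y, x < n -> y < n -> cells st' (mat n x y) =
       if (x == u) && (y == w) then regs st 1
       else if (x == v) && (y == w) then 0
       else if (x == u) && (y == v) then 0 else cells st (mat n x y),
     cells st' (regs st 1) = regs st 37 + regs st 38 &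
     forall p, p != regs st 1 -> ~~ (0 < p < b) -> cells st' p = cells st p].
Proof.
move=> nb E10 HF E2 E3 E4 un vn wn HB.
have [Muv Mvw Muw] := And3 (mat_bound nb un vn) (mat_bound nb vn wn) (mat_bound nb un wn).
have n1 : (b + u == regs st 1) = false by apply/eqP; lia.
have n2 : (b + v == regs st 1) = false by apply/eqP; lia.
have n3 : (b + u == mat n u v) = false by apply/eqP; lia.
have n4 : (b + v == mat n u v) = false by apply/eqP; lia.
have n5 : (b + u == mat n v w) = false by apply/eqP; lia.
rewrite /update_matrix /= E10 E2 E3 E4 n1 n2 !HB // -/(mat n u v) -/(mat n v w) -/(mat n u w) ?n3 ?n4 ?n5.
have nF p : p != regs st 1 -> ~~ (0 < p < b) -> [/\ (p == mat n u w) = false,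
    (p == mat n v w) = false & (p == mat n u v) = false].
  by move=> pF p0; split; apply/eqP => e; rewrite e in p0; rewrite ?Muv ?Mvw ?Muw in p0.
split=> //= [x y xn yn| |p pF p0].
- rewrite !mat_eq //; do 3!case: ifP => // _.
  by have := mat_bound nb xn yn; case: eqP => // ->; lia.
- have -> : (regs st 1 == mat n u w) = false by apply/eqP; lia.
  have -> : (regs st 1 == mat n v w) = false by apply/eqP; lia.
  have -> : (regs st 1 == mat n u v) = false by apply/eqP; lia.
  by rewrite eqxx.
- by have [-> -> ->] := nF p pF p0; rewrite (negPf pF).
Qed.

Lemma run_update_sums st n b u v w :
  layout n b st -> regs st 2 = u -> regs st 3 = v -> regs st 4 = w ->
  u < n -> v < n -> w < n ->
  let st' := run update_sums st in
  let e := 0 < regs st 34 in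
  [/\ regs st' 1 = regs st 1 + regs st 0,
     forall x, x < n -> cells st' (b + 3 * n + x) =
       if x == v then 0 else cells st (b + 3 * n + x) - ((x == u) && e) ,
     forall x, x < n -> cells st' (b + 4 * n + x) =
       if x == v then 0 else cells st (b + 4 * n + x) - ((x == w) && e),
     (forall x, x < n -> cells st' (b + 5 * n + x) =
       if x == v then 0 else if x == u then
         cells st (b + 5 * n + x) + (if e then 0 else w) - v else cells st (b + 5 * n + x)) /\
     forall x, x < n -> cells st' (b + 6 * n + x) =
       if x == v then 0 else if x == w then
         cells st (b + 6 * n + x) + (if e then 0 else u) - v else cells st (b + 6 * n + x) &
     forall p, ~~ (b + 3 * n <= p < b + 7 * n) -> cells st' p = cells st p].
Proof.
move=> L E2 E3 E4 un vn wn.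
have E13 : regs st 13 = b + 3 * n := L 3 isT.
have E14 : regs st 14 = b + 4 * n := L 4 isT.
have E15 : regs st 15 = b + 5 * n := L 5 isT.
have E16 : regs st 16 = b + 6 * n := L 6 isT.
pose st1 := run pick_terms st; pose st2 := run shift_sums st1.
rewrite /update_sums (run_seqE pick_terms) (run_seqE shift_sums) -/st1 -/st2.
have C1 : cells st1 = cells st by rewrite /st1 /=; case: ifP.
have R8 : regs st1 8 = (0 < regs st 34) by rewrite /st1 /=; case: ifP.
have R44 : regs st1 44 = if 0 < regs st 34 then 0 else u.
  by rewrite /st1 /= lt0n; case: ifP.
have R45 : regs st1 45 = if 0 < regs st 34 then 0 else w.
  by rewrite /st1 /= lt0n; case: ifP.
have F r : r \notin assigned pick_terms -> regs st1 r = regs st r.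
  by move=> Hr; rewrite /st1 run_frame.
have F2 r : regs st2 r = regs st1 r by [].
have [f2 f3 f4] : [/\ regs st1 2 = u, regs st1 3 = v & regs st1 4 = w] by rewrite !F.
have [[f13 f14] [f15 f16]] : (regs st1 13 = b + 3 * n /\ regs st1 14 = b + 4 * n) /\
  (regs st1 15 = b + 5 * n /\ regs st1 16 = b + 6 * n) by rewrite !F.
have [g0 g1] : regs st2 0 = regs st 0 /\ regs st2 1 = regs st 1 by rewrite !F2 !F.
have S2 : [/\ forall x, x < n -> cells st2 (b + 3 * n + x) =
       cells st (b + 3 * n + x) - ((x == u) && (0 < regs st 34)),
     forall x, x < n -> cells st2 (b + 4 * n + x) =
       cells st (b + 4 * n + x) - ((x == w) && (0 < regs st 34)),
     forall x, x < n -> cells st2 (b + 5 * n + x) = if x == u then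
         cells st (b + 5 * n + x) + (if 0 < regs st 34 then 0 else w) - v else cells st (b + 5 * n + x),
     forall x, x < n -> cells st2 (b + 6 * n + x) = if x == w then
         cells st (b + 6 * n + x) + (if 0 < regs st 34 then 0 else u) - v else cells st (b + 6 * n + x) &
     forall p, ~~ (b + 3 * n <= p < b + 7 * n) -> cells st2 p = cells st p].
  rewrite /st2 /shift_sums /= R8 R44 R45 C1 f2 f3 f4 f13 f14 f15 f16.
  rewrite !row_eq //=; split=> [x xn|x xn|x xn|x xn|p Hp]; rewrite ?row_eq //=.
  - by case: eqP => [->|_]; rewrite ?subn0.
  - by case: eqP => [->|_]; rewrite ?subn0.
  - by case: eqP => [->|_].
  - by case: eqP => [->|_].
  - by do 4!(case: eqP => [?|_]; first by subst p; lia).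
have [h3 [h13 h14 h15 h16]] : regs st2 3 = v /\ [/\ regs st2 13 = b + 3 * n,
  regs st2 14 = b + 4 * n, regs st2 15 = b + 5 * n & regs st2 16 = b + 6 * n].
  by rewrite !F2.
clearbody st2; case: S2 => S3 S4 S5 S6 Sp.
rewrite /clear_sums /= g0 g1 h3 h13 h14 h15 h16; split=> //= [x xn|x xn||p Hp].
- by rewrite !row_eq //= S3.
- by rewrite !row_eq //= S4.
- by split=> x xn; rewrite !row_eq //= ?S5 ?S6.
- by do 4!(case: eqP => [?|_]; first by subst p; lia); exact: Sp.
Qed.

(** * Neighbour sums and the memory invariant *)

(** With [g] constant 1 this is a degree, with [g = id] a sum of neighbours, and with [g] a
    multiplicity a degree with parallel arcs; one set of lemmas serves all three. *)
Definition vsum (n : nat) (g : nat -> nat) (P : pred nat) : nat :=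
  \sum_(y < n | P y) g y.

Lemma eq_vsum n g (P Q : pred nat) : (forall y, y < n -> P y = Q y) ->
  vsum n g P = vsum n g Q.
Proof. by move=> H; apply: eq_bigl => y; exact: H. Qed.

Lemma vsumD1 n g (P : pred nat) v : v < n -> P v ->
  vsum n g P = g v + vsum n g [pred y | P y && (y != v)].
Proof. by move=> vn Pv; rewrite /vsum (bigD1 (Ordinal vn)). Qed.

Lemma vsum_pred0 n g (P : pred nat) : P =1 xpred0 -> vsum n g P = 0.
Proof. by move=> H; rewrite /vsum big_pred0 // => y; exact: H. Qed.

Lemma vsum_pred1 n g (P : pred nat) w : w < n -> (forall y, P y = (y == w)) ->
  vsum n g P = g w.
Proof.
move=> wn H; rewrite (vsumD1 g wn) ?H // vsum_pred0 ?addn0 // => y /=.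
by rewrite H; case: eqP.
Qed.

Lemma vsum_one n (P : pred nat) : (forall y, P y -> y < n) ->
  vsum n (fun _ => 1) P = 1 ->
  vsum n id P < n /\ forall y, P y = (y == vsum n id P).
Proof.
move=> Pn H1; have [y0 Py0|N] := pickP (fun y : 'I_n => P y); last first.
  by move: H1; rewrite /vsum big_pred0.
have y0n := ltn_ord y0.
have E y : P y = (y == y0 :> nat).
  apply/idP/eqP => [Py|-> //]; apply/eqP; apply: contraTT isT => ne.
  move: H1; rewrite (vsumD1 _ y0n Py0) (@vsumD1 _ _ _ y) ?Pn //.
  by rewrite /= Py ne.
by rewrite (vsum_pred1 _ y0n E).
Qed.

(** The truncated subtraction is exact, since [v] is among the neighbours of [u]. *)
Lemma vsum_contract n g E u v w : inner E u v w -> v < n -> w < n ->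
  vsum n g (contract E u v w u) =
  vsum n g (E u) + (if E u w then 0 else g w) - g v.
Proof.
move=> [H1 H2 uv wv] vn wn; rewrite [vsum n g (E u)](vsumD1 g vn) ?H1 //.
have [Euw|nEuw] := boolP (E u w).
  rewrite addn0 addKn; apply: eq_vsum => y _; rewrite /contract /= uv eqxx /=.
  by case: (eqVneq y w) => [->|_]; rewrite ?Euw ?wv // orbF andbC.
rewrite -addnA addKn (vsumD1 g wn); last by rewrite /contract uv wv !eqxx orbT.
rewrite addnC; congr (_ + _); apply: eq_vsum => y _; rewrite /contract /= uv eqxx /=.
case: (eqVneq y w) => [->|_]; rewrite ?(negPf nEuw) ?andbF // andbT orbF andbC //.
Qed.

(** Reversing all arcs turns statements on out-neighbours into those on in-neighbours. *)
Lemma inner_transpose (E : rel nat) u v w :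
  inner E u v w -> inner (fun x y => E y x) w v u.
Proof. by case=> H1 H2 uv wv; split. Qed.

Lemma contract_transpose (E : rel nat) u v w x y :
  contract (fun x y => E y x) w v u x y = contract E u v w y x.
Proof. by rewrite /contract [(x == w) && _]andbC andbCA. Qed.

Lemma vsum_contract_other n g E u v w x : x != u -> x != v -> inner E u v w ->
  vsum n g (contract E u v w x) = vsum n g (E x).
Proof.
move=> xu xv [H1 _ _ _]; apply: eq_vsum => y _; rewrite /contract xv (negPf xu) orbF /=.
by case: (eqVneq y v) => [->|//]; rewrite H1 (negPf xu).
Qed.

Lemma vsum_contract_dead n g E u v w : vsum n g (contract E u v w v) = 0.
Proof. by apply: vsum_pred0 => y; rewrite /contract eqxx. Qed.

(* Degrees count neighbours, not arcs.  For a vertex of degree 1, the sum of the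
   neighbours is its only neighbour. *)
Record rep (n b : nat) (wt : nat -> nat * nat) (E : rel nat)
    (L : nat -> nat -> seq nat) (st : state) : Prop := Rep {
  rep_layout : layout n b st;
  rep_n : regs st 0 = n;
  rep_b : n * n < b;
  rep_free : b + 14 * n <= regs st 1;
  rep_zero : cells st 0 = 0;
  rep_rows : forall x, x < n -> cells st (b + x) = 1 + x * n;
  rep_weight : weighs b n wt (cells st);
  rep_outdeg : forall x, x < n -> cells st (b + 3 * n + x) = vsum n (fun _ => 1) (E x);
  rep_indeg : forall x, x < n -> cells st (b + 4 * n + x) = vsum n (fun _ => 1) (E^~ x);
  rep_outsum : forall x, x < n -> cells st (b + 5 * n + x) = vsum n id (E x);
  rep_insum : forall x, x < n -> cells st (b + 6 * n + x) = vsum n id (E^~ x);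
  rep_arc : forall x y, x < n -> y < n -> E x y ->
    [/\ b + 13 * n <= cells st (mat n x y), cells st (mat n x y) + n <= regs st 1 &
        labelled (cells st) (cells st (mat n x y)) (L x y)];
  rep_noarc : forall x y, x < n -> y < n -> ~~ E x y -> cells st (mat n x y) = 0
}.

Definition update : cmd := Seq update_matrix update_sums.

Lemma rep_update n b wt E L st u v w X :
  rep n b wt E L st -> inner E u v w -> u < n -> v < n -> w < n ->
  regs st 2 = u -> regs st 3 = v -> regs st 4 = w ->
  regs st 34 = cells st (mat n u w) ->
  (forall x y, E x y -> size (L x y) < n) ->
  regs st 37 + regs st 38 = size X ->
  (forall t, t < size X -> cells st ((regs st 1).+1 + t) = nth 0 X t) ->
  rep n b wt (contract E u v w)
    (fun x y => if (x == u) && (y == w) then X else L x y) (run update st).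
Proof.
move=> R Hi un vn wn E2 E3 E4 E34 HL EX HX.
have [Lay En nb HF m0 Hrows Hw Hod Hid Hos His Harc Hno] := R.
have [H1 H2 uv wv] := Hi.
have E10 : regs st 10 = b by have := Lay 0 isT; rewrite mul0n !addn0.
pose st1 := run update_matrix st; pose st2 := run update_sums st1.
rewrite /update (run_seqE update_matrix) -/st1 -/st2.
have [A1 A2 A3 A4] := run_update_matrix nb E10 HF E2 E3 E4 un vn wn Hrows.
rewrite -/st1 in A1 A2 A3 A4.
have Lay1 : layout n b st1 by move=> j jn; rewrite A1; exact: Lay.
have h2 : regs st1 2 = u by rewrite A1.
have h3 : regs st1 3 = v by rewrite A1.
have h4 : regs st1 4 = w by rewrite A1.
have [B1 B3 B4 [B5 B6] Bp] := run_update_sums Lay1 h2 h3 h4 un vn wn.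
rewrite -/st2 A1 in B1 B3 B4 B5 B6 Bp.
(* Label addresses are at least b + 13 n, hence positive, so 0 can signal a missing arc. *)
have e_arc : (0 < regs st 34) = E u w.
  rewrite E34; have [Euw|nE] := boolP (E u w); last by rewrite Hno.
  by have [+ _ _] := Harc u w un wn Euw; lia.
rewrite e_arc in B3 B4 B5 B6.
have F2 r : r \notin assigned update_sums -> regs st2 r = regs st r.
  by move=> Hr; rewrite /st2 run_frame ?A1.
have M1 p : p != regs st 1 -> b <= p -> cells st1 p = cells st p.
  by move=> pF bp; rewrite A4 // ; lia.
have M2 p : p != regs st 1 -> b <= p -> ~~ (b + 3 * n <= p < b + 7 * n) ->
    cells st2 p = cells st p.
  by move=> pF bp pn; rewrite Bp // M1.
have row1 k x : k < 14 -> x < n -> cells st1 (b + k * n + x) = cells st (b + k * n + x).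
  move=> k14 xn; have : k.+1 * n <= 14 * n by rewrite leq_mul2r k14 orbT.
  by rewrite mulSn => ?; apply: M1; [apply/eqP|]; lia.
have Mm x y : x < n -> y < n -> cells st2 (mat n x y) = cells st1 (mat n x y).
  by move=> xn yn; apply: Bp; have := mat_bound nb xn yn; lia.
clearbody st1 st2.
split.
- move=> j j14; rewrite F2; first exact: Lay.
  by do 14!(case: j j14 => [|j] j14 //).
- by rewrite F2.
- exact: nb.
- by rewrite B1 En; lia.
- by rewrite Bp ?A4 //; [apply/eqP; lia|lia].
- by move=> x xn; rewrite M2 ?Hrows //; [apply/eqP|..]; lia.
- by move=> x xn; rewrite !M2 ?Hw //; try lia; apply/eqP; lia.
- move=> x xn; rewrite B3 // row1 // Hod //.
  case: (eqVneq x v) => [->|xv]; first by rewrite vsum_contract_dead.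
  case: (eqVneq x u) => [->|xu] /=; last by rewrite subn0 (vsum_contract_other _ _ xu xv Hi).
  rewrite (vsum_contract _ Hi vn wn); case: (E u w) => /=; first by rewrite addn0.
  by rewrite addnK subn0.
- move=> x xn; rewrite B4 // row1 // Hid //.
  rewrite -(eq_vsum _ (fun y _ => contract_transpose E u v w x y)).
  case: (eqVneq x v) => [->|xv]; first by rewrite vsum_contract_dead.
  case: (eqVneq x w) => [->|xw] /=; last first.
    by rewrite subn0 (vsum_contract_other _ _ xw xv (inner_transpose Hi)).
  rewrite (vsum_contract _ (inner_transpose Hi) vn un); case: (E u w) => /=; first by rewrite addn0.
  by rewrite addnK subn0.
- move=> x xn; rewrite B5 // row1 // Hos //.
  case: (eqVneq x v) => [->|xv]; first by rewrite vsum_contract_dead.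
  case: (eqVneq x u) => [->|xu]; last by rewrite (vsum_contract_other _ _ xu xv Hi).
  by rewrite (vsum_contract _ Hi vn wn).
- move=> x xn; rewrite B6 // row1 // His //.
  rewrite -(eq_vsum _ (fun y _ => contract_transpose E u v w x y)).
  case: (eqVneq x v) => [->|xv]; first by rewrite vsum_contract_dead.
  case: (eqVneq x w) => [->|xw]; last first.
    by rewrite (vsum_contract_other _ _ xw xv (inner_transpose Hi)).
  by rewrite (vsum_contract _ (inner_transpose Hi) vn un).
- move=> x y xn yn Exy; rewrite Mm // A2 // B1 En.
  case: ifP => [_|nxy].
    split=> //; first lia.
    split=> [|t tX]; first by rewrite Bp ?A3 ?EX //; lia.
    by rewrite Bp ?M1 ?HX //; [apply/eqP|..]; lia.
  move: Exy; rewrite /contract nxy orbF => /and3P[xv yv Exy].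
  rewrite (negPf xv) (negPf yv) !andbF /=.
  have [P1 P2 [P3 P4]] := Harc x y xn yn Exy; have := HL x y Exy => Lxy.
  split=> //; first lia.
  split=> [|t tX]; rewrite M2 ?P3 ?P4 //; try lia; apply/eqP; lia.
- move=> x y xn yn; rewrite Mm // A2 // /contract.
  case: ifP => [/andP[/eqP -> /eqP ->]|nxy]; first by rewrite uv wv orbT.
  case: ifP => [//|nvw]; case: ifP => [//|nuv]; rewrite orbF => nE.
  apply: Hno => //; apply: contraNN nE => Exy; rewrite Exy andbT.
  apply/andP; split; apply/eqP => e.
    by move: Exy nvw; rewrite e H2 => ->; rewrite eqxx.
  by move: Exy nuv; rewrite e H1 => ->; rewrite eqxx.
Qed.

(** Rows 7 to 12 and all cells from the free pointer on are scratch space. *)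
Lemma rep_frame n b wt E L st st' : rep n b wt E L st ->
  (forall x y, E x y -> size (L x y) < n) ->
  (forall r, r \in [:: 0, 1 & iota 10 14] -> regs st' r = regs st r) ->
  (forall p, p < regs st 1 -> ~~ (b + 7 * n <= p < b + 13 * n) ->
     cells st' p = cells st p) -> rep n b wt E L st'.
Proof.
move=> [Lay En nb HF m0 Hrows Hw Hod Hid Hos His Harc Hno] HL R C.
have R1 : regs st' 1 = regs st 1 by rewrite R.
have Mm x y : x < n -> y < n -> cells st' (mat n x y) = cells st (mat n x y).
  by move=> xn yn; apply: C; have := mat_bound nb xn yn; lia.
split; rewrite ?R1 ?R // ?C //; try lia.
- move=> j j14; rewrite R ?Lay // !inE; lia.
- by move=> x xn; rewrite C ?Hrows //; lia.
- by move=> x xn; rewrite !C ?Hw //; lia.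
- by move=> x xn; rewrite C ?Hod //; lia.
- by move=> x xn; rewrite C ?Hid //; lia.
- by move=> x xn; rewrite C ?Hos //; lia.
- by move=> x xn; rewrite C ?His //; lia.
- move=> x y xn yn Exy; rewrite Mm //.
  have [P1 P2 [P3 P4]] := Harc x y xn yn Exy; have := HL x y Exy => Lxy.
  split=> //; split=> [|t tL]; rewrite C ?P3 ?P4 //; lia.
- by move=> x y xn yn /(Hno _ _ xn yn) <-; exact: Mm.
Qed.

(** * One contraction step of the program *)

(** The mere existence of a feasible order controls all chains: they are subsequences of a
    permutation of 0, ..., n - 1. This yields the bounds needed for memory and time. *)
Lemma feasible_subseq n E L p s : feasible n E L p -> subseq s p ->
  [/\ uniq s, all (ltn^~ n) s & size s <= n].
Proof.
move=> Hf Hs; have [Hp _] := Hf; have up := feasible_uniq Hf; split.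
- exact: subseq_uniq Hs up.
- apply/allP => x /(mem_subseq Hs); rewrite (perm_mem Hp) mem_iota add0n //.
- by rewrite -(size_iota 0 n) -(perm_size Hp); exact: size_subseq.
Qed.

Lemma feasible_label n E L p x y : feasible n E L p -> E x y ->
  [/\ uniq (L x y), all (ltn^~ n) (L x y), size (L x y) < n & x != y].
Proof.
move=> Hf Exy; have [_ H] := Hf.
have [] := feasible_subseq Hf (H _ _ Exy).
rewrite /= rcons_uniq mem_rcons inE negb_or all_rcons size_rcons.
by move=> /and3P[/andP[-> _] _ ->] /and3P[_ _ ->] /ltnW ->.
Qed.

Lemma feasible_through n E L p u v w : feasible n E L p -> E u v -> E v w ->
  [/\ uniq (through_label L u v w), all (ltn^~ n) (through_label L u v w),
      size (through_label L u v w) < n & u != w].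
Proof.
move=> Hf Euv Evw; have [_ H] := Hf.
have HT : subseq (u :: rcons (through_label L u v w) w) p.
  rewrite /through_label rcons_cat rcons_cons -cat_cons.
  by apply: subseq_glue; [exact: feasible_uniq Hf|exact: H Euv|exact: H Evw].
have [] := feasible_subseq Hf HT.
rewrite /= rcons_uniq mem_rcons inE negb_or all_rcons size_rcons.
by move=> /and3P[/andP[-> _] _ ->] /and3P[_ _ ->] /ltnW ->.
Qed.

Definition load_side := Seq (Assign 28 (Add (Reg 34) (Cst 1))) (Assign 29 (Reg 37)).
Definition load_through := Seq (Assign 28 (Reg 22)) (Assign 29 (Reg 38)).

Definition step : cmd :=
  Seq find_inner (Seq fetch_labels (Seq join (Seq load_side (Seq canon
  (Seq load_through (Seq canon (Seq merge_chains update))))))).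

Definition step_cost n :=
  (2 + (n * 20 + 16)) + (flat_cost fetch_labels + ((60 + 16 * n) +
  (flat_cost load_side + (canon_cost n + (flat_cost load_through +
  (canon_cost n + (merge_cost (n + n) + flat_cost update))))))).

Lemma run_fetch st n b u v w :
  layout n b st -> u < n -> v < n ->
  (forall x, x < n -> cells st (b + x) = 1 + x * n) ->
  regs st 3 = v -> cells st (b + 5 * n + v) = w -> cells st (b + 6 * n + v) = u ->
  let st' := run fetch_labels st in
  [/\ cells st' = cells st, regs st' 2 = u /\ regs st' 4 = w,
      [/\ regs st' 32 = cells st (mat n u v), regs st' 33 = cells st (mat n v w) &
          regs st' 34 = cells st (mat n u w)] &
      [/\ regs st' 35 = cells st (cells st (mat n u v)),
          regs st' 36 = cells st (cells st (mat n v w)) &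
          regs st' 37 = cells st (cells st (mat n u w))]].
Proof.
move=> L un vn Hrows E3 Ew Eu.
have E10 : regs st 10 = b by have := L 0 isT; rewrite mul0n !addn0.
have E15 : regs st 15 = b + 5 * n := L 5 isT.
have E16 : regs st 16 = b + 6 * n := L 6 isT.
rewrite /fetch_labels /= E16 E15 E3 Eu Ew E10 !Hrows //.
Qed.

Lemma canon_cost_mono k k' : k <= k' -> canon_cost k <= canon_cost k'.
Proof.
rewrite /canon_cost; have -> : flat_cost pool_body = 100 by vm_compute.
have -> : flat_cost spread_body = 38 by vm_compute.
by lia.
Qed.

Lemma merge_cost_mono k k' : k <= k' -> merge_cost k <= merge_cost k'.
Proof. by move=> kk; rewrite /merge_cost !leq_add2l leq_add2r leq_mul2r kk orbT. Qed.

Lemma run_step n b wo wi E L st :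
  rep n b (net_key wo wi) E L st ->
  (forall x y, E x y -> x < n /\ y < n) -> well_labelled n E L ->
  (exists p, feasible n E L p) -> (exists u v w, inner E u v w) ->
  runs step st (step_cost n) (fun st' => same_regs step st st' /\
    exists u v w bA bB, [/\ inner E u v w /\ u != w,
      glued (net_key wo wi) (singles (side_label E L u w)) bA,
      glued (net_key wo wi) (singles (through_label L u v w)) bB,
      sorted (block_le (net_key wo wi)) bA /\ sorted (block_le (net_key wo wi)) bB &
      rep n b (net_key wo wi) (contract E u v w) (relabel wo wi L u w bA bB) st']).
Proof.
move=> R HE Hwl [p Hf] [u0 [v0 [w0 Hi0]]]; set kv := net_key wo wi in R *.
have [Lay En nb HF m0 Hrows Hw Hod Hid Hos His Harc Hno] := R.
have HL x y : E x y -> size (L x y) < n by move=> /(feasible_label Hf) [].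
have v0n : v0 < n by have [H1 _ _ _] := Hi0; have := HE u0 v0; rewrite H1 eqxx => /(_ isT) [].
apply: runs_frame; rewrite /step /step_cost.
have E13 : regs st 13 = b + 3 * n := Lay 3 isT.
have E14 : regs st 14 = b + 4 * n := Lay 4 isT.
have [deg1 deg2] : cells st (regs st 13 + v0) = 1 /\ cells st (regs st 14 + v0) = 1.
  have [H1 H2 _ _] := Hi0.
  have u0n : u0 < n by have := HE u0 v0; rewrite H1 eqxx => /(_ isT) [].
  have w0n : w0 < n by have := HE v0 w0; rewrite H2 eqxx => /(_ isT) [].
  by rewrite E13 E14 Hod // Hid // (vsum_pred1 _ w0n) ?(vsum_pred1 _ u0n).
apply: runs_seq; apply: runs_weaken (run_find deg1 deg2) _ _; first lia.
move=> st1 [F1 C1 v_le]; set v := regs st1 3 in v_le *; rewrite E13 E14.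
have vn : v < n by lia.
rewrite Hod // Hid // => o1 i1.
have [wn Hv] := vsum_one (fun y Ey => (HE v y Ey).2) o1.
have [un Hu] := vsum_one (fun y Ey => (HE y v Ey).1) i1.
set w := vsum n id (E v) in wn Hv; set u := vsum n id (E^~ v) in un Hu.
have Euv : E u v by rewrite Hu eqxx.
have Evw : E v w by rewrite Hv eqxx.
have [_ _ _ uv] := feasible_label Hf Euv; have [_ _ _ vw] := feasible_label Hf Evw.
have Hi : inner E u v w by split=> //; rewrite eq_sym.
have [uT aT sT uw] := feasible_through Hf Euv Evw.
apply: runs_seq; apply: runs_flat => //.
have Lay1 : layout n b st1 by move=> j j14; rewrite F1 ?Lay //; do 14!(case: j j14 => [|j] j14 //).
have rows1 x : x < n -> cells st1 (b + x) = 1 + x * n by rewrite C1; exact: Hrows.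
have os1 : cells st1 (b + 5 * n + v) = w by rewrite C1 Hos.
have is1 : cells st1 (b + 6 * n + v) = u by rewrite C1 His.
have [C2 [R2 R4] [R32 R33 R34] [R35 R36 R37]] := run_fetch Lay1 un vn rows1 (erefl v) os1 is1.
have F2 r : r \notin assigned (Seq find_inner fetch_labels) -> regs (run fetch_labels st1) r = regs st r.
  by move=> Hr; rewrite run_frame ?F1 //; exact: assigned_sub Hr.
have R3 : regs (run fetch_labels st1) 3 = v by rewrite run_frame.
set st2 := run fetch_labels st1 in C2 R2 R4 R32 R33 R34 R35 R36 R37 F2 R3 *.
clearbody st2; rewrite C1 in C2 R32 R33 R34 R35 R36 R37.
have [p1 q1 lab1] := Harc _ _ un vn Euv; have [p2 q2 lab2] := Harc _ _ vn wn Evw.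
have labA : labelled (cells st) (cells st (mat n u w)) (side_label E L u w).
  rewrite /side_label; case: ifP => Euw; first by have [_ _] := Harc _ _ un wn Euw.
  by rewrite (Hno _ _ un wn) ?Euw.
(* Without an arc from u to w the address is 0, and cell 0 holds 0, the length of an empty label. *)
have posA : cells st (mat n u w) = 0 /\ side_label E L u w = [::] \/
   [/\ b + 13 * n <= cells st (mat n u w), cells st (mat n u w) + n <= regs st 1 &
       size (side_label E L u w) < n].
  rewrite /side_label; case: ifP => Euw.
    by right; have [h1 h2 _] := Harc _ _ un wn Euw; split=> //; exact: HL.
  by left; rewrite (Hno _ _ un wn) ?Euw.
have [uA aA] : uniq (side_label E L u w) /\ all (ltn^~ n) (side_label E L u w).
  by rewrite /side_label; case: ifP => // Euw; have [] := feasible_label Hf Euw.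
set A := side_label E L u w in labA posA uA aA *.
set B := through_label L u v w in uT aT sT *.
have sA : size A < n by case: posA => [[_ ->]|[_ _ ->]] //=; lia.
have AB x : x \in A -> x \notin B by exact: (side_through_disjoint Hwl Hi).
have Lay2 : layout n b st2 by move=> j j14; rewrite F2 ?Lay //; do 14!(case: j j14 => [|j] j14 //).
have [a1 l1] := lab1; have [a2 l2] := lab2; have [a3 l3] := labA.
rewrite -R32 in lab1 p1; rewrite -R33 in lab2 p2; rewrite -C2 in lab1 lab2.
rewrite a1 in R35; rewrite a2 in R36; rewrite a3 in R37.
apply: runs_seq; apply: runs_weaken (run_join Lay2 R3 R35 R36 lab1 lab2 p1 p2 (ltnW sT)) (leqnn _) _.
move=> st3 [F3 R38 HB C3]; rewrite -/B in R38 HB; rewrite C2 in C3.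
apply: runs_seq; apply: (@runs_flat load_side) => //.
have F4 r : r \notin assigned (Seq join load_side) -> regs (run load_side st3) r = regs st2 r.
  by move=> Hr; rewrite run_frame ?F3 //; exact: assigned_sub Hr.
have R28 : regs (run load_side st3) 28 = (cells st (mat n u w)).+1 by rewrite /= F3 // R34 addn1.
have R29 : regs (run load_side st3) 29 = size A by rewrite /= F3.
have C4 : cells (run load_side st3) = cells st3 by [].
have R38' : regs (run load_side st3) 38 = size B by [].
set st4 := run load_side st3 in F4 R28 R29 C4 R38' *; clearbody st4; rewrite -C4 in HB C3.
have Lay4 : layout n b st4 by move=> j j14; rewrite F4 ?Lay2 //; do 14!(case: j j14 => [|j] j14 //).
have Hw4 : weighs b n kv (cells st4) by move=> x xn; rewrite !C3 ?Hw //; lia.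
have HA4 t : t < size A -> cells st4 (regs st4 28 + t) = nth 0 A t.
  move=> tA; rewrite R28 C3 ?l3 //.
  by case: posA => [[_ e]|[h1 h2 _]]; [rewrite e in tA|lia].
have DA : (regs st4 28 + size A <= b) || (b + 12 * n <= regs st4 28).
  by rewrite R28; case: posA => [[-> ->] /=|[h1 h2 _]]; lia.
apply: runs_seq; apply: runs_weaken (run_canon Lay4 Hw4 R29 HA4 uA (ltnW sA) aA DA)
   (canon_cost_mono (ltnW sA)) _.
move=> st5 [F5 [bA [gA soA kA _ C5]]].
apply: runs_seq; apply: (@runs_flat load_through) => //.
have F6 r : r \notin assigned (Seq canon load_through) -> regs (run load_through st5) r = regs st4 r.
  by move=> Hr; rewrite run_frame ?F5 //; exact: assigned_sub Hr.
have R28' : regs (run load_through st5) 28 = b + 12 * n.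
  by rewrite /= F5 // (Lay4 12).
have R29' : regs (run load_through st5) 29 = size B.
  by rewrite /= F5.
have C6 : cells (run load_through st5) = cells st5 by [].
set st6 := run load_through st5 in F6 R28' R29' C6 *; clearbody st6; rewrite -C6 in kA C5.
have Lay6 : layout n b st6 by move=> j j14; rewrite F6 ?Lay4 //; do 14!(case: j j14 => [|j] j14 //).
have Hw6 : weighs b n kv (cells st6) by move=> x xn; rewrite !C5 ?Hw4 //; lia.
have HB6 t : t < size B -> cells st6 (regs st6 28 + t) = nth 0 B t.
  by move=> tB; rewrite R28' C5 ?HB //; lia.
have DB : (regs st6 28 + size B <= b) || (b + 12 * n <= regs st6 28).
  by rewrite R28' leqnn orbT.
apply: runs_seq; apply: runs_weaken (run_canon Lay6 Hw6 R29' HB6 uT (ltnW sT) aT DB)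
   (canon_cost_mono (ltnW sT)) _.
move=> st7 [F7 [bB [gB soB kB KB C7]]].
have F r : r \notin assigned (Seq (Seq join load_side) (Seq canon load_through)) ->
    regs st7 r = regs st2 r.
  move=> Hr; rewrite F7; last exact: assigned_sub Hr.
  rewrite F6; last exact: assigned_sub Hr.
  by rewrite F4 //; exact: assigned_sub Hr.
(* The keys of the first chain outlive the second call because the two chains are disjoint. *)
have kA7 : keyed kv (block_key b n (cells st7)) bA.
  move=> a aA'; have [h1 h2] := kA a aA'; split=> // x xa; rewrite -(h2 x xa).
  have xA : x \in A by rewrite -(flatten_singles A) -(glued_flatten gA); apply/flattenP; exists a.
  by apply: KB; [move/allP: aA; exact|exact: AB].
have Cst q : q <= regs st 1 -> ~~ (b + 7 * n <= q < b + 13 * n) -> cells st7 q = cells st q.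
  by move=> pF Hp; rewrite C7 ?C5 ?C3 //; clear -HF pF Hp; lia.
have f1 : regs st7 1 = regs st 1 by rewrite F ?F2.
have f34 : regs st7 34 = cells st (mat n u w) by rewrite F.
have f37 : regs st7 37 = size A by rewrite F.
have f38 : regs st7 38 = size B.
  by rewrite F7 // F6.
have f22 : regs st7 22 = b + 12 * n by rewrite F // (Lay2 12).
have f20 : regs st7 20 = b + 10 * n by rewrite F // (Lay2 10).
have f21 : regs st7 21 = b + 11 * n by rewrite F // (Lay2 11).
have HA7 t : t < size A -> cells st7 ((regs st7 34).+1 + t) = nth 0 A t.
  move=> tA; rewrite f34 Cst ?l3 //; clear -HF tA posA;
    (case: posA => [[_ e]|[h1 h2 h3]]; [by rewrite e in tA|lia]).
have HB7 t : t < size B -> cells st7 (regs st7 22 + t) = nth 0 B t.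
  by move=> tB; rewrite f22 C7 -?R28' ?HB6 //; clear; lia.
have d1 : (regs st7 34).+1 + size A <= (regs st7 1).+1.
  by rewrite f34 f1; case: posA => [[-> ->] //|[h1 h2 h3]]; clear -h2 h3; lia.
have d2 : regs st7 22 + size B <= (regs st7 1).+1 by rewrite f22 f1; clear -HF sT; lia.
have d3 : regs st7 20 + n <= (regs st7 1).+1 by rewrite f20 f1; clear -HF; lia.
have d4 : regs st7 21 + n <= (regs st7 1).+1 by rewrite f21 f1; clear -HF; lia.
have sAB : size A + size B <= n + n by exact: leq_add (ltnW sA) (ltnW sT).
apply: runs_seq; apply: runs_weaken (run_merge f37 f38 HA7 HB7 aA aT d1 d2 d3 d4)
  (merge_cost_mono sAB) _.
move=> st8 [F8 HM C8].
have EM : merge (fun x y => key_le (key_at (regs st7 20) (regs st7 21) (cells st7) x)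
    (key_at (regs st7 20) (regs st7 21) (cells st7) y)) A B =
    merged_label wo wi bA bB.
  rewrite f20 f21 /merged_label (flatten_merge_keyed kA7 kB).
  by rewrite (glued_flatten gA) (glued_flatten gB) !flatten_singles.
rewrite EM in HM.
have sM : size (merged_label wo wi bA bB) = size A + size B.
  by rewrite -EM size_merge size_cat.
have R8 : rep n b kv E L st8.
  apply: rep_frame R HL _ _ => [r|p' pF Hp].
    move=> Hr; have nin c : all [predC [:: 0, 1 & iota 10 14]] (assigned c) -> r \notin assigned c.
      by move=> /allP H; apply/negP => /H; rewrite inE Hr.
    by rewrite F8 ?F ?F2 //; apply: nin.
  by rewrite C8 ?Cst //; [exact: ltnW|rewrite f1; clear -pF; lia].
apply: (@runs_flat update) => //.
exists u, v, w, bA, bB; split=> //.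
apply: (@rep_update n b kv E L st8 u v w (merged_label wo wi bA bB)) => //.
- by rewrite F8 // F.
- by rewrite F8 // F.
- by rewrite F8 // F.
- rewrite F8 // f34 C8 ?Cst //.
    by have := mat_bound nb un wn; clear -HF; lia.
    by have := mat_bound nb un wn; clear -HF; lia.
    by have := mat_bound nb un wn; rewrite f1; clear -HF; lia.
- by rewrite !F8 // f37 f38 sM.
- by move=> t tM; rewrite F8 // HM // -sM.
Qed.

(** * Preparing the memory from the input word *)

(** The machine has no multiplication, so 1 + n^2 is accumulated by n additions. *)
Definition square : cmd :=
  Seq (Assign 10 (Cst 1)) (Seq (Assign 5 (Cst 0))
  (While (Less (Reg 5) (Reg 0)) (Seq (Assign 10 (Add (Reg 10) (Reg 0))) (incr 5)))).

Lemma run_square st n : regs st 0 = n ->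
  runs square st (2 + (2 + (n * 12 + 4))) (fun st' =>
    [/\ regs st' 0 = n, regs st' 10 = 1 + n * n & cells st' = cells st]).
Proof.
move=> En; do 2!(apply: runs_seq; apply: (@runs_flat (Assign _ _)) => //=).
set st0 := State _ _.
pose I j st' := exists i, [/\ j = n - i /\ i <= n, regs st' 5 = i,
  regs st' 10 = 1 + i * n & cells st' = cells st].
apply: (@runs_while I _ _ _ _ n) => [j st' F|j st' F|]; last first.
- by exists 0; rewrite subn0.
- have E0 : regs st' 0 = n by rewrite F.
  move=> [i [[-> iN] E5 E10 C]]; rewrite /= E0 E5; case: ltnP => // lt _.
  apply: runs_flat => //=; exists (n - i.+1); first lia.
  by exists i.+1; split=> //=; rewrite ?E5 ?E10 ?E0 ?mulSn; lia.
- have E0 : regs st' 0 = n by rewrite F.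
  move=> [i [[_ iN] E5 E10 C]]; rewrite /= E0 E5; case: ltnP => // lt _.
  by split=> //; rewrite E10; have -> : i = n by lia.
Qed.

Definition bases : cmd :=
  foldr (fun j c => Seq (Assign (11 + j) (Add (Reg (10 + j)) (Reg 0))) c)
        (Assign 1 (Add (Reg 23) (Reg 0))) (iota 0 13).

Lemma run_bases st n b : regs st 0 = n -> regs st 10 = b ->
  let st' := run bases st in
  [/\ layout n b st', regs st' 0 = n, regs st' 1 = b + 14 * n & cells st' = cells st].
Proof.
move=> E0 E10; rewrite /bases /=; split=> //=; rewrite E0 E10; last lia.
by move=> j j14; do 14!(case: j j14 => [|j] j14; [rewrite /= ?E0 ?E10; lia|]).
Qed.

Definition addto r q e := Store (Add (Reg r) (Reg q)) (Add (Fetch (Add (Reg r) (Reg q))) e).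

Lemma run_addto r q e st p : cells (run (addto r q e) st) p =
  cells st p + (if p == regs st r + regs st q then eval st e else 0).
Proof. by rewrite /=; case: eqP => [->|_]; rewrite ?addn0. Qed.

(** All initial arcs share the row of zeros as their empty label. Overwriting a multiplicity is
    harmless once it has been added to the degrees. *)
Definition tally_arc : cmd :=
  Seq (addto 11 5 (Reg 8)) (Seq (addto 12 6 (Reg 8))
  (Seq (addto 13 5 (Cst 1)) (Seq (addto 14 6 (Cst 1))
  (Seq (addto 15 5 (Reg 6)) (Seq (addto 16 6 (Reg 5)) (Store (Reg 43) (Reg 23))))))).

Lemma run_tally_arc st n b : n * n < b -> layout n b st -> regs st 5 < n -> regs st 6 < n ->
  regs st 43 = mat n (regs st 5) (regs st 6) ->
  let st' := run tally_arc st in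
  [/\ regs st' = regs st,
    [/\ forall x, x < n -> cells st' (b + 1 * n + x) = cells st (b + 1 * n + x) +
         (if x == regs st 5 then regs st 8 else 0),
        forall x, x < n -> cells st' (b + 2 * n + x) = cells st (b + 2 * n + x) +
         (if x == regs st 6 then regs st 8 else 0),
        forall x, x < n -> cells st' (b + 3 * n + x) = cells st (b + 3 * n + x) +
         (if x == regs st 5 then 1 else 0) &
        forall x, x < n -> cells st' (b + 4 * n + x) = cells st (b + 4 * n + x) +
         (if x == regs st 6 then 1 else 0)],
    (forall x, x < n -> cells st' (b + 5 * n + x) = cells st (b + 5 * n + x) +
         (if x == regs st 5 then regs st 6 else 0)) /\
    (forall x, x < n -> cells st' (b + 6 * n + x) = cells st (b + 6 * n + x) +
         (if x == regs st 6 then regs st 5 else 0)),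
    cells st' (regs st 43) = b + 13 * n &
    forall p, p != regs st 43 -> ~~ (b + n <= p < b + 7 * n) -> cells st' p = cells st p].
Proof.
move=> nb L i_lt j_lt E43.
have Mb := mat_bound nb i_lt j_lt.
have [E11 E12] : regs st 11 = b + 1 * n /\ regs st 12 = b + 2 * n := conj (L 1 isT) (L 2 isT).
have [E13 E14] : regs st 13 = b + 3 * n /\ regs st 14 = b + 4 * n := conj (L 3 isT) (L 4 isT).
have [E15 E16] : regs st 15 = b + 5 * n /\ regs st 16 = b + 6 * n := conj (L 5 isT) (L 6 isT).
have E23 : regs st 23 = b + 13 * n := L 13 isT.
(* In additive form the six increments need no case analysis on coinciding addresses; the rows are
   separated only afterwards. *)
have Hp p : p != regs st 43 -> cells (run tally_arc st) p = cells st p +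
  (if p == b + 1 * n + regs st 5 then regs st 8 else 0) +
  (if p == b + 2 * n + regs st 6 then regs st 8 else 0) +
  (if p == b + 3 * n + regs st 5 then 1 else 0) +
  (if p == b + 4 * n + regs st 6 then 1 else 0) +
  (if p == b + 5 * n + regs st 5 then regs st 6 else 0) +
  (if p == b + 6 * n + regs st 6 then regs st 5 else 0).
  move=> pn; rewrite /tally_arc.
  do 6!rewrite (run_seqE (addto _ _ _)).
  set s := run (addto 16 _ _) _.
  have -> : cells (run (Store (Reg 43) (Reg 23)) s) p = cells s p by rewrite /= (negPf pn).
  by rewrite /s !run_addto -E11 -E12 -E13 -E14 -E15 -E16.
have nM k x : x < n -> b + k * n + x != regs st 43.
  by move=> xn; rewrite E43; apply/eqP; lia.
split=> //.
- by split=> x xn; rewrite Hp ?nM // !row_eq //= !addn0.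
- by split=> x xn; rewrite Hp ?nM // !row_eq //= !addn0.
- by rewrite /= eqxx E23.
- move=> p pM Hn; rewrite Hp //.
  by do 6!(case: eqP => [?|_]; first by subst p; lia); rewrite !addn0.
Qed.

Lemma vsum_add n g (P Q : pred nat) (c : bool) j : j < n -> (c -> ~~ P j) ->
  (forall y, y < n -> Q y = P y || c && (y == j)) ->
  vsum n g Q = vsum n g P + (if c then g j else 0).
Proof.
move=> jn Pj H; case: c H Pj => H Pj; last first.
  by rewrite addn0; apply: eq_vsum => y yn; rewrite H // orbF.
rewrite (vsumD1 g jn); last by rewrite H // eqxx orbT.
rewrite addnC; congr (_ + _); apply: eq_vsum => y yn /=; rewrite H //.
by case: eqP => [->|_]; rewrite ?andbF ?(negPf (Pj isT)) // orbF andbT.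
Qed.

Section Scan.
Variables (n b : nat) (mu : nat -> nat -> nat).
Hypothesis nb : n * n < b.

Let E x y := mu x y != 0.
Let seen t x y := E x y && (x * n + y < t).

(** The memory after [t] entries of the matrix in row-major order, entry (x, y) being number x n +
    y. The address of row x is known from its first entry on. *)
Record scanned (t : nat) (m : nat -> nat) : Prop := Scanned {
  sc_zero : m 0 = 0;
  sc_mat : forall x y, x < n -> y < n -> m (mat n x y) =
    if x * n + y < t then (if E x y then b + 13 * n else 0) else mu x y;
  sc_rows : forall x, x < n -> x * n < t -> m (b + x) = 1 + x * n;
  sc_out : forall x, x < n -> m (b + 1 * n + x) = vsum n (mu x) (seen t x);
  sc_in : forall x, x < n -> m (b + 2 * n + x) = vsum n (mu^~ x) (seen t ^~ x);
  sc_outdeg : forall x, x < n -> m (b + 3 * n + x) = vsum n (fun _ => 1) (seen t x);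
  sc_indeg : forall x, x < n -> m (b + 4 * n + x) = vsum n (fun _ => 1) (seen t ^~ x);
  sc_outsum : forall x, x < n -> m (b + 5 * n + x) = vsum n id (seen t x);
  sc_insum : forall x, x < n -> m (b + 6 * n + x) = vsum n id (seen t ^~ x);
  sc_rest : forall p, b + 7 * n <= p -> m p = 0
}.

Lemma seen_next i j x y : i < n -> j < n -> x < n -> y < n ->
  seen (i * n + j).+1 x y = seen (i * n + j) x y || [&& E i j, x == i & y == j].
Proof.
move=> i_lt j_lt xn yn; rewrite /seen ltnS leq_eqVlt.
have -> : (x * n + y == i * n + j) = (x == i) && (y == j).
  by have := mat_eq x i yn j_lt; rewrite /mat -!addnA eqn_add2l.
by case: eqP => [->|_]; case: eqP => [->|_]; rewrite ?andbF ?orbF ?ltnn ?andbF ?andbT.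
Qed.

Lemma vsum_seen_row g i j x : i < n -> j < n -> x < n ->
  vsum n g (seen (i * n + j).+1 x) =
  vsum n g (seen (i * n + j) x) + (if E i j && (x == i) then g j else 0).
Proof.
move=> i_lt j_lt xn; apply: vsum_add => // [|y yn]; last by rewrite seen_next // andbA.
by move=> /andP[_ /eqP ->]; rewrite /seen ltnn andbF.
Qed.

Lemma vsum_seen_col g i j y : i < n -> j < n -> y < n ->
  vsum n g (seen (i * n + j).+1 ^~ y) =
  vsum n g (seen (i * n + j) ^~ y) + (if E i j && (y == j) then g i else 0).
Proof.
move=> i_lt j_lt yn; apply: vsum_add => // [|x xn]; last first.
  by rewrite seen_next // andbAC andbA.
by move=> /andP[_ /eqP ->]; rewrite /seen ltnn andbF.
Qed.

Lemma scanned_step i j m m' : i < n -> j < n -> scanned (i * n + j) m ->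
  m' (mat n i j) = (if E i j then b + 13 * n else 0) -> m' (b + i) = 1 + i * n ->
  [/\ forall x, x < n -> m' (b + 1 * n + x) = m (b + 1 * n + x) +
         (if E i j && (x == i) then mu i j else 0),
      forall x, x < n -> m' (b + 2 * n + x) = m (b + 2 * n + x) +
         (if E i j && (x == j) then mu i j else 0),
      forall x, x < n -> m' (b + 3 * n + x) = m (b + 3 * n + x) +
         (if E i j && (x == i) then 1 else 0) &
      forall x, x < n -> m' (b + 4 * n + x) = m (b + 4 * n + x) +
         (if E i j && (x == j) then 1 else 0)] ->
  (forall x, x < n -> m' (b + 5 * n + x) = m (b + 5 * n + x) +
         (if E i j && (x == i) then j else 0)) ->
  (forall x, x < n -> m' (b + 6 * n + x) = m (b + 6 * n + x) +
         (if E i j && (x == j) then i else 0)) ->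
  (forall p, p != mat n i j -> p != b + i -> ~~ (b + n <= p < b + 7 * n) -> m' p = m p) ->
  scanned (i * n + j).+1 m'.
Proof.
move=> i_lt j_lt [S0 Sm Sr S1 S2 S3 S4 S5 S6 Sz] Hm Hr [H1 H2 H3 H4] H5 H6 Hp.
have Mb := mat_bound nb i_lt j_lt.
split.
- by rewrite Hp //; try (apply/eqP); lia.
- move=> x y xn yn; have := mat_bound nb xn yn => Mxy.
  have [e|ne] := boolP (mat n x y == mat n i j).
    move: (e); rewrite mat_eq // => /andP[/eqP -> /eqP ->].
    by rewrite Hm ltnSn.
  rewrite Hp // ?Sm //; try (apply/eqP); try lia.
  have -> // : (x * n + y < (i * n + j).+1) = (x * n + y < i * n + j).
  rewrite ltnS leq_eqVlt; case: eqP => // e; move: ne.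
  by rewrite /mat -!addnA e eqxx.
- move=> x xn; have [->|xi] := eqVneq x i; first by rewrite Hr.
  rewrite ltnS => xt; rewrite Hp ?Sr //; try (apply/eqP; lia); try lia.
  move: xt; rewrite leq_eqVlt => /orP[/eqP e|//].
  have := mat_eq x i (leq_ltn_trans (leq0n j) j_lt) j_lt.
  by rewrite /mat addn0 -addnA e eqxx (negPf xi).
- by move=> x xn; rewrite H1 // S1 // (vsum_seen_row _ i_lt j_lt xn); case: eqP => [->|]; rewrite ?andbF.
- by move=> x xn; rewrite H2 // S2 // (vsum_seen_col _ i_lt j_lt xn); case: eqP => [->|]; rewrite ?andbF.
- by move=> x xn; rewrite H3 // S3 // (vsum_seen_row _ i_lt j_lt xn).
- by move=> x xn; rewrite H4 // S4 // (vsum_seen_col _ i_lt j_lt xn).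
- by move=> x xn; rewrite H5 // S5 // (vsum_seen_row _ i_lt j_lt xn).
- by move=> x xn; rewrite H6 // S6 // (vsum_seen_col _ i_lt j_lt xn).
- by move=> p bp; rewrite Hp ?Sz //; try (apply/eqP); lia.
Qed.

End Scan.

(** The address 1 + i n of the current row is the current address minus the column, which again
    avoids a multiplication. *)
Definition advance : cmd :=
  Seq (Store (Add (Reg 10) (Reg 5)) (Sub (Reg 43) (Reg 6)))
  (Seq (incr 6) (Seq (incr 43)
       (If (Equal (Reg 6) (Reg 0)) (Seq (Assign 6 (Cst 0)) (incr 5)) Skip))).

Definition scan_body : cmd :=
  Seq (Assign 8 (Fetch (Reg 43))) (Seq (If (Reg 8) tally_arc Skip) advance).

Lemma run_scan_body st n b mu i j : n * n < b -> layout n b st -> regs st 0 = n ->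
  i < n -> j < n -> regs st 5 = i -> regs st 6 = j -> regs st 43 = mat n i j ->
  scanned n b mu (i * n + j) (cells st) ->
  let st' := run scan_body st in
  [/\ scanned n b mu (i * n + j).+1 (cells st'),
      regs st' 43 = (mat n i j).+1 &
      if j.+1 == n then regs st' 5 = i.+1 /\ regs st' 6 = 0
      else regs st' 5 = i /\ regs st' 6 = j.+1].
Proof.
move=> nb L E0 i_lt j_lt E5 E6 E43 S; rewrite /scan_body.
rewrite (run_seqE (Assign 8 _)) (run_seqE (If _ tally_arc Skip)).
set st1 := run (Assign 8 _) st; set st2 := run (If (Reg 8) _ _) st1.
have C1 : cells st1 = cells st by [].
have R8 : regs st1 8 = mu i j by rewrite /= E43 (sc_mat S) // ltnn.
have R1 r : r != 8 -> regs st1 r = regs st r by move=> /negPf /= ->.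
have L1 : layout n b st1 by move=> k k14; rewrite R1 ?L //; lia.
have e43 : regs st1 43 = mat n (regs st1 5) (regs st1 6) by rewrite !R1 // E43 E5 E6.
have i1 : regs st1 5 < n by rewrite R1 // E5.
have j1 : regs st1 6 < n by rewrite R1 // E6.
have E2 : st2 = if mu i j != 0 then run tally_arc st1 else st1.
  by rewrite -R8.
have R2 : regs st2 = regs st1.
  by rewrite E2; case: ifP => // _; have [->] := run_tally_arc nb L1 i1 j1 e43.
have Mb := mat_bound nb i_lt j_lt.
have T : [/\ cells st2 (mat n i j) = (if mu i j != 0 then b + 13 * n else 0),
   [/\ forall x, x < n -> cells st2 (b + 1 * n + x) = cells st (b + 1 * n + x) +
         (if (mu i j != 0) && (x == i) then mu i j else 0),
      forall x, x < n -> cells st2 (b + 2 * n + x) = cells st (b + 2 * n + x) +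
         (if (mu i j != 0) && (x == j) then mu i j else 0),
      forall x, x < n -> cells st2 (b + 3 * n + x) = cells st (b + 3 * n + x) +
         (if (mu i j != 0) && (x == i) then 1 else 0) &
      forall x, x < n -> cells st2 (b + 4 * n + x) = cells st (b + 4 * n + x) +
         (if (mu i j != 0) && (x == j) then 1 else 0)],
   forall x, x < n -> cells st2 (b + 5 * n + x) = cells st (b + 5 * n + x) +
         (if (mu i j != 0) && (x == i) then j else 0),
   forall x, x < n -> cells st2 (b + 6 * n + x) = cells st (b + 6 * n + x) +
         (if (mu i j != 0) && (x == j) then i else 0) &
   forall p, p != mat n i j -> ~~ (b + n <= p < b + 7 * n) -> cells st2 p = cells st p].
  rewrite E2; have [mu0|mu0] := eqVneq (mu i j) 0.
    rewrite /=; split=> //; try by move=> x xn; rewrite addn0.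
      by rewrite (sc_mat S) // ltnn mu0.
    by split=> x xn; rewrite addn0.
  have [_ [H1 H2 H3 H4] [H5 H6] H7 H8] := run_tally_arc nb L1 i1 j1 e43.
  rewrite R8 !R1 // E5 E6 C1 E43 in H1 H2 H3 H4 H5 H6 H7 H8.
  by split.
have [h0 [h5 h6 h10 h43]] : regs st2 0 = n /\
  [/\ regs st2 5 = i, regs st2 6 = j, regs st2 10 = b & regs st2 43 = mat n i j].
  rewrite R2 !R1 // E0 E5 E6 E43; split=> //; split=> //.
  by have := L 0 isT; rewrite mul0n !addn0.
clearbody st2; case: T => T0 T1 T5 T6 Tp.
have V : cells (run advance st2) = [eta cells st2 with b + i |-> 1 + i * n].
  by rewrite /= h0 h5 h6 h10 h43 /mat addnK; case: ifP.
split.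
- apply: (scanned_step nb i_lt j_lt S); rewrite V /=.
  + by case: eqP => [?|//]; lia.
  + by rewrite eqxx.
  + case: T1 => T1 T2 T3 T4; split=> x xn; (case: eqP => [?|_]; first lia);
    by rewrite ?T1 ?T2 ?T3 ?T4.
  + by move=> x xn; case: eqP => [?|_]; [lia|exact: T5].
  + by move=> x xn; case: eqP => [?|_]; [lia|exact: T6].
  + by move=> p p1 p2 p3; rewrite (negPf p2); exact: Tp.
- by rewrite /= h0 h6 h43 !addn1; case: ifP.
- rewrite /= h0 h5 h6 !addn1; case: (j.+1 == n) => /=; rewrite ?h5 ?h6 ?addn1 //.
Qed.

Definition read_size : cmd := Seq (Assign 0 (Fetch (Cst 0))) (Store (Cst 0) (Cst 0)).
Definition rewind : cmd := Seq (Assign 5 (Cst 0)) (Seq (Assign 6 (Cst 0)) (Assign 43 (Cst 1))).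

Definition prepare : cmd :=
  Seq read_size (Seq square (Seq bases (Seq rewind
    (While (Less (Reg 5) (Reg 0)) scan_body)))).

Definition prepare_cost n :=
  flat_cost read_size + ((2 + (2 + (n * 12 + 4))) + (flat_cost bases +
  (flat_cost rewind + (n * n * (4 + flat_cost scan_body) + 4)))).

Lemma run_scan st n b mu : 0 < n -> n * n < b -> layout n b st -> regs st 0 = n ->
  regs st 5 = 0 -> regs st 6 = 0 -> regs st 43 = 1 -> scanned n b mu 0 (cells st) ->
  runs (While (Less (Reg 5) (Reg 0)) scan_body) st
    (n * n * (4 + flat_cost scan_body) + 4)
    (fun st' => same_regs scan_body st st' /\ scanned n b mu (n * n) (cells st')).
Proof.
move=> n_gt nb L E0 E5 E6 E43 S; apply: runs_frame.
pose I k st' := exists i j, [/\ k + (i * n + j) = n * n /\ j < n,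
  regs st' 5 = i, regs st' 6 = j, regs st' 43 = mat n i j &
  scanned n b mu (i * n + j) (cells st')].
apply: (@runs_while I _ _ _ _ (n * n)) => [k st' F|k st' F|]; last first.
- by exists 0, 0; split=> //; split=> //; lia.
- have L' : layout n b st'.
    by move=> k' k14; rewrite F ?L //; do 14!(case: k' k14 => [|k'] k14 //).
  have E0' : regs st' 0 = n by rewrite F.
  move=> [i [j [[Hk jn] E5' E6' E43' S']]]; rewrite /= E0' E5'; case: ltnP => // i_lt _.
  have nn : i.+1 * n <= n * n by rewrite leq_mul2r i_lt orbT.
  have [S2 R43 R56] := run_scan_body nb L' E0' i_lt jn E5' E6' E43' S'.
  apply: runs_flat; first by vm_compute.
  have k_gt : 0 < k by move: nn Hk; rewrite mulSn; lia.
  exists k.-1; first by lia.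
  move: R56; case: eqP => [e|ne] [R5 R6].
    exists i.+1, 0; split=> //.
    + by split=> //; rewrite mulSn; lia.
    + by rewrite R43 /mat mulSn; lia.
    + by have -> : i.+1 * n + 0 = (i * n + j).+1 by rewrite mulSn; lia.
  exists i, j.+1; split=> //.
  + by split; lia.
  + by rewrite R43 /mat addnS.
  + by rewrite addnS.
- have E0' : regs st' 0 = n by rewrite F.
  move=> [i [j [[Hk jn] E5' E6' E43' S']]]; rewrite /= E0' E5'; case: ltnP => // i_ge _.
  have nn : n * n <= i * n by rewrite leq_mul2r i_ge orbT.
  by have <- : i * n + j = n * n by lia.
Qed.

Lemma seen_all n (mu : nat -> nat -> nat) x y : x < n -> y < n ->
  (mu x y != 0) && (x * n + y < n * n) = (mu x y != 0).
Proof.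
move=> xn yn; have : x.+1 * n <= n * n by rewrite leq_mul2r xn orbT.
by rewrite mulSn => ?; rewrite andbC; have -> : x * n + y < n * n by lia.
Qed.

Lemma vsum_support n (g : nat -> nat) :
  vsum n g (fun y => g y != 0) = \sum_(y < n) g y.
Proof.
rewrite /vsum big_mkcond /=; apply: eq_bigr => y _.
by case: eqP => // ->.
Qed.

Lemma scanned_init n b mu m : n * n < b -> m 0 = 0 ->
  (forall x y, x < n -> y < n -> m (mat n x y) = mu x y) ->
  (forall p, b <= p -> m p = 0) -> scanned n b mu 0 m.
Proof.
move=> nb m0 Cm Cz; split=> //.
- by move=> x xn; rewrite vsum_pred0 => [|y]; [rewrite Cz //; lia|rewrite ltn0 andbF].
- by move=> x xn; rewrite vsum_pred0 => [|y]; [rewrite Cz //; lia|rewrite /= ltn0 andbF].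
- by move=> x xn; rewrite vsum_pred0 => [|y]; [rewrite Cz //; lia|rewrite ltn0 andbF].
- by move=> x xn; rewrite vsum_pred0 => [|y]; [rewrite Cz //; lia|rewrite /= ltn0 andbF].
- by move=> x xn; rewrite vsum_pred0 => [|y]; [rewrite Cz //; lia|rewrite ltn0 andbF].
- by move=> x xn; rewrite vsum_pred0 => [|y]; [rewrite Cz //; lia|rewrite /= ltn0 andbF].
- by move=> p bp; rewrite Cz //; lia.
Qed.

Lemma scanned_rep n b mu (E : rel nat) wo wi st : n * n < b -> 0 < n ->
  layout n b st -> regs st 0 = n -> regs st 1 = b + 14 * n ->
  (forall x y, E x y = (mu x y != 0)) ->
  (forall x, x < n -> wo x = \sum_(y < n) mu x y) ->
  (forall x, x < n -> wi x = \sum_(y < n) mu y x) ->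
  scanned n b mu (n * n) (cells st) ->
  rep n b (net_key wo wi) E (fun _ _ => [::]) st.
Proof.
move=> nb n_gt L E0 E1 HE Hwo Hwi [S0 Sm Sr S1 S2 S3 S4 S5 S6 Sz].
have row x y : x < n -> y < n -> E x y = (mu x y != 0) && (x * n + y < n * n).
  by move=> xn yn; rewrite HE seen_all.
split=> //.
- by rewrite E1.
- by move=> x xn; apply: Sr => //; rewrite ltn_mul2r n_gt.
- move=> x xn; rewrite /net_key.
  have -> : wo x = cells st (b + 1 * n + x).
    rewrite Hwo // S1 // -(vsum_support n (mu x)).
    by apply: eq_vsum => y yn; rewrite seen_all.
  have -> // : wi x = cells st (b + 2 * n + x).
  rewrite Hwi // S2 // -(vsum_support n (mu^~ x)).
  by apply: eq_vsum => y yn; rewrite seen_all.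
- by move=> x xn; rewrite S3 //; apply: eq_vsum => y yn; rewrite -row.
- by move=> x xn; rewrite S4 //; apply: eq_vsum => y yn; rewrite -row.
- by move=> x xn; rewrite S5 //; apply: eq_vsum => y yn; rewrite -row.
- by move=> x xn; rewrite S6 //; apply: eq_vsum => y yn; rewrite -row.
- move=> x y xn yn Exy; rewrite Sm //; have : x.+1 * n <= n * n by rewrite leq_mul2r xn orbT.
  rewrite mulSn => h; have -> : x * n + y < n * n by lia.
  rewrite -HE Exy E1; split; [lia|lia|split=> //].
  by apply: Sz; lia.
- move=> x y xn yn Exy; rewrite Sm //; have : x.+1 * n <= n * n by rewrite leq_mul2r xn orbT.
  rewrite mulSn => h; have -> : x * n + y < n * n by lia.
  by rewrite -HE (negPf Exy).
Qed.

Lemma run_prepare st n mu (E : rel nat) wo wi :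
  let b := 1 + n * n in
  0 < n -> cells st 0 = n ->
  (forall x y, x < n -> y < n -> cells st (mat n x y) = mu x y) ->
  (forall p, b <= p -> cells st p = 0) ->
  (forall x y, E x y = (mu x y != 0)) ->
  (forall x, x < n -> wo x = \sum_(y < n) mu x y) ->
  (forall x, x < n -> wi x = \sum_(y < n) mu y x) ->
  runs prepare st (prepare_cost n)
    (rep n b (net_key wo wi) E (fun _ _ => [::])).
Proof.
move=> b n_gt C0 Cm Cz HE Hwo Hwi; have nb : n * n < b by [].
rewrite /prepare /prepare_cost.
apply: runs_seq; apply: runs_flat => //.
have R0 : regs (run read_size st) 0 = n by [].
have C1 p : cells (run read_size st) p = if p == 0 then 0 else cells st p by [].
move: (run read_size st) R0 C1 => st1 R0 C1.
apply: runs_seq; apply: runs_weaken (run_square R0) (leqnn _) _ => st2 [R02 R10 C2].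
apply: runs_seq; apply: runs_flat; first by vm_compute.
have [] := run_bases R02 R10; move: (run bases st2) => st3 L3 R03 R13 C3.
rewrite -/b in L3 R13.
apply: runs_seq; apply: runs_flat => //; set st4 := run rewind st3.
have L4 : layout n b st4.
  by move=> j j14; rewrite /st4 run_frame ?L3 // !inE; lia.
have [R04 R14] : regs st4 0 = n /\ regs st4 1 = b + 14 * n.
  by rewrite /st4 !run_frame.
have [R5 R6 R43] : [/\ regs st4 5 = 0, regs st4 6 = 0 & regs st4 43 = 1] by [].
have C4 p : cells st4 p = if p == 0 then 0 else cells st p.
  by rewrite -C1 -C2 -C3.
clearbody st4.
have S0 : scanned n b mu 0 (cells st4).
  apply: (scanned_init nb); first by rewrite C4.
    move=> x y xn yn; rewrite C4; case: eqP => [e|_]; last exact: Cm.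
    by have := mat_bound nb xn yn; rewrite e.
  by move=> p bp; rewrite C4; case: eqP => // _; exact: Cz.
apply: runs_weaken (run_scan n_gt nb L4 R04 R5 R6 R43 S0) (leqnn _) _.
move=> st5 [F5 S5]; apply: (scanned_rep nb n_gt _ _ _ HE Hwo Hwi S5).
- by move=> j j14; rewrite F5 ?L4 //; do 14!(case: j j14 => [|j] j14 //).
- by rewrite F5.
- by rewrite F5 // R14.
Qed.

(** * Reading off the order and its cutwidth *)

(** When a single arc is left, its source is the only vertex with an out-neighbour. *)
Definition find_source : cmd :=
  Seq (Assign 3 (Cst 0))
    (While (Equal (Fetch (Add (Reg 13) (Reg 3))) (Cst 0)) (incr 3)).

Lemma run_find_source st s : cells st (regs st 13 + s) != 0 ->
  (forall x, x < s -> cells st (regs st 13 + x) = 0) ->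
  runs find_source st (2 + (s * 11 + 7)) (fun st' =>
    [/\ same_regs find_source st st', cells st' = cells st & regs st' 3 = s]).
Proof.
move=> Hs Hx; suff H : runs find_source st (2 + (s * 11 + 7)) (fun st' =>
    cells st' = cells st /\ regs st' 3 = s).
  by apply: runs_weaken (runs_frame H) (leqnn _) _ => st' [? []].
apply: runs_seq; apply: (@runs_flat (Assign _ _)) => //=.
pose I j st' := cells st' = cells st /\ j + regs st' 3 = s.
apply: (@runs_while I _ _ _ _ s) => [j st' F|j st' F|]; last first.
- by split=> //=; rewrite addn0.
- have f13 : regs st' 13 = regs st 13 by rewrite F.
  move=> [C E]; rewrite /= f13 C => ne.
  case: j E ne => [|j] E; first by rewrite add0n in E; rewrite E (negPf Hs).
  by move=> _; apply: runs_flat => //=; exists j => //; split=> //=; lia.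
- have f13 : regs st' 13 = regs st 13 by rewrite F.
  move=> [C E]; rewrite /= f13 C => e; split=> //.
  case: (ltngtP (regs st' 3) s) => // lt; last by lia.
  by rewrite Hx in e.
Qed.

(** Prepending a vertex to a sequence, the first component of [bmul] depends only on the first
    component of the sequence. Hence the order is traversed from its end, with one number in
    register 46. *)
Definition visit : cmd :=
  Seq (Store (Add (Reg 8) (Cst 1)) (Reg 5))
  (Seq (Assign 24 (Fetch (Add (Reg 11) (Reg 8))))
  (Seq (Assign 25 (Fetch (Add (Reg 12) (Reg 8))))
       (Assign 46 (Add (Sub (Reg 24) (Reg 25))
                       (Sub (Reg 46) (Sub (Reg 25) (Reg 24))))))).

Lemma cells_assign r e st : cells (run (Assign r e) st) = cells st.
Proof. by []. Qed.

Section Report.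
Variables (n b : nat) (wt : nat -> nat * nat) (p : seq nat).
Hypotheses (nb : n < b) (up : uniq p) (pn : all (ltn^~ n) p).

(** The positions go to cells 1 to n, over the first row of the matrix; the address of the last
    label has been fetched by then. *)
Definition visited j (c : nat -> nat) (st : state) : Prop :=
  [/\ regs st 46 = (bic wt (drop j p)).1,
      forall i, j <= i < size p -> cells st (nth 0 p i).+1 = i &
      forall q, ~~ (0 < q <= n) -> cells st q = c q].

Lemma run_visit st j c : layout n b st -> weighs b n wt c ->
  regs st 5 = j -> j < size p -> regs st 8 = nth 0 p j -> visited j.+1 c st ->
  visited j c (run visit st).
Proof.
move=> L Hw E5 jp E8 [V1 V2 V3].
have xn : nth 0 p j < n by move/all_nthP: pn; exact.
have E11 : regs st 11 = b + 1 * n := L 1 isT.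
have E12 : regs st 12 = b + 2 * n := L 2 isT.
split.
- rewrite /= E11 E12 E8 V1 (drop_nth 0 jp) /= Hw //=.
  case: eqP => [?|_]; first lia.
  case: eqP => [?|_]; first lia.
  by rewrite !V3 //; lia.
- move=> i /andP[]; rewrite leq_eqVlt => /orP[/eqP <- _|ji ip] /=.
    by rewrite E8 addn1 eqxx E5.
  rewrite E8 addn1 eqSS nth_uniq // (gtn_eqF ji); apply: V2; rewrite ji //.
- by move=> q Hq; rewrite /= E8; case: eqP => [?|_]; [lia|exact: V3].
Qed.

Lemma visited_eq j c st st' : regs st' 46 = regs st 46 -> cells st' = cells st ->
  visited j c st -> visited j c st'.
Proof. by move=> R C [V1 V2 V3]; split; rewrite ?R ?C. Qed.

End Report.

Definition fetch_last : cmd :=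
  Seq (Assign 4 (Fetch (Add (Reg 15) (Reg 3))))
  (Seq (Assign 34 (Fetch (Add (Fetch (Add (Reg 10) (Reg 3))) (Reg 4))))
  (Seq (Assign 37 (Fetch (Reg 34)))
  (Seq (Assign 46 (Cst 0))
  (Seq (Assign 8 (Reg 4))
       (Assign 5 (Add (Reg 37) (Cst 1))))))).

(** The length stored in front of a label takes one cell, just as the source takes position 0: cell
    j of the label holds the vertex of position j. *)
Definition walk_body : cmd :=
  Seq (Assign 8 (Fetch (Add (Reg 34) (Reg 5)))) (Seq visit (decr 5)).

Definition report : cmd :=
  Seq find_source (Seq fetch_last (Seq visit (Seq (Assign 5 (Reg 37))
  (Seq (While (Less (Cst 0) (Reg 5)) walk_body)
  (Seq (Assign 8 (Reg 3)) (Seq visit (Store (Cst 0) (Reg 46)))))))).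

Definition report_cost n :=
  (2 + (n * 11 + 7)) + (flat_cost fetch_last + (flat_cost visit + (2 +
  ((n * (4 + flat_cost walk_body) + 4) + (2 + (flat_cost visit + 3)))))).

Lemma run_report n b wt E L st s t (p : seq nat) :
  rep n b wt E L st -> E =2 edge s t -> s < n -> t < n ->
  p = s :: rcons (L s t) t -> uniq p -> all (ltn^~ n) p -> size p <= n ->
  runs report st (report_cost n) (fun st' =>
    cells st' 0 = (bic wt p).1 /\
    forall i, i < size p -> cells st' (nth 0 p i).+1 = i).
Proof.
move=> [L0 En nb HF m0 Hrows Hw Hod Hid Hos His Harc Hno] HE sn tn Ep up pn szp.
have n_gt : 0 < n by lia.
have nb' : n < b by apply: leq_ltn_trans nb; rewrite leq_pmull.
have E10 : regs st 10 = b by have := L0 0 isT; rewrite mul0n !addn0.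
have E13 : regs st 13 = b + 3 * n := L0 3 isT.
have E15 : regs st 15 = b + 5 * n := L0 5 isT.
have Est : E s t by rewrite HE /edge !eqxx.
have h1 : cells st (regs st 13 + s) != 0.
  by rewrite E13 Hod // (@vsum_pred1 _ _ _ t) // => y; rewrite HE /edge eqxx.
have h2 x : x < s -> cells st (regs st 13 + x) = 0.
  move=> xs; rewrite E13 Hod ?(ltn_trans xs) // vsum_pred0 // => y.
  by rewrite HE /edge (ltn_eqF xs).
have sumE : cells st (b + 5 * n + s) = t.
  by rewrite Hos // (@vsum_pred1 _ _ _ t) // => y; rewrite HE /edge eqxx.
have [a1 a2 [a3 a4]] := Harc s t sn tn Est.
set l := L s t in Ep a3 a4.
have szl : size p = (size l).+2 by rewrite Ep /= size_rcons.
rewrite /report /report_cost.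
apply: runs_seq; apply: runs_weaken (run_find_source h1 h2) _ _.
  by rewrite leq_add2l leq_add2r leq_mul2r (ltnW sn) orbT.
move=> st1 [F1 C1 R3].
apply: runs_seq; apply: runs_flat => //.
have F2 r : r \notin [:: 3; 4; 34; 37; 46; 8; 5] -> regs (run fetch_last st1) r = regs st r.
  by move=> Hr; rewrite run_frame ?F1 //; move: Hr; rewrite !inE !negb_or => /and4P[a b0 c0 /and4P[d e f g]]; rewrite ?a ?b0 ?c0 ?d ?e ?f ?g.
have R23 : regs (run fetch_last st1) 3 = s by rewrite run_frame.
have e4 : cells st1 (regs st1 15 + regs st1 3) = t by rewrite F1 // E15 R3 C1.
have e34 : cells st1 (cells st1 (regs st1 10 + regs st1 3) + t) = cells st (mat n s t).
  by rewrite F1 // E10 R3 C1 Hrows.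
have [R34 [R37 R46] [R8 R5]] : [/\ regs (run fetch_last st1) 34 = cells st (mat n s t),
   regs (run fetch_last st1) 37 = size l /\ regs (run fetch_last st1) 46 = 0 &
   regs (run fetch_last st1) 8 = t /\ regs (run fetch_last st1) 5 = (size l).+1].
  by rewrite /= e4 e34 C1 a3 addn1.
have C2 : cells (run fetch_last st1) = cells st by rewrite /= C1.
move: (run fetch_last st1) F2 R23 R34 R37 R46 R8 R5 C2 => st2 F2 R23 R34 R37 R46 R8 R5 C2.
have L2 : layout n b st2.
  by move=> j j14; rewrite F2 ?L0 // !inE; lia.
have pt : nth 0 p (size l).+1 = t by rewrite Ep /= nth_rcons ltnn eqxx.
have V2 : visited n wt p (size l).+2 (cells st) st2.
  split; [by rewrite -szl drop_size R46| |by rewrite C2].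
  by move=> i; rewrite szl; lia.
have V3 : visited n wt p (size l).+1 (cells st) (run visit st2).
  by apply: (run_visit nb' up pn L2 Hw R5 _ _ V2); rewrite ?szl ?R8 ?pt.
apply: runs_seq; apply: runs_flat => //.
have F3 r : r \notin assigned visit -> regs (run visit st2) r = regs st2 r.
  by move=> Hr; rewrite run_frame.
move: (run visit st2) F3 V3 => st3 F3 V3.
apply: runs_seq; apply: (@runs_flat (Assign _ _)) => //.
set st4 := run (Assign 5 (Reg 37)) st3.
pose I j st' := [/\ regs st' 5 = j, j <= size l & visited n wt p j.+1 (cells st) st'].
have Lp x : x \in l -> x \in p by rewrite Ep inE mem_rcons inE => ->; rewrite !orbT.
have lt_l : size l <= n by lia.
apply: runs_seq.
apply: (@runs_weaken _ _ (size l * (4 + flat_cost walk_body) + 4) _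
  (fun st' => same_regs walk_body st4 st' /\
     visited n wt p 1 (cells st) st' /\ regs st' 5 = 0)).
- apply: runs_frame.
  apply: (@runs_while I _ _ _ _ (size l)) => [j st' F|j st' F|]; last first.
  + by split=> //=; rewrite F3.
  + move=> [R5' jl V]; rewrite /= R5' => j_gt.
    case: j R5' jl V j_gt => // j R5' jl V _.
    have G r : r \notin [:: 5; 8; 24; 25; 46] -> regs st' r = regs st2 r.
      move=> Hr; rewrite F; last first.
        by move: Hr; rewrite !inE; do 5!case: eqP => //=.
      rewrite /st4 run_frame //; last by move: Hr; rewrite !inE; case: eqP.
      by apply: F3; move: Hr; rewrite !inE; do 5!case: eqP => //=.
    have pj : nth 0 p j.+1 = nth 0 l j by rewrite Ep /= nth_rcons jl.
    have x8 : cells st' (regs st' 34 + regs st' 5) = nth 0 p j.+1.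
      have [_ _ V3'] := V; rewrite G // R34 R5' V3'; last by lia.
      by rewrite pj -a4 // addnS.
    apply: runs_flat => //; exists j => //.
    rewrite /walk_body (run_seqE (Assign 8 _)) (run_seqE visit).
    have R8' : regs (run (Assign 8 (Fetch (Add (Reg 34) (Reg 5)))) st') 8 = nth 0 p j.+1.
      by rewrite -x8.
    have R6 r : r \notin [:: 8] -> regs (run (Assign 8 (Fetch (Add (Reg 34) (Reg 5)))) st') r = regs st' r.
      by move=> Hr; rewrite run_frame.
    have C6 := cells_assign 8 (Fetch (Add (Reg 34) (Reg 5))) st'.
    move: (run (Assign 8 _) st') R8' R6 C6 => st6 R8' R6 C6.
    have L6 : layout n b st6 by move=> k k14; rewrite R6 ?G ?L2 // !inE; lia.
    have V6 : visited n wt p j.+2 (cells st) st6 by apply: visited_eq V; rewrite ?R6.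
    have R56 : regs st6 5 = j.+1 by rewrite R6.
    have V7 : visited n wt p j.+1 (cells st) (run visit st6).
      by apply: (run_visit nb' up pn L6 Hw R56 _ R8' V6); rewrite szl; lia.
    have R57 : regs (run visit st6) 5 = j.+1 by rewrite run_frame.
    move: (run visit st6) V7 R57 => st7 V7 R57; split.
    * by rewrite /= R57 subn1.
    * exact: ltnW.
    * by apply: visited_eq V7; [rewrite run_frame|rewrite cells_assign].
  + by move=> [R5' jl V]; rewrite /= R5'; case: j R5' jl V.
- by apply: leq_add => //; apply: leq_mul.
move=> st5 [F5 [V5 R55]].
have R53 : regs st5 3 = s by rewrite F5 // /st4 run_frame // F3.
have L5 : layout n b st5.
  move=> j j14; rewrite F5; last by rewrite !inE; lia.
  rewrite /st4 run_frame //.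
  by rewrite F3 ?L2 // !inE; lia.
apply: runs_seq; apply: (@runs_flat (Assign _ _)) => //.
have R8' : regs (run (Assign 8 (Reg 3)) st5) 8 = s by rewrite -R53.
have R6 r : r \notin [:: 8] -> regs (run (Assign 8 (Reg 3)) st5) r = regs st5 r.
  by move=> Hr; rewrite run_frame.
have C6 := cells_assign 8 (Reg 3) st5.
move: (run (Assign 8 _) st5) R8' R6 C6 => st6 R8' R6 C6.
have L6 : layout n b st6 by move=> k k14; rewrite R6 ?L5 // !inE; lia.
have V6 : visited n wt p 1 (cells st) st6 by apply: visited_eq V5; rewrite ?R6.
have R56 : regs st6 5 = 0 by rewrite R6.
have V7 : visited n wt p 0 (cells st) (run visit st6).
  by apply: (run_visit nb' up pn L6 Hw R56 _ _ V6); rewrite ?R8' Ep.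
apply: runs_seq; apply: runs_flat => //.
move: (run visit st6) V7 => st7 [V71 V72 _].
apply: (@runs_flat (Store _ _)) => //; split; first by rewrite /= V71 drop0.
by move=> i ip; rewrite /=; exact: V72.
Qed.

(** * Invariant of the whole reduction *)

(** All labels are empty at the start, so [wl_cover] requires every vertex to be incident to an
    arc. *)
Lemma spd_touched n (G : mdigraph n) s t : spd G s t ->
  forall v, exists a : arc G, src a = v \/ dst a = v.
Proof.
elim=> {n G s t}.
- move=> G s t st /eqP; rewrite -cardsT => /cards1P [a Ha] H v; exists a.
  have [-> ->] := H a; move: st; rewrite -val_eqE /=.
  move: s t v {H Ha} => [[|[|s]] Hs] [[|[|t]] Ht] [[|[|v]] Hv] //= _;
    by [left; apply: val_inj|right; apply: val_inj].
- move=> n1 n2 n G1 G2 G s1 t1 s2 t2 f1 f2 _ IH1 _ IH2 [_ _ Hc _ [g [_ H1 H2]]] v.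
  case: (Hc v) => [] [x <-].
    have [a Ha] := IH1 x; exists (g (inl a)); have [-> ->] := H1 a.
    by case: Ha => <-; [left|right].
  have [a Ha] := IH2 x; exists (g (inr a)); have [-> ->] := H2 a.
  by case: Ha => <-; [left|right].
- move=> n1 n2 n G1 G2 G s1 t1 s2 t2 f1 f2 _ IH1 _ IH2 [_ _ Hc _ [g [_ H1 H2]]] v.
  case: (Hc v) => [] [x <-].
    have [a Ha] := IH1 x; exists (g (inl a)); have [-> ->] := H1 a.
    by case: Ha => <-; [left|right].
  have [a Ha] := IH2 x; exists (g (inr a)); have [-> ->] := H2 a.
  by case: Ha => <-; [left|right].
Qed.

Section Reached.
Variables (n : nat) (wo wi : nat -> nat) (E0 : rel nat) (s t : nat).
Hypothesis st : s != t.
Let kv := net_key wo wi.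
Let L0 : nat -> nat -> seq nat := fun _ _ => [::].

(** Contractions may discard feasible orders, but they create none and always keep one that is at
    least as good as any given order. *)
Record reached (k : nat) (E : rel nat) (L : nat -> nat -> seq nat) : Prop := Reached {
  re_reds : reds k E (edge s t);
  re_bound : forall x y, E x y -> x < n /\ y < n;
  re_labelled : well_labelled n E L;
  re_sound : forall p, feasible n E L p -> feasible n E0 L0 p;
  re_optimal : forall p, feasible n E0 L0 p ->
    exists2 p', feasible n E L p' & better kv p' p
}.

Lemma reached_step k E L u v w bA bB : reached k.+1 E L -> inner E u v w -> u != w ->
  glued kv (singles (side_label E L u w)) bA ->
  glued kv (singles (through_label L u v w)) bB ->
  sorted (block_le kv) bA -> sorted (block_le kv) bB ->
  reached k (contract E u v w) (relabel wo wi L u w bA bB).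
Proof.
move=> [R B W S O] Hi uw gA gB sA sB; split.
- by have [k' [->]] := reds_inner st R Hi.
- move=> x y /and3P[_ _ /orP[/B //|/andP[/eqP -> /eqP ->]]].
  have [H1 H2 _ _] := Hi.
  have [un _] := B u v (eq_trans (H1 u) (eqxx u)).
  by have [_ wn] := B v w (eq_trans (H2 w) (eqxx w)).
- exact: well_labelled_step W Hi gA gB.
- by move=> p Hp; apply: S; exact: (feasible_coarsen Hi gA gB Hp).
- move=> p /O [p1 Hp1 b1].
  have [p2 Hp2 b2] := feasible_refine W Hi gA gB sA sB Hp1.
  by exists p2 => //; exact: better_trans b2 b1.
Qed.

End Reached.

(** Sorts the vertices by rank. The resulting order is the first feasible one; through [re_optimal]
    it gives a feasible order at every stage, and so the bounds on the labels. *)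
Lemma topological_seq n (E : rel nat) (h : nat -> nat) :
  (forall x y, E x y -> h x < h y) -> (forall x y, E x y -> x < n /\ y < n) ->
  exists2 p, perm_eq p (iota 0 n) & forall x y, E x y -> index x p < index y p.
Proof.
move=> Hh B; pose p := sort (fun x y => h x <= h y) (iota 0 n).
exists p; first by rewrite perm_sort.
have mp x : (x \in p) = (x < n) by rewrite mem_sort mem_iota.
have tr : transitive (fun x y => h x <= h y) by move=> x y z; exact: leq_trans.
have so : sorted (fun x y => h x <= h y) p by apply: sort_sorted => x y; exact: leq_total.
move=> x y Exy; have [xn yn] := B _ _ Exy; have hxy := Hh _ _ Exy.
rewrite ltnNge; apply/negP; rewrite leq_eqVlt => /orP[/eqP e|lt].
  have exy : y = x by rewrite -(nth_index 0 (_ : y \in p)) ?mp // e nth_index ?mp.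
  by rewrite exy ltnn in hxy.
have := sorted_ltn_index tr so; rewrite /= => /(_ y x).
by rewrite !mp => /(_ yn xn lt); rewrite leqNgt hxy.
Qed.

(** * The input word *)

Lemma nth_flatten_rows (T : Type) (d : T) (ss : seq (seq T)) m i j :
  all (fun s => size s == m) ss -> j < m -> i < size ss ->
  nth d (flatten ss) (i * m + j) = nth d (nth [::] ss i) j.
Proof.
elim: ss i => [|s ss IH] [|i] //= /andP[/eqP sm H] jm; rewrite nth_cat sm.
  by rewrite mul0n add0n jm.
rewrite ltnS => i_lt; rewrite mulSn -addnA ltnNge leq_addr /= addKn.
exact: IH.
Qed.

Section Input.
Variables (n : nat) (G : mdigraph n).

Definition mult (x y : nat) :=
  #|[set a : arc G | (src a == x :> nat) && (dst a == y :> nat)]|.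

Lemma nadj_mult x y : nadj G x y = (mult x y != 0).
Proof.
rewrite /mult cards_eq0; apply/nadjP/set0Pn => [[a e1 e2]|[a]].
  by exists a; rewrite inE e1 e2 !eqxx.
by rewrite inE => /andP[/eqP e1 /eqP e2]; exists a.
Qed.

Lemma wout_mult x : wout G x = \sum_(y < n) mult x y.
Proof.
rewrite /wout -sum1_card (partition_big (fun a => dst a) xpredT) //=.
apply: eq_bigr => y _; rewrite /mult -sum1_card; apply: eq_bigl => a.
by rewrite !inE.
Qed.

Lemma win_mult x : win G x = \sum_(y < n) mult y x.
Proof.
rewrite /win -sum1_card (partition_big (fun a => src a) xpredT) //=.
apply: eq_bigr => y _; rewrite /mult -sum1_card; apply: eq_bigl => a.
by rewrite !inE andbC.
Qed.

Lemma input_mult x y : x < n -> y < n ->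
  cells (initial_state (input_word G)) (mat n x y) = mult x y.
Proof.
move=> xn yn; rewrite /mat -addnA /=.
rewrite (@nth_flatten_rows _ 0 _ n) //; last by rewrite size_map size_enum_ord.
  rewrite (nth_map (Ordinal xn)) ?size_enum_ord //.
  rewrite (nth_map (Ordinal yn)) ?size_enum_ord //.
  rewrite /multiplicity /mult; apply: eq_card => a.
  by rewrite !inE -!val_eqE /= !nth_enum_ord.
by apply/allP => l /mapP[v _ ->]; rewrite size_map size_enum_ord.
Qed.

Lemma input_end p : 1 + n * n <= p -> cells (initial_state (input_word G)) p = 0.
Proof.
move=> np; apply: nth_default; rewrite /= size_allpairs size_enum_ord.
exact: np.
Qed.

End Input.

(** * The complete program, its cost and its correctness *)

(** Counting from 2 up to n performs the n - 2 contractions without computing n - 2. *)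
Definition reduce_all : cmd :=
  Seq (Assign 31 (Cst 2)) (While (Less (Reg 31) (Reg 0)) (Seq step (incr 31))).

Definition cutwidth_program : cmd := Seq prepare (Seq reduce_all report).

Lemma run_reduce_all n b wo wi E0 s t st L0 : s != t -> 1 < n ->
  rep n b (net_key wo wi) E0 L0 st ->
  reached n wo wi E0 s t (n - 2) E0 L0 ->
  (exists p, feasible n E0 (fun _ _ => [::]) p) ->
  runs reduce_all st (2 + ((n - 2) * (4 + (step_cost n + 4)) + 4)) (fun st' =>
    exists E L, rep n b (net_key wo wi) E L st' /\ reached n wo wi E0 s t 0 E L).
Proof.
move=> ne n_gt R0 H0 [p0 Hp0].
apply: runs_seq; apply: (@runs_flat (Assign _ _)) => //.
set st0 := run _ st.
have sz k E L x y : reached n wo wi E0 s t k E L -> E x y -> size (L x y) < n.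
  by move=> H Exy; have [p1 Hp1 _] := re_optimal H Hp0; have [] := feasible_label Hp1 Exy.
pose I k st' := exists E L, [/\ k + regs st' 31 = n,
  rep n b (net_key wo wi) E L st' & reached n wo wi E0 s t k E L].
apply: (@runs_while I _ _ _ _ (n - 2)) => [k st' F|k st' F|]; last first.
- exists E0, L0; split=> //=; first lia.
  apply: rep_frame R0 (fun x y => sz _ _ _ x y H0) _ _ => // r Hr.
  by rewrite /st0 run_frame //; move: r Hr; exact/allP.
- move=> [E [L [Ek R H]]]; rewrite /= (rep_n R); case: ltnP => // lt _.
  case: k Ek H => [|k] Ek H; first by rewrite add0n in Ek; rewrite Ek ltnn in lt.
  have [p1 Hp1 _] := re_optimal H Hp0.
  (* The abstract reduction only certifies that an inner vertex exists; the program may contract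
     another one. *)
  have [u [v [w [Hi _]]]] := re_reds H.
  apply: runs_seq; apply: runs_weaken (run_step R (re_bound H) (re_labelled H) _ _) (leqnn _) _.
  + by exists p1.
  + by exists u, v, w.
  move=> st2 [F2 [u' [v' [w' [bA [bB [[Hi' uw] gA gB [sA sB] R2]]]]]]].
  have H2 := reached_step ne H Hi' uw gA gB sA sB.
  apply: (@runs_flat (incr 31)) => //; exists k => //.
  exists (contract E u' v' w'), (relabel wo wi L u' w' bA bB); split=> //.
  + by rewrite /= F2 // -Ek; lia.
  + apply: rep_frame R2 (fun x y => sz _ _ _ x y H2) _ _ => // r Hr.
    by rewrite run_frame //; move: r Hr; exact/allP.
- move=> [E [L [Ek R H]]]; rewrite /= (rep_n R); case: ltnP => // le _.
  exists E, L; split=> //.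
  by have <- : k = 0 by lia.
Qed.

Lemma cutwidth_cost n : 1 < n ->
  prepare_cost n + (2 + ((n - 2) * (4 + (step_cost n + 4)) + 4) + report_cost n)
  <= 2000 * n ^ 2.
Proof.
move=> n_gt; rewrite /prepare_cost /step_cost /canon_cost /merge_cost /report_cost.
have -> : flat_cost pool_body = 100 by vm_compute.
have -> : flat_cost spread_body = 38 by vm_compute.
have -> : flat_cost fetch_labels = 43 by vm_compute.
have -> : flat_cost load_side = 6 by vm_compute.
have -> : flat_cost load_through = 4 by vm_compute.
have -> : flat_cost update = 107 by vm_compute.
have -> : flat_cost (Seq select_body emit_body) = 74 by vm_compute.
have -> : flat_cost read_size = 6 by vm_compute.
have -> : flat_cost bases = 56 by vm_compute.
have -> : flat_cost rewind = 6 by vm_compute.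
have -> : flat_cost scan_body = 93 by vm_compute.
have -> : flat_cost fetch_last = 24 by vm_compute.
have -> : flat_cost visit = 25 by vm_compute.
have -> : flat_cost walk_body = 34 by vm_compute.
set q := (X in (n - 2) * X).
(* A generous 1000 n per contraction; the other 1000 n^2 covers the preparation and the report,
   linear terms being absorbed by 2 n <= n^2. *)
have q_le : (n - 2) * q <= n * (1000 * n).
  by apply: leq_mul; [exact: leq_subr|rewrite /q; lia].
have nn : 2 * n <= n * n by rewrite leq_mul2r n_gt orbT.
by move: q_le; rewrite mulnCA mulnn => ?; rewrite mulnn in nn *; lia.
Qed.

Theorem theorem4p6 :
  exists (P : cmd) (c : nat),
    forall (n : nat) (G : mdigraph n), is_spd G ->
      exists (T : nat) (st : state) (cw : nat) (sigma : 'S_n),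
        [/\ exec P (initial_state (input_word G)) T st,
            T <= c * n ^ 2,
            mkseq (cells st) n.+1 = output_word cw sigma,
            is_cutwidth G cw
          & topological G sigma /\ order_cutwidth G sigma = cw].
Proof.
exists cutwidth_program, 2000 => n G HG.
have [n_gt [s [t [ne sn tn R]]]] := is_spd_reds HG.
have n_gt0 : 0 < n := ltnW n_gt.
pose E0 := nadj G; pose wo := wout G; pose wi := win G.
have B0 x y : E0 x y -> x < n /\ y < n by move=> /nadjP [a <- <-].
have [h Hh] := reds_rank ne R.
have [p0 Pp0 Hp0] := topological_seq Hh B0.
have Fp0 : feasible n E0 (fun _ _ => [::]) p0 by apply/(feasible_nil B0 Pp0).
have W0 : well_labelled n E0 (fun _ _ => [::]).
  apply: well_labelled_nil => x xn; have [s' [t' /spd_touched H]] := HG.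
  have [a [e|e]] := H (Ordinal xn).
    by exists (dst a); apply/orP; left; apply/nadjP; exists a; rewrite ?e.
  by exists (src a); apply/orP; right; apply/nadjP; exists a; rewrite ?e.
have H0 : reached n wo wi E0 s t (n - 2) E0 (fun _ _ => [::]).
  by split=> // p Hp; exists p => //; exact: dom_refl.
have Hprog : runs cutwidth_program (initial_state (input_word G)) (2000 * n ^ 2)
  (fun st => exists E L, [/\ reached n wo wi E0 s t 0 E L,
     cells st 0 = (bic (net_key wo wi) (s :: rcons (L s t) t)).1 &
     forall i, i < n -> cells st (nth 0 (s :: rcons (L s t) t) i).+1 = i]).
  apply: runs_weaken (cutwidth_cost n_gt) (fun _ H => H).
  apply: runs_seq; apply: runs_weaken (run_prepare n_gt0 _ _ _ _ _ _) (leqnn _) _.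
  - by [].
  - by move=> x y xn yn; exact: input_mult.
  - by move=> p; exact: input_end.
  - by move=> x y; exact: nadj_mult.
  - by move=> x _; exact: wout_mult.
  - by move=> x _; exact: win_mult.
  move=> st1 R1; apply: runs_seq.
  apply: runs_weaken (run_reduce_all ne n_gt R1 H0 _) (leqnn _) _; first by exists p0.
  move=> st2 [E [L [R2 H]]].
  have HE : E =2 edge s t := re_reds H.
  have [p1 Hp1 _] := re_optimal H Fp0.
  have Ep := feasible_edge HE (re_labelled H) Hp1.
  have [Hperm _] := Hp1.
  have sp : size p1 = n by rewrite (perm_size Hperm) size_iota.
  have ap : all (ltn^~ n) p1 by apply/allP => x; rewrite (perm_mem Hperm) mem_iota.
  have Hr := run_report R2 HE sn tn Ep (feasible_uniq Hp1) ap.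
  rewrite sp leqnn in Hr; apply: runs_weaken (Hr isT) (leqnn _) _ => st3 [C0 Ci].
  by exists E, L; split=> //; rewrite -?Ep.
have [T [st [Hex HT [E [L [H C0 Ci]]]]]] := Hprog.
have HE : E =2 edge s t := re_reds H.
set p := s :: rcons (L s t) t in C0 Ci.
(* The last graph admits no other order, so the order reported by the program is both sound and
   optimal. *)
have Fp q : feasible n E L q -> q = p by exact: feasible_edge HE (re_labelled H).
have [p1 Hp1 _] := re_optimal H Fp0; have Ep1 := Fp _ Hp1; rewrite {}Ep1 in Hp1.
have [Pp Rp] : perm_eq p (iota 0 n) /\ respects G p.
  have Hf := re_sound H Hp1; have [Hp _] := Hf; split=> //.
  by move/(feasible_nil B0 Hp): Hf.
have [sigma Hs] := positions_exist Pp.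
have Ts : topological G sigma by apply/(positions_topological G Hs).
have Es := order_cutwidth_bic Hs Ts.
exists T, st, (order_cutwidth G sigma), sigma; split=> //.
- rewrite /output_word Es -C0 /mkseq -[iota 0 n.+1]/(0 :: iota 1 n) map_cons.
  congr (_ :: _).
  apply: (@eq_from_nth _ 0); first by rewrite size_map size_iota size_map size_enum_ord.
  rewrite size_map size_iota => i i_lt.
  rewrite (nth_map 0) ?size_iota // nth_iota // (nth_map (Ordinal i_lt)) ?size_enum_ord //.
  have [_ <-] := Hs; rewrite /= nth_enum_ord //.
  have ip : i \in p by rewrite (perm_mem Pp) mem_iota.
  have lt : index i p < n by rewrite -[X in _ < X](size_iota 0 n) -(perm_size Pp) index_mem.
  by have := Ci _ lt; rewrite nth_index.
- split; first by exists sigma.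
  move=> sigma' Ts'; have [q Hq] := positions_of sigma'.
  rewrite Es (order_cutwidth_bic Hq Ts').
  have Fq : feasible n E0 (fun _ _ => [::]) q.
    have [Pq _] := Hq; apply/(feasible_nil B0 Pq).
    by apply/(positions_topological G Hq).
  (* The order that dominates [q] is feasible for the last graph, hence equal to [p]. *)
  by have [q' /Fp -> []] := re_optimal H Fq.
Qed.
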